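(* Let $D\in\{\mathbb R,\mathbb R^+\}$, let $F:D\to\mathbb R$ be a warping function with $w=(F^{-1})'$, and let $\theta\in\mathbf L^2_{\sqrt w}(\mathbb R)\cap\mathbf L^2(\mathbb R)$ be nonzero. Then any $f\in\mathcal F^{-1}(\mathbf L^2(D))$ can be reconstructed from $V_{\theta,F}f$ by $$f=\frac1{\|\theta\|_{\mathbf L^2}^2}\int_D\int_{\mathbb R}V_{\theta,F}f(x,\xi)\,g_{x,\xi}\,d\xi\,dx,$$ where the equation holds in the weak sense.
   Context: $\mathbb R^+=(0,\infty)$. A weight function $v:\mathbb R\to\mathbb R^+$ is submultiplicative if $v(x+y)\le v(x)v(y)$; a weight function $w:\mathbb R\to\mathbb R^+$ is $v$-moderate if $w(x+y)\le Cv(x)w(y)$ for some submultiplicative weight $v$ and constant $C<\infty$. A bijective function $F:D\to\mathbb R$ is a warping function if $F\in\mathcal C^1(D)$, $F'>0$, $|t_0|<|t_1|\Rightarrow F'(t_1)<F'(t_0)$, and the weight $w(t)=(F^{-1})'(t)=1/F'(F^{-1}(t))$ is $v$-moderate for some submultiplicative weight $v$; if $D=\mathbb R$, $F$ is additionally required to be odd. $\mathbf L^2_{\sqrt w}(\mathbb R)$ is the space of $\theta:\mathbb R\to\mathbb C$ with $\sqrt w\,\theta\in\mathbf L^2(\mathbb R)$. Fourier transform: $\hat f(\xi)=\mathcal Ff(\xi)=\int_{\mathbb R}f(t)e^{-2\pi it\xi}dt$, extended unitarily to $\mathbf L^2(\mathbb R)$; $\check g=\mathcal F^{-1}g$. $\mathbf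 L^2(D)$ is viewed as a subspace of $\mathbf L^2(\mathbb R)$ by zero extension. $\mathbf T_xf=f(\cdot-x)$. For $(x,\xi)\in D\times\mathbb R$ let $g_x:=\sqrt{F'(x)}\,(\mathbf T_{F(x)}\theta)\circ F\in\mathbf L^2(D)$ and $g_{x,\xi}:=\mathbf T_\xi\,\check{g_x}$. The $F$-warped time-frequency transform of $f\in\mathcal F^{-1}(\mathbf L^2(D))$ is $V_{\theta,F}f(x,\xi)=\langle f,g_{x,\xi}\rangle$. ''In the weak sense'' means equality after taking inner products with every $f_2\in\mathcal F^{-1}(\mathbf L^2(D))$. *)

(* Defs.v *)
From HB Require Import structures.
From mathcomp Require Import all_boot all_order all_algebra.
From mathcomp Require Import complex.
From mathcomp Require Import all_classical all_reals all_analysis.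

Set Implicit Arguments.
Unset Strict Implicit.
Unset Printing Implicit Defensive.
Import Order.TTheory GRing.Theory Num.Theory.
Import numFieldNormedType.Exports.

Local Open Scope classical_set_scope.
Local Open Scope ring_scope.
Local Open Scope complex_scope.

Section warping.
Context {R : realType}.
Implicit Types (v w F : R -> R) (D : set R).

Definition weight_function v := forall x, 0 < v x.

Definition submultiplicative v := forall x y, v (x + y) <= v x * v y.

Definition moderate v w :=
  exists C : R, forall x y, w (x + y) <= C * v x * w y.

(* [F] is a total function on [R], but only its values on [D] matter. *)
Definition warping_weight D F : R -> R := derive1 (pinv D F).

(* As [D] is open in the two cases of interest, [F \in C^1(D)] is expressed
   with two-sided derivatives. *)
Definition warping_function D F :=
  [/\ set_bij D setT F,
      {in D, forall t, derivable F t 1} /\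
        {in D, forall t, {for t, continuous (derive1 F)}},
      {in D, forall t, 0 < derive1 F t},
      {in D &, forall t0 t1, `|t0| < `|t1| -> derive1 F t1 < derive1 F t0} &
      (exists v, [/\ weight_function v, submultiplicative v,
                     weight_function (warping_weight D F) &
                     moderate v (warping_weight D F)]) /\
        (D = setT -> forall t, F (- t) = - F t)].

End warping.

(* Complex-valued functions are handled through their real and imaginary parts,
   and elements of L^2 through Borel representatives. *)
Section complex_integration.
Context {R : realType}.
Local Notation mu := (@lebesgue_measure R).
Implicit Types (D : set R) (f g : R -> R[i]).

Definition cmeasurable f :=
  measurable_fun setT (fun t => complex.Re (f t)) /\
  measurable_fun setT (fun t => complex.Im (f t)).

Definition cintegrable D f :=
  mu.-integrable D (fun t => (complex.Re (f t))%:E) /\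
  mu.-integrable D (fun t => (complex.Im (f t))%:E).

Definition cintegral D f : R[i] :=
  Rintegral mu D (fun t => complex.Re (f t)) +i*
  Rintegral mu D (fun t => complex.Im (f t)).

Definition norm2 f : \bar R :=
  Lnorm mu 2%:E (fun t => (ComplexField.Normc.normc (f t))%:E).

Definition L2 f := cmeasurable f /\ (norm2 f < +oo)%E.

Definition L2w (w : R -> R) f := L2 (fun t => (Num.sqrt (w t))%:C * f t).

(* L^2(D), seen inside L^2(R) by zero extension. *)
Definition L2on D f := L2 f /\ forall t, ~ D t -> f t = 0.

Definition inner f g : R[i] := cintegral setT (fun t => f t * conjc (g t)).

Definition translate (x : R) f : R -> R[i] := fun t => f (t - x).

End complex_integration.

Section fourier.
Context {R : realType}.
Implicit Types (D : set R) (f h : R -> R[i]).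

Definition cexpi (a : R) : R[i] := cos a +i* sin a.

Definition fourier f (xi : R) : R[i] :=
  cintegral setT (fun t => f t * cexpi (- (2 * pi * t * xi))).

(* [h] represents the Fourier transform of [f] in L^2: it is the value at [f]
   of the extension by continuity of [fourier] from L^1 `&` L^2 to L^2. *)
Definition is_fourierL2 f h :=
  [/\ L2 f, L2 h &
      exists u : nat -> R -> R[i],
        [/\ forall n, cintegrable setT (u n) /\ L2 (u n),
            norm2 (fun t => u n t - f t) @[n --> \oo] --> 0%E &
            norm2 (fun xi => fourier (u n) xi - h xi) @[n --> \oo] --> 0%E]].

(* A representative of the inverse Fourier transform of [h]; the default value
   is only used if [h] is not in the range of the Fourier transform. *)
Definition inv_fourierL2 h : R -> R[i] :=
  xget (cst 0) [set f | is_fourierL2 f h].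

Definition inv_fourier_image D : set (R -> R[i]) :=
  [set f | exists2 h, L2on D h & is_fourierL2 f h].

End fourier.

Section warped_transform.
Context {R : realType}.
Variables (D : set R) (F : R -> R) (theta : R -> R[i]).

Definition warped_atom_freq (x : R) : R -> R[i] :=
  patch (cst 0) D
    (fun t => (Num.sqrt (derive1 F x))%:C * translate (F x) theta (F t)).

Definition warped_atom (x xi : R) : R -> R[i] :=
  translate xi (inv_fourierL2 (warped_atom_freq x)).

Definition warped_transform (f : R -> R[i]) (x xi : R) : R[i] :=
  inner f (warped_atom x xi).

End warped_transform.

(* Main.v *)
Require Import Defs.
From HB Require Import structures.
From mathcomp Require Import all_boot all_order all_algebra.
From mathcomp Require Import complex.
From mathcomp Require Import all_classical all_reals all_analysis.
From mathcomp Require Import measurable_realfun ring lra.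

(** On the Fourier side the transform is elementary. If [h] is the transform of
    [f], Parseval's formula turns [V f (x, xi)] into the inner product of [h]
    with the modulation of the frequency atom [g_x] by [exp (- 2 i pi xi t)],
    that is, into the value at [- xi] of the Fourier transform of
    [h * conj g_x]; the other factor of the integrand is likewise the conjugate
    of the transform of [h2 * conj g_x], where [h2] is the transform of [f2].
    For almost every [x] these two products lie in L^1 and in L^2, so that
    Plancherel's formula in [xi] evaluates the inner integral as the integral
    of [h * conj h2 * |g_x|^2]. By Fubini's theorem it remains to integrate
    [|g_x (t)|^2 = F' x * |theta (F t - F x)|^2] over [x] in [D]; the
    substitution [y = F x] gives the squared norm of [theta], for every [t] in
    [D] ([mass_warped_kernel]). The same computation, with [|h|^2] in place of
    [h * conj h2], is what makes the products square integrable for almost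
    every [x]. That [g_x] itself lies in L^2 comes from the moderateness of the
    weight [w] ([L2_warped_kernel]): since [w (F t) * F' t = 1], the energy of
    [g_x] is at most a constant depending on [x] times the energy of [theta]
    weighted by [w]. These steps are assembled in [weak_inversion].

    What is used of the Fourier transform on L^2 is Parseval's formula
    ([parseval]) and surjectivity ([fourierL2_surj]), as the atoms are inverse
    transforms.

    - Plancherel's formula is first proved for a real function [a] of L^1 and
      L^2, whose spectral density is the sum of the squares of its cosine and
      sine transforms ([integral_spectral_density]). Against a damping factor
      [exp (- e |xi|)], the integral of the spectral density is that of the
      autocorrelation of [a] against a Poisson kernel. As [e] tends to 0 the
      first converges by monotone convergence, and the second to the
      autocorrelation at 0, because translation is continuous in L^2. The
      complex case follows by adding the identities for the real and the
      imaginary part ([plancherel_L1]), and Parseval's formula by density and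
      polarization.

    - For surjectivity, let [p] be in L^1 and L^2 and let [q] be its inverse
      transform. The multiplication formula shows that the transform of [q]
      cut off to [[- n, n]] is at distance from [p] exactly the norm of [q]
      outside [[- n, n]] ([cenergy_fourier_inversion]). So the range is dense,
      and it is closed since L^2 is complete ([energy_complete]). *)

Set Implicit Arguments.
Unset Strict Implicit.
Unset Printing Implicit Defensive.
Import Order.TTheory GRing.Theory Num.Theory.
Import numFieldNormedType.Exports.

Local Open Scope classical_set_scope.
Local Open Scope ring_scope.
Local Open Scope complex_scope.

(** * Change of variables *)

Section density.
Local Open Scope ereal_scope.
Context d (T : measurableType d) (R : realType).
Variables (mu : {measure set T -> \bar R}) (g : T -> \bar R).
Hypotheses (mg : measurable_fun setT g) (g0 : forall x, 0 <= g x).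

Definition density of measurable_fun setT g & (forall x, 0 <= g x) :=
  fun A : set T => \int[mu]_(x in A) g x.

Local Notation nu := (density mg g0).

Let density0 : nu set0 = 0.
Proof. by rewrite /density integral_set0. Qed.

Let density_ge0 A : 0 <= nu A.
Proof. by rewrite /density integral_ge0. Qed.

Let density_sigma_additive : semi_sigma_additive nu.
Proof.
move=> A mA tA mUA; rewrite /density ge0_integral_bigcup//; last first.
  exact: measurable_funTS.
by apply: is_cvg_ereal_nneg_natsum_cond => n _ _; exact: integral_ge0.
Qed.

HB.instance Definition _ := isMeasure.Build _ _ _ nu
  density0 density_ge0 density_sigma_additive.

Import HBNNSimple.

(** Both sides agree on indicators, hence on simple functions, and the general
    case is monotone convergence. *)
Lemma ge0_integral_density (f : T -> \bar R) :
  measurable_fun setT f -> (forall x, 0 <= f x) ->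
  \int[nu]_x f x = \int[mu]_x (f x * g x).
Proof.
move=> mf f0.
pose f_ := nnsfun_approx measurableT mf.
have f_f x : EFin (f_ n x) @[n --> \oo] --> f x by exact: cvg_nnsfun_approx.
have ndf x m n : (m <= n)%N -> (f_ m x <= f_ n x)%R.
  by move=> mn; exact/lefP/nd_nnsfun_approx.
transitivity (limn (fun n => \int[nu]_x (f_ n x)%:E)).
  rewrite -monotone_convergence//.
  - by apply: eq_integral => x _; apply/esym/cvg_lim.
  - by move=> n; exact/measurable_EFinP.
  - by move=> n x _; rewrite lee_fin.
  - by move=> x _ m n mn; rewrite lee_fin ndf.
transitivity (limn (fun n => \int[mu]_x ((f_ n x)%:E * g x))); last first.
  rewrite -monotone_convergence//.
  - apply: eq_integral => x _; apply/cvg_lim => //.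
    have [g_fin|] := boolP (g x \is a fin_num).
      by apply: cvgeZr.
    rewrite fin_numE negb_and !negbK => /orP[/eqP gx|/eqP gx].
      by have := g0 x; rewrite gx.
    (* where the density is infinite, the products are eventually constant *)
    rewrite gx.
    have [fx0|fx0] := eqVneq (f x) 0.
      rewrite (_ : (fun _ => _) = cst 0).
        by rewrite fx0 mul0e; exact: cvg_cst.
      apply/funext => n.
      suff -> : f_ n x = 0%R by rewrite mul0e.
      apply/eqP; rewrite eq_le; apply/andP; split => //.
      suff : (f_ n x)%:E <= f x by rewrite fx0 lee_fin.
      rewrite -(cvg_lim _ (f_f x))//.
      apply: (lime_ge (cvgP _ (f_f x))); near=> m.
      by rewrite lee_fin ndf//; near: m; exact: nbhs_infty_ge.
    have fx_gt0 : 0 < f x by rewrite lt0e fx0 f0.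
    rewrite gt0_muley//.
    have [n0 _ Hn0] : \forall n \near \oo, 0 < (f_ n x)%:E.
      exact: (f_f x _ (open_ereal_gt' fx_gt0)).
    apply: cvg_near_cst; exists n0 => // n /Hn0 ?.
    by rewrite gt0_muley.
  - by move=> n; apply: emeasurable_funM => //; exact/measurable_EFinP.
  - by move=> n x _; rewrite mule_ge0// lee_fin.
  - by move=> x _ m n mn; rewrite lee_wpmul2r// lee_fin ndf.
congr (limn _); apply/funext => n.
transitivity (\sum_(k \in range (f_ n))
    \int[nu]_x (k * \1_(f_ n @^-1` [set k]) x)%:E).
  under eq_integral do rewrite fimfunE -fsumEFin//.
  rewrite ge0_integral_fsum//.
  - by move=> y; exact/measurable_EFinP/measurable_funM.
  - by move=> y x _; rewrite nnfun_muleindic_ge0.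
transitivity (\sum_(k \in range (f_ n))
    \int[mu]_x ((k * \1_(f_ n @^-1` [set k]) x)%:E * g x)); last first.
  rewrite -ge0_integral_fsum//.
  - apply: eq_integral => x _.
    rewrite [in RHS](fimfunE (f_ n)) -fsumEFin//.
    rewrite ge0_mule_fsuml// => r.
    by rewrite nnfun_muleindic_ge0.
  - by move=> y; apply: emeasurable_funM => //; exact/measurable_EFinP/measurable_funM.
  - by move=> y x _; rewrite mule_ge0// nnfun_muleindic_ge0.
apply: eq_fsbigr => r _.
have [r0|r0] := ltP r 0%R.
  rewrite preimage_nnfun0//.
  by rewrite !integral0_eq// => x _; rewrite indicE in_set0 mulr0 ?mul0e.
transitivity (\int[nu]_x (r%:E * (\1_(f_ n @^-1` [set r]) x)%:E)).
  by apply: eq_integral => x _; rewrite EFinM.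
transitivity (\int[mu]_x (r%:E * ((\1_(f_ n @^-1` [set r]) x)%:E * g x)));
  last by apply: eq_integral => x _; rewrite EFinM muleA.
rewrite !ge0_integralZl_EFin//.
- congr (_ * _); rewrite integral_indic// setIT /= /density.
  rewrite [LHS]integral_mkcond; apply: eq_integral => x _.
  rewrite patchE indicE; case: ifPn => _ /=; first by rewrite mul1e.
  by rewrite mul0e.
- by move=> x _; rewrite mule_ge0// lee_fin.
- by apply: emeasurable_funM => //; exact/measurable_EFinP.
- exact/measurable_EFinP.
Unshelve. all: by end_near. Qed.

End density.

Section substitution.
Context {R : realType}.
Local Notation mu := (@lebesgue_measure R).

Variables (D : set R) (F : R -> R).
Hypotheses (oD : open D) (iD : is_interval D) (bijF : set_bij D setT F).
Hypotheses (dF : {in D, forall t, derivable F t 1})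
           (cF' : {in D, forall t, {for t, continuous (derive1 F)}})
           (F'gt0 : {in D, forall t, 0 < derive1 F t}).

Let mD : measurable D. Proof. exact: open_measurable. Qed.

Let sub_cc x y : D x -> D y -> `[x, y]%classic `<=` D.
Proof. by move=> Dx Dy z; rewrite /= in_itv/= => xzy; exact: iD xzy. Qed.

Let cF : {in D, continuous F}.
Proof.
by move=> t tD; apply/differentiable_continuous/derivable1_diffP; exact: dF.
Qed.

Lemma measurable_bij_C1 : measurable_fun D F.
Proof. exact: open_continuous_measurable_fun. Qed.

Lemma measurable_derive_bij_C1 : measurable_fun D (derive1 F).
Proof. exact: open_continuous_measurable_fun. Qed.

Lemma bij_C1_lt : {in D &, {homo F : x y / x < y}}.
Proof.
move=> x y /set_mem Dx /set_mem Dy xy.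
have subD := sub_cc Dx Dy.
apply: (@gtr0_derive1_lt_cc R F x y) => //.
- move=> z zxy; apply: dF; apply/mem_set/subD => /=.
  by move: zxy; rewrite !in_itv/= => /andP[/ltW -> /ltW ->].
- move=> z zxy; apply: F'gt0; apply/mem_set/subD => /=.
  by move: zxy; rewrite !in_itv/= => /andP[/ltW -> /ltW ->].
- apply: continuous_in_subspaceT => z; rewrite inE => zxy.
  by apply: cF; rewrite inE; exact: subD.
- by rewrite in_itv/= lexx ltW.
- by rewrite in_itv/= lexx ltW.
Qed.

Lemma bij_C1_le : {in D &, {mono F : x y / x <= y}}.
Proof. exact/le_mono_in/bij_C1_lt. Qed.

Lemma integral_derive_bij_C1 x y : D x -> D y -> x < y ->
  (\int[mu]_(t in `[x, y]) (derive1 F t)%:E = (F y - F x)%:E)%E.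
Proof.
move=> Dx Dy xy; have subD := sub_cc Dx Dy.
rewrite EFinB; apply: (@continuous_FTC2 _ (derive1 F) F x y xy).
- apply: continuous_in_subspaceT => z; rewrite inE => zxy.
  by apply: cF'; rewrite inE; exact: subD.
- split.
  + move=> z zxy; apply: dF; apply/mem_set/subD => /=.
    by move: zxy; rewrite !in_itv/= => /andP[/ltW -> /ltW ->].
  + by apply: cvg_at_right_filter; apply: cF; rewrite inE.
  + by apply: cvg_at_left_filter; apply: cF; rewrite inE.
- by [].
Qed.

Let g : R -> \bar R := EFin \o (derive1 F \_ D).

Let mg : measurable_fun setT g.
Proof.
apply/measurable_EFinP; apply/(measurable_restrictT _ mD).
exact: measurable_derive_bij_C1.
Qed.

Let g0 x : (0 <= g x)%E.
Proof.
rewrite /g/= lee_fin patchE; case: ifPn => // xD.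
by rewrite ltW// F'gt0.
Qed.

Let Fb : R -> R := F \_ D.

Let mFb : measurable_fun setT Fb.
Proof. by apply/(measurable_restrictT _ mD); exact: measurable_bij_C1. Qed.

(** Lebesgue measure is the image under [F] of the measure of density [F'], as
    on intervals this is the fundamental theorem of calculus. *)
Lemma lebesgue_measure_pushforward_density (A : set R) : measurable A ->
  mu A = pushforward (density mu mg g0) (Fb : R -> measurableTypeR R) A.
Proof.
apply: lebesgue_measure_unique A => // _ [[a b] _ <-] /=.
rewrite /pushforward /density.
rewrite integral_mkcond.
have [ab|ba] := ltP a b; last first.
  rewrite set_itv_ge ?bnd_simp -?leNgt// measure0.
  by rewrite integral0_eq// => x _; rewrite patchE preimage_set0 in_set0.
have [_ _ surjF] := bijF.
have [x Dx Fx] := surjF a Logic.I.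
have [y Dy Fy] := surjF b Logic.I.
have xy : x < y.
  rewrite ltNge -bij_C1_le ?inE// Fx Fy -ltNge//.
rewrite [LHS]lebesgue_measure_itv/= lte_fin ab.
transitivity (\int[mu]_(t in `]x, y]) (derive1 F t)%:E)%E.
  rewrite integral_itv_obnd_cbnd.
    by rewrite integral_derive_bij_C1// Fx Fy EFinB.
  apply/measurable_EFinP; apply: measurable_funS measurable_derive_bij_C1 => //.
  by apply: subset_trans (sub_cc Dx Dy) => z /=; rewrite !in_itv/= => /andP[/ltW -> ->].
rewrite [LHS]integral_mkcond; apply: eq_integral => z _.
rewrite /g !patchE/=.
have [zD|zD] := boolP (z \in D); last first.
  rewrite ifF; last first.
    apply/negbTE; apply: contra zD; rewrite !inE/= => zxy.
    by apply: (sub_cc Dx Dy); move: zxy => /=; rewrite !in_itv/= => /andP[/ltW -> ->].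
  by rewrite /= patchE (negbTE zD); case: ifP.
have Dz := set_mem zD.
congr (if _ then _ else _).
  apply/idP/idP; rewrite !inE/= /Fb !in_itv/= patchE zD.
    rewrite -Fx -Fy bij_C1_le ?inE// => /andP[+ ->].
    by rewrite !ltNge bij_C1_le ?inE// => ->.
  by rewrite -Fx -Fy !ltNge !bij_C1_le ?inE.
by rewrite /= patchE zD.
Qed.

(** Integration against an image measure, followed by integration against a
    density. *)
Lemma ge0_integral_substitution (phi : R -> \bar R) :
  measurable_fun setT phi -> (forall x, 0 <= phi x)%E ->
  (\int[mu]_(x in D) ((derive1 F x)%:E * phi (F x)) = \int[mu]_x phi x)%E.
Proof.
move=> mphi phi0.
transitivity (\int[pushforward (density mu mg g0) (Fb : R -> measurableTypeR R)]_x phi x)%E; last first.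
  apply: eq_measure_integral => A mA _.
  exact/esym/lebesgue_measure_pushforward_density.
rewrite ge0_integral_pushforward//.
rewrite preimage_setT ge0_integral_density; first last.
- by move=> x; exact: phi0.
- exact: measurableT_comp mphi mFb.
rewrite [LHS]integral_mkcond; congr (integral _ _ _); apply/funext => x.
rewrite /g /= /Fb !patchE; case: ifPn => [|_]; first by rewrite muleC.
by rewrite mule0.
Qed.

End substitution.

Section affine_change_of_variable.
Context {R : realType}.
Local Notation mu := (@lebesgue_measure R).
Implicit Types (phi : R -> \bar R) (f : R -> R).

Lemma derive1_affine (a c x : R) : derive1 (fun t => c * t + a) x = c.
Proof.
rewrite derive1E deriveD//= deriveM// !derive_cst derive_id scaler0 !addr0.
by rewrite /GRing.scale/= mulr1.
Qed.

Lemma ge0_integral_affine (a c : R) phi : 0 < c ->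
  measurable_fun setT phi -> (forall x, 0 <= phi x)%E ->
  (\int[mu]_x phi (c * x + a)%R = c^-1%:E * \int[mu]_x phi x)%E.
Proof.
move=> c0 mphi phi0.
have cN0 : c != 0 by rewrite gt_eqF.
have maff : measurable_fun setT (fun t : R => c * t + a).
  apply: continuous_measurable_fun => x; apply: cvgD; last exact: cvg_cst.
  by apply: cvgM; [exact: cvg_cst|exact: cvg_id].
rewrite -[in RHS](@ge0_integral_substitution R setT (fun t => c * t + a))//.
- under [in RHS]eq_integral => x _ do rewrite derive1_affine.
  rewrite ge0_integralZl_EFin//; last 2 first.
    exact: measurableT_comp mphi maff.
    exact: ltW.
  by rewrite muleA -EFinM mulVf// mul1e.
- exact: openT.
- split => //.
  + by move=> x y _ _ /addIr /(mulfI cN0).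
  + by move=> y _; exists ((y - a) / c) => //; rewrite mulrCA divff// mulr1 subrK.
- move=> t _; rewrite (_ : derive1 _ = cst c); first exact: cst_continuous.
  by apply/funext => x; rewrite derive1_affine.
- by move=> t _; rewrite derive1_affine.
Qed.

Lemma ge0_integral_shift (a : R) phi :
  measurable_fun setT phi -> (forall x, 0 <= phi x)%E ->
  (\int[mu]_x phi (x - a)%R = \int[mu]_x phi x)%E.
Proof.
move=> mphi phi0; have := ge0_integral_affine (- a) (@ltr01 R) mphi phi0.
rewrite invr1 mul1e => <-; apply: eq_integral => x _; by rewrite mul1r.
Qed.

Lemma ge0_integral_opp phi :
  measurable_fun setT phi -> (forall x, 0 <= phi x)%E ->
  (\int[mu]_x phi (- x)%R = \int[mu]_x phi x)%E.
Proof.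
move=> mphi phi0.
transitivity (\int[pushforward mu (-%R : R -> measurableTypeR R)]_x phi x)%E.
  by rewrite ge0_integral_pushforward.
by apply: eq_measure_integral => A mA _; exact: lebesgue_measureN.
Qed.

Lemma integral_shift (a : R) phi : measurable_fun setT phi ->
  (\int[mu]_x phi (x - a)%R = \int[mu]_x phi x)%E.
Proof.
move=> mphi; rewrite integralE [in RHS]integralE; congr (_ - _)%E.
  rewrite -[X in (\int[_]_x X^\+ x)%E]/(phi \o (fun x => x - a)) funepos_comp.
exact: (ge0_integral_shift a (measurable_funepos mphi) (funepos_ge0 _)).
rewrite -[X in (\int[_]_x X^\- x)%E]/(phi \o (fun x => x - a)) funeneg_comp.
exact: (ge0_integral_shift a (measurable_funeneg mphi) (funeneg_ge0 _)).
Qed.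

Lemma integral_opp phi : measurable_fun setT phi ->
  (\int[mu]_x phi (- x)%R = \int[mu]_x phi x)%E.
Proof.
move=> mphi; rewrite integralE [in RHS]integralE; congr (_ - _)%E.
  rewrite -[X in (\int[_]_x X^\+ x)%E]/(phi \o -%R) funepos_comp.
exact: (ge0_integral_opp (measurable_funepos mphi) (funepos_ge0 _)).
rewrite -[X in (\int[_]_x X^\- x)%E]/(phi \o -%R) funeneg_comp.
exact: (ge0_integral_opp (measurable_funeneg mphi) (funeneg_ge0 _)).
Qed.

Lemma Rintegral_shift (a : R) f : measurable_fun setT f ->
  Rintegral mu setT (fun x => f (x - a)) = Rintegral mu setT f.
Proof.
move=> /measurable_EFinP mf; congr fine.
exact: (integral_shift a mf).
Qed.

Lemma Rintegral_opp f : measurable_fun setT f ->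
  Rintegral mu setT (fun x => f (- x)) = Rintegral mu setT f.
Proof.
by move=> /measurable_EFinP mf; congr fine; exact: (integral_opp mf).
Qed.

Lemma integrable_shift (a : R) phi : mu.-integrable setT phi ->
  mu.-integrable setT (fun x => phi (x - a)%R).
Proof.
move=> /integrableP[mphi phioo]; apply/integrableP; split.
  apply: measurableT_comp => //; exact: measurable_funB.
rewrite (ge0_integral_shift a (phi := fun x => `|phi x|%E))//.
exact: measurableT_comp.
Qed.

Lemma integrable_opp phi : mu.-integrable setT phi ->
  mu.-integrable setT (fun x => phi (- x)%R).
Proof.
move=> /integrableP[mphi phioo]; apply/integrableP; split.
  exact: measurableT_comp.
rewrite (ge0_integral_opp (phi := fun x => `|phi x|%E))//.
exact: measurableT_comp.
Qed.

Lemma Rintegral_scale (c : R) f : 0 < c -> mu.-integrable setT (EFin \o f) ->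
  Rintegral mu setT (fun x => f (c * x)) = c^-1 * Rintegral mu setT f.
Proof.
move=> c0 intf.
have mf := measurable_int _ intf.
rewrite /Rintegral -[RHS]/(fine c^-1%:E * _) -fineM//; last first.
  exact: integrable_fin_num.
congr fine; rewrite integralE [in RHS]integralE muleBr//; last first.
  exact: integrable_add_def.
congr (_ - _)%E.
  rewrite -(ge0_integral_affine 0 c0 (measurable_funepos mf))//.
rewrite -[X in (\int[_]_x X^\+ x)%E]/((EFin \o f) \o ( *%R c)) funepos_comp.
  by apply: eq_integral => x _; rewrite addr0.
rewrite -(ge0_integral_affine 0 c0 (measurable_funeneg mf))//.
rewrite -[X in (\int[_]_x X^\- x)%E]/((EFin \o f) \o ( *%R c)) funeneg_comp.
by apply: eq_integral => x _; rewrite addr0.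
Qed.

Lemma integrable_scale (c : R) phi : 0 < c -> mu.-integrable setT phi ->
  mu.-integrable setT (fun x => phi (c * x)).
Proof.
move=> c0 /integrableP[mphi phioo]; apply/integrableP; split.
  by apply: measurableT_comp => //; exact: measurable_funM.
have := ge0_integral_affine 0 c0 (measurableT_comp (@abse_measurable R setT) mphi).
under eq_integral => x _ do rewrite addr0.
move=> /(_ (fun _ => abse_ge0 _)) ->; rewrite lte_mul_pinfty// lee_fin invr_ge0 ltW//.
Qed.

End affine_change_of_variable.

(** * Damped cosines and the Cauchy kernel *)

Section laplace_cos.
Context {R : realType}.
Local Notation mu := (@lebesgue_measure R).

Lemma cvg_expRNM (e : R) : 0 < e -> expR (- e * x) @[x --> +oo] --> 0.
Proof.
move=> e0; under eq_fun do rewrite mulNr.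
apply: (cvg_comp (fun x => e * x) (fun y => expR (- y)) _ (@cvgr_expR R)).
by apply: gt0_cvgMry.
Qed.

Lemma cvg_expRNM_bounded (e M : R) (h : R -> R) : 0 < e ->
  (forall x, `|h x| <= M) -> expR (- e * x) * h x @[x --> +oo] --> 0.
Proof.
move=> e0 hM; apply: norm_cvg0.
apply: (@squeeze_cvgr _ _ _ _ (cst 0) (fun x => expR (- e * x) * M)).
- near=> x; rewrite normr_ge0/= normrM ger0_norm ?expR_ge0//.
  by rewrite ler_wpM2l ?expR_ge0.
- exact: cvg_cst.
- by rewrite -[X in _ --> X](mul0r M); apply: cvgM; [exact: cvg_expRNM|exact: cvg_cst].
Unshelve. all: by end_near. Qed.

Lemma continuous_expRM (e : R) : continuous (fun x => expR (e * x) : R).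
Proof.
move=> x; apply/differentiable_continuous/derivable1_diffP.
by apply: ex_derive.
Qed.

Lemma integral_expRNM (e : R) : 0 < e ->
  (\int[mu]_(x in `[0%R, +oo[) (expR (- e * x))%:E = (e^-1)%:E)%E.
Proof.
move=> e0.
pose F (x : R) : R := - e^-1 * expR (- e * x).
have dF (x : R) : is_derive x 1 F (expR (- e * x)).
  apply: is_derive_eq; rewrite /GRing.scale/=; field.
  by rewrite gt_eqF.
rewrite (@ge0_continuous_FTC2y _ _ F 0 0).
- by rewrite /F mulr0 expR0 mulr1 EFinN sub0e oppeK.
- by move=> x _; exact: expR_ge0.
- exact/continuous_subspaceT/continuous_expRM.
- rewrite -(mulr0 (- e^-1)); apply: cvgM; [exact: cvg_cst|exact: cvg_expRNM].
- by move=> x _; apply: ex_derive.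
- apply: cvg_at_right_filter.
  by apply/differentiable_continuous/derivable1_diffP; apply: ex_derive.
- by move=> x _; rewrite derive1E; exact: derive_val.
Qed.

(** The constant 1 added to the cosine makes the integrand nonnegative, so that
    the value is read off from a primitive at 0 and at infinity. *)
Lemma integral_expRNM_1cos (e b : R) : 0 < e ->
  (\int[mu]_(x in `[0%R, +oo[) (expR (- e * x) * (1 + cos (b * x)))%:E =
   (e^-1 + e / (e ^+ 2 + b ^+ 2))%:E)%E.
Proof.
move=> e0.
have eb0 : e ^+ 2 + b ^+ 2 != 0 by rewrite gt_eqF// ltr_wpDr ?sqr_ge0// exprn_gt0.
pose F (x : R) : R := expR (- e * x) *
  ((e ^+ 2 + b ^+ 2)^-1 * (b * sin (b * x) - e * cos (b * x)) - e^-1).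
have dF (x : R) : is_derive x 1 F (expR (- e * x) * (1 + cos (b * x))).
  apply: is_derive_eq; rewrite /GRing.scale/=; field.
  by rewrite eb0 gt_eqF.
rewrite (@ge0_continuous_FTC2y _ _ F 0 0).
- rewrite /F !mulr0 expR0 sin0 cos0 -EFinB; congr EFin; field.
  by rewrite eb0 gt_eqF.
- move=> x _; rewrite mulr_ge0 ?expR_ge0//.
- apply: continuous_subspaceT => x.
  by apply/differentiable_continuous/derivable1_diffP; apply: ex_derive.
- apply: (@cvg_expRNM_bounded _ (`|(e ^+ 2 + b ^+ 2)^-1| * (`|b| + `|e|) + `|e^-1|)) => // x.
  rewrite (le_trans (ler_normB _ _))// lerD2r normrM ler_wpM2l//.
  rewrite (le_trans (ler_normB _ _))// lerD// normrM ler_piMr//.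
    by rewrite sin_max.
  by rewrite cos_max.
- by move=> x _; apply: ex_derive.
- apply: cvg_at_right_filter.
  by apply/differentiable_continuous/derivable1_diffP; apply: ex_derive.
- by move=> x _; rewrite derive1E; exact: derive_val.
Qed.

(** Normalized for the transform with [2 pi] in the exponent: the Fourier
    transform of [exp (- |xi|)] is twice this function. *)
Definition cauchy_kernel (u : R) := (1 + (2 * pi * u) ^+ 2)^-1.

Lemma cauchy_kernel_ge0 u : 0 <= cauchy_kernel u.
Proof. by rewrite invr_ge0 addr_ge0// sqr_ge0. Qed.

Lemma cauchy_kernel_le1 u : cauchy_kernel u <= 1.
Proof. by rewrite invf_le1 ?lerDl ?sqr_ge0// ltr_wpDr ?sqr_ge0. Qed.

Lemma measurable_cauchy_kernel : measurable_fun setT cauchy_kernel.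
Proof.
apply: continuous_measurable_fun => u.
apply: (@continuous_comp _ _ _ (fun u => 2 * pi * u) (fun x => (oneDsqr x)^-1)).
  by apply: cvgM; [exact: cvg_cst|exact: cvg_id].
exact: continuous_oneDsqrV.
Qed.

Lemma integral_cauchy_kernel : (\int[mu]_u (cauchy_kernel u)%:E = (2^-1)%:E)%E.
Proof.
have pi0 : 0 < 2 * pi :> R by rewrite mulr_gt0// pi_gt0.
have mV : measurable_fun setT (fun x : R => ((oneDsqr x)^-1)%:E).
  apply/measurable_EFinP; apply: continuous_measurable_fun => x.
  exact: continuous_oneDsqrV.
transitivity (\int[mu]_u ((oneDsqr (2 * pi * u + 0))^-1)%:E)%E.
  by apply: eq_integral => u _; rewrite addr0.
rewrite (ge0_integral_affine 0 pi0 mV); last first.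
  by move=> x; rewrite lee_fin invr_ge0 ltW ?oneDsqr_gt0.
rewrite ge0_symfun_integralT.
- rewrite -set_itvcy integral0y_oneDsqr -!EFinM; congr EFin.
  have : pi != 0 :> R by rewrite gt_eqF// pi_gt0.
  by move: (pi : R) => p p0; field.
- by move=> x; rewrite invr_ge0 ltW ?oneDsqr_gt0.
- exact: continuous_oneDsqrV.
- by move=> x /=; rewrite /oneDsqr sqrrN.
Qed.

Lemma integrable_cauchy_kernel :
  mu.-integrable setT (EFin \o cauchy_kernel).
Proof.
apply/integrableP; split; first by apply/measurable_EFinP; exact: measurable_cauchy_kernel.
under eq_integral => x _ do rewrite gee0_abs ?lee_fin ?cauchy_kernel_ge0//.
by rewrite integral_cauchy_kernel ltry.
Qed.

End laplace_cos.

(** * Square integrable real functions *)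

Section ereal_limits.
Context {R : realType}.

Lemma ge0_cvge0P (u : nat -> \bar R) : (forall n, 0 <= u n)%E ->
  u @ \oo --> 0%E <->
  (forall e : R, 0 < e -> \forall n \near \oo, (u n < e%:E)%E).
Proof.
move=> u0; split=> [/fine_cvgP[fu /cvgr0Pnorm_lt cu] e e0|H].
  near=> n.
  rewrite -[u n]fineK; last by near: n.
  rewrite lte_fin (le_lt_trans (ler_norm _))//.
  by near: n; exact: cu.
apply/fine_cvgP; split.
  near=> n; rewrite ge0_fin_numE//.
  rewrite (@lt_trans _ _ 1%:E) ?ltry//.
  by near: n; exact: H.
apply/cvgr0Pnorm_lt => e e0; near=> n.
rewrite /= ger0_norm ?fine_ge0//.
have un : (u n < e%:E)%E by near: n; exact: H.
by rewrite -lte_fin fineK// ge0_fin_numE// (lt_trans un)// ltry.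
Unshelve. all: by end_near. Qed.

End ereal_limits.

Section dominated_convergence_real.
Context d (T : measurableType d) (R : realType).
Variable mu : {measure set T -> \bar R}.
Implicit Types f g l : T -> R.

Lemma integrableZl_EFin (k : R) f : mu.-integrable setT (EFin \o f) ->
  mu.-integrable setT (fun x => (k * f x)%:E).
Proof. by move=> intf; exact: (integrableZl measurableT k intf). Qed.

Lemma integrableD_EFin f g : mu.-integrable setT (EFin \o f) ->
  mu.-integrable setT (EFin \o g) ->
  mu.-integrable setT (fun x => (f x + g x)%:E).
Proof. by move=> intf intg; exact: (integrableD measurableT intf intg). Qed.

Lemma integrableB_EFin f g : mu.-integrable setT (EFin \o f) ->
  mu.-integrable setT (EFin \o g) ->
  mu.-integrable setT (fun x => (f x - g x)%:E).
Proof. by move=> intf intg; exact: (integrableB measurableT intf intg). Qed.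

Lemma cvg_integral_dominated (f : nat -> T -> R) l g :
  (forall n, measurable_fun setT (f n)) -> measurable_fun setT l ->
  {ae mu, forall x, f n x @[n --> \oo] --> l x} ->
  mu.-integrable setT (EFin \o g) -> (forall n x, `|f n x| <= g x) ->
  (\int[mu]_x (f n x)%:E)%E @[n --> \oo] --> (\int[mu]_x (l x)%:E)%E.
Proof.
move=> mf ml fl intg fg.
have mfE n : measurable_fun setT (fun x => (f n x)%:E) by apply/measurable_EFinP.
have mlE : measurable_fun setT (fun x => (l x)%:E) by apply/measurable_EFinP.
have flE : {ae mu, forall x, setT x -> (f n x)%:E @[n --> \oo] --> (l x)%:E}.
  by apply: filterS fl => x fx _; apply: cvg_EFin => //; exact: nearW.
have fgE : {ae mu, forall x n, setT x -> (`|(f n x)%:E| <= (g x)%:E)%E}.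
  by apply: aeW => x n _; rewrite lee_fin.
by have [] := dominated_convergence measurableT mfE mlE flE intg fgE.
Qed.

Lemma cvg_Rintegral_dominated (f : nat -> T -> R) l g :
  (forall n, measurable_fun setT (f n)) -> measurable_fun setT l ->
  {ae mu, forall x, f n x @[n --> \oo] --> l x} ->
  mu.-integrable setT (EFin \o g) -> (forall n x, `|f n x| <= g x) ->
  Rintegral mu setT (f n) @[n --> \oo] --> Rintegral mu setT l.
Proof.
move=> mf ml fl intg fg.
have mfE n : measurable_fun setT (fun x => (f n x)%:E) by apply/measurable_EFinP.
have mlE : measurable_fun setT (fun x => (l x)%:E) by apply/measurable_EFinP.
have flE : {ae mu, forall x, setT x -> (f n x)%:E @[n --> \oo] --> (l x)%:E}.
  by apply: filterS fl => x fx _; apply: cvg_EFin => //; exact: nearW.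
have fgE : {ae mu, forall x n, setT x -> (`|(f n x)%:E| <= (g x)%:E)%E}.
  by apply: aeW => x n _; rewrite lee_fin.
have [intl _] := dominated_convergence measurableT mfE mlE flE intg fgE.
move=> H; have := H; rewrite -{1}(fineK (integrable_fin_num measurableT intl)).
by move/fine_cvgP => [].
Qed.

End dominated_convergence_real.

Section energy.
Context {R : realType}.
Local Notation mu := (@lebesgue_measure R).
Implicit Types a b : R -> R.

Definition energy a : \bar R := (\int[mu]_x (a x ^+ 2)%:E)%E.

Definition sqint a := measurable_fun setT a /\ (energy a < +oo)%E.

Lemma energy_ge0 a : (0 <= energy a)%E.
Proof. by apply: integral_ge0 => x _; rewrite lee_fin sqr_ge0. Qed.

Lemma measurable_sqr a : measurable_fun setT a ->
  measurable_fun setT (fun x => (a x ^+ 2)%:E).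
Proof. by move=> ma; apply/measurable_EFinP; exact: measurable_funX. Qed.

Lemma sqint_integrable a : sqint a ->
  mu.-integrable setT (fun x => (a x ^+ 2)%:E).
Proof.
move=> [ma aoo]; apply/integrableP; split; first exact: measurable_sqr.
under eq_integral => x _ do rewrite gee0_abs ?lee_fin ?sqr_ge0//.
exact: aoo.
Qed.

Lemma sqint_energyE a : sqint a -> (Rintegral mu setT (fun x => a x ^+ 2))%:E = energy a.
Proof.
by move=> ia; rewrite /Rintegral fineK//; exact/integrable_fin_num/sqint_integrable.
Qed.

Lemma le_energy a b : measurable_fun setT a -> measurable_fun setT b ->
  (forall x, `|a x| <= `|b x|) -> (energy a <= energy b)%E.
Proof.
move=> ma mb ab; apply: ge0_le_integral => //.
- by move=> x _; rewrite lee_fin sqr_ge0.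
- exact: measurable_sqr.
- exact: measurable_sqr.
- by move=> x _; rewrite lee_fin -real_normK ?num_real// -[leRHS]real_normK ?num_real// lerXn2r ?nnegrE.
Qed.

Lemma energyD_le a b : measurable_fun setT a -> measurable_fun setT b ->
  (energy (fun x => a x + b x)%R <= 2%:E * energy a + 2%:E * energy b)%E.
Proof.
move=> ma mb.
rewrite -!ge0_integralZl_EFin//; try by [move=> x _; rewrite lee_fin sqr_ge0|exact: measurable_sqr].
rewrite -ge0_integralD//; first last.
- by apply/measurable_EFinP; apply: measurable_funM => //; exact: measurable_funX.
- by move=> x _; rewrite lee_fin mulr_ge0 ?sqr_ge0.
- by apply/measurable_EFinP; apply: measurable_funM => //; exact: measurable_funX.
- by move=> x _; rewrite lee_fin mulr_ge0 ?sqr_ge0.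
apply: ge0_le_integral => //.
- by move=> x _; rewrite lee_fin sqr_ge0.
- by apply: measurable_sqr; exact: measurable_funD.
- by apply/measurable_EFinP; apply: measurable_funD => //; apply: measurable_funM => //; exact: measurable_funX.
- move=> x _; rewrite -!EFinM -EFinD lee_fin.
  by have := sqr_ge0 (a x - b x); rewrite !sqrrD sqrrN; lra.
Qed.

Lemma energyN a : energy (fun x => - a x) = energy a.
Proof. by apply: eq_integral => x _; rewrite sqrrN. Qed.

Lemma energy_shift (u : R) a : measurable_fun setT a ->
  energy (fun x => a (x - u)) = energy a.
Proof.
move=> ma; rewrite /energy (ge0_integral_shift u (phi := fun x => (a x ^+ 2)%:E))//.
- exact: measurable_sqr.
- by move=> x; rewrite lee_fin sqr_ge0.
Qed.

Lemma measurable_fun_shift d (T : measurableType d) (u : R) (a : R -> T) :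
  measurable_fun setT a -> measurable_fun setT (fun x : R => a (x - u)).
Proof. by move=> ma; apply: measurableT_comp => //; exact: measurable_funB. Qed.

Lemma sqint_shift (u : R) a : sqint a -> sqint (fun x => a (x - u)).
Proof.
by move=> [ma aoo]; split; [exact: measurable_fun_shift|rewrite energy_shift].
Qed.

Lemma sqintD a b : sqint a -> sqint b -> sqint (fun x => a x + b x).
Proof.
move=> [ma aoo] [mb boo]; split; first exact: measurable_funD.
rewrite (le_lt_trans (energyD_le ma mb))// lte_add_pinfty// lte_mul_pinfty//.
Qed.

Lemma sqintN a : sqint a -> sqint (fun x => - a x).
Proof.
by move=> [ma aoo]; split; [exact: measurableT_comp|rewrite energyN].
Qed.

Lemma sqintB a b : sqint a -> sqint b -> sqint (fun x => a x - b x).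
Proof. by move=> ia /sqintN; exact: sqintD. Qed.

Lemma le_sqint a b : measurable_fun setT a -> (forall x, `|a x| <= `|b x|) ->
  sqint b -> sqint a.
Proof.
by move=> ma ab [mb boo]; split => //; apply: le_lt_trans boo; exact: le_energy.
Qed.

Lemma sqintM_integrable a b : sqint a -> sqint b ->
  mu.-integrable setT (fun x => (a x * b x)%:E).
Proof.
move=> ia ib; have [ma _] := ia; have [mb _] := ib.
apply: le_integrable (integrableD _ (sqint_integrable ia) (sqint_integrable ib)) => //.
  by apply/measurable_EFinP; exact: measurable_funM.
move=> x _ /=; rewrite lee_fin [leRHS]ger0_norm ?addr_ge0 ?sqr_ge0//.
rewrite normrM -[a x ^+ 2]real_normK ?num_real// -[b x ^+ 2]real_normK ?num_real//.
have := sqr_ge0 (`|a x| - `|b x|); rewrite !sqrrD sqrrN.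
by have := mulr_ge0 (normr_ge0 (a x)) (normr_ge0 (b x)); lra.
Qed.

End energy.

Lemma lte_quarters {R : realType} (x y : \bar R) (e : R) :
  (x < (e / 4)%:E -> y < (e / 4)%:E -> 2%:E * x + 2%:E * y < e%:E)%E.
Proof.
move=> xe ye; have -> : e%:E = (2%:E * (e / 4)%:E + 2%:E * (e / 4)%:E)%E.
  by rewrite -!EFinM -EFinD; congr EFin; field.
by rewrite lteD// lte_pmul2l.
Qed.

(** * Continuity of translations *)

Section translation_continuity.
Context {R : realType}.
Local Notation mu := (@lebesgue_measure R).
Implicit Types a b h : R -> R.

Definition window (n : nat) h : R -> R :=
  fun x => if `|x| <= n%:R then h x else 0.

Lemma measurable_norm_le (n : nat) (h : R -> R) : measurable_fun setT h ->
  measurable_fun setT (fun x => `|h x| <= n%:R :> R).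
Proof. by move=> mh; apply: measurable_fun_ler => //; exact: measurableT_comp. Qed.

Lemma measurable_window n h : measurable_fun setT h ->
  measurable_fun setT (window n h).
Proof.
move=> mh; apply: measurable_fun_ifT => //.
exact: measurable_norm_le.
Qed.

Lemma near_norm_le (x : R) : \forall n \near \oo, `|x| <= n%:R.
Proof.
near=> n; rewrite (le_trans (ltW (truncnS_gt _)))// ler_nat.
by near: n; exact: nbhs_infty_ge.
Unshelve. all: by end_near. Qed.

Definition clip (n : nat) (y : R) : R := Num.max (- n%:R) (Num.min n%:R y).

Lemma norm_clip_le n y : `|clip n y| <= n%:R.
Proof.
have n0 : 0 <= n%:R :> R by [].
rewrite ler_norml /clip le_max lexx/= ge_max ge_min lexx/= andbT; lra.
Qed.

(** Clipping is a projection on [[- n, n]], so it does not increase the distance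
    to a point of that interval. *)
Lemma dist_clip_le n (x y : R) : `|x| <= n%:R -> `|x - clip n y| <= `|x - y|.
Proof.
rewrite ler_norml => /andP[x1 x2]; rewrite /clip.
have [yn|yn] := leP n%:R y.
  have -> : Num.max (- n%:R) n%:R = n%:R :> R by apply/max_idPr; lra.
  by rewrite !ler0_norm; lra.
have [yn'|yn'] := leP (- n%:R) y; first by [].
by rewrite !ger0_norm; lra.
Qed.

Lemma energy_truncation_cvg a : sqint a ->
  energy (fun x => a x - window n (fun y => if `|a y| <= n%:R then a y else 0) x)
    @[n --> \oo] --> 0%E.
Proof.
move=> ia; have [ma aoo] := ia.
pose b n := window n (fun y => if `|a y| <= n%:R then a y else 0).
have mb n : measurable_fun setT (b n).
  apply: measurable_window; apply: measurable_fun_ifT => //.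
  exact: measurable_norm_le.
rewrite (_ : 0%E = (\int[mu]_x (cst 0 x)%:E)%E); last by rewrite integral0.
apply: (@cvg_integral_dominated _ _ _ mu _ _ (fun x => a x ^+ 2)) => //.
- by move=> n; apply: measurable_funX; apply: measurable_funB => //; exact: mb.
- apply: aeW => x; apply: cvg_near_cst.
  near=> n; rewrite /b /window.
  have -> : `|x| <= n%:R by near: n; exact: near_norm_le.
  have -> : `|a x| <= n%:R by near: n; exact: near_norm_le.
  by rewrite subrr expr0n.
- exact: sqint_integrable.
- move=> n x; rewrite ger0_norm ?sqr_ge0// /b /window.
  by case: ifPn => _; [case: ifPn => _|]; rewrite ?subrr ?subr0// expr0n sqr_ge0.
Unshelve. all: by end_near. Qed.

(** Approximation in the mean gives approximation in energy, because everything
    can be kept bounded by [n] and the square of a difference is then at most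
    [2 n] times its absolute value. *)
Lemma energy_continuous_approx (n : nat) b (e : R) :
  measurable_fun setT b -> (forall x, `|b x| <= n%:R) -> 0 < e ->
  exists h, [/\ continuous h, forall x, `|h x| <= n%:R &
    (energy (fun x => window n b x - window n h x)%R < e%:E)%E].
Proof.
move=> mb bn e0.
pose E : set R := `[- n%:R, n%:R]%classic.
have mE : measurable E by exact: measurable_itv.
have Efin : (mu E < +oo)%E.
  rewrite /E lebesgue_measure_itv/=; case: ifPn => // _.
  by rewrite -EFinB ltry.
have intb : mu.-integrable E (EFin \o b).
  apply: measurable_bounded_integrable => //; first exact: measurable_funTS.
  exists n%:R; split; first exact: num_real.
  by move=> M nM x _ /=; rewrite (le_trans (bn x))// ltW.
have [g [cg intg gb]] := approximation_continuous_integrable mE Efin intb.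
(* the denominator exceeds the bound [2 n] and is positive even for [n = 0] *)
pose d := e / (2 * n%:R + 1).
have d0 : 0 < d by rewrite divr_gt0// ltr_wpDl.
have /(ge0_cvge0P) := gb; move=> /(_ _ _ d0)[|k _ /(_ k (leqnn k)) gk].
  by move=> m; exact: integral_ge0.
pose h x := clip n (g k x).
have ch : continuous h.
  move=> x; apply: (@continuous_comp _ _ _ (g k) (clip n)); first exact: cg.
  by apply: continuous_max; [exact: cst_continuous|apply: continuous_min; [exact: cst_continuous|exact: cvg_id]].
have mh := continuous_measurable_fun ch.
exists h; split => //; first by move=> x; exact: norm_clip_le.
apply: (@le_lt_trans _ _ (\int[mu]_(x in E) ((2 * n%:R)%:E * `|(b x - g k x)%:E|)))%E.
  rewrite [leRHS]integral_mkcond; apply: ge0_le_integral => //.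
  - by move=> x _; rewrite lee_fin sqr_ge0.
  - by apply: measurable_sqr; apply: measurable_funB; exact: measurable_window.
  - apply/(measurable_restrictT _ mE).
    apply: emeasurable_funM => //; apply: measurableT_comp => //.
    apply/measurable_EFinP; apply: measurable_funTS; apply: measurable_funB => //.
    exact: continuous_measurable_fun.
  - move=> x _; rewrite patchE /window.
    have -> : (x \in E) = (`|x| <= n%:R).
      by rewrite ler_norml; apply/idP/idP; rewrite inE /E/= in_itv/=.
    case: ifPn => xn; last by rewrite subrr expr0n.
    rewrite lee_fin -real_normK ?num_real// expr2 ler_pM//.
      rewrite (le_trans (ler_normB _ _))// mulr_natl mulr2n lerD//.
      exact: norm_clip_le.
    exact: dist_clip_le.
rewrite ge0_integralZl_EFin//; last first.
  apply: measurableT_comp => //.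
  apply/measurable_EFinP; apply: measurable_funTS; apply: measurable_funB => //.
  exact: continuous_measurable_fun.
apply: (@le_lt_trans _ _ ((2 * n%:R)%:E * d%:E))%E.
  by rewrite lee_wpmul2l// ltW.
rewrite -EFinM lte_fin /d mulrA ltr_pdivrMr; last by rewrite ltr_wpDl.
by rewrite mulrC ltr_pM2l// ltrDl.
Qed.

Lemma sqint_continuous_window_approx a (e : R) : sqint a -> 0 < e ->
  exists n h, [/\ continuous h, forall x, `|h x| <= n%:R &
    (energy (fun x => a x - window n h x)%R < e%:E)%E].
Proof.
move=> ia e0; have [ma _] := ia.
have e40 : 0 < e / 4 by rewrite divr_gt0.
have /ge0_cvge0P := energy_truncation_cvg ia.
move=> /(_ _ _ e40)[|n _ /(_ n (leqnn n)) an]; first by move=> ?; exact: energy_ge0.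
pose b y := if `|a y| <= n%:R then a y else 0.
have mb : measurable_fun setT b.
  by apply: measurable_fun_ifT => //; exact: measurable_norm_le.
have bn x : `|b x| <= n%:R by rewrite /b; case: ifPn => //; rewrite normr0.
have [h [ch hn hb]] := energy_continuous_approx mb bn e40.
exists n, h; split => //.
have mh := continuous_measurable_fun ch.
apply: (@le_lt_trans _ _ (2%:E * energy (fun x => a x - window n b x)%R +
    2%:E * energy (fun x => window n b x - window n h x)%R)%E).
  rewrite -[X in energy X]/(fun x => _).
  rewrite (_ : (fun x => a x - window n h x) = (fun x => (a x - window n b x) +
     (window n b x - window n h x))); last by apply/funext => x; rewrite addrA subrK.
  by apply: energyD_le; apply: measurable_funB => //; exact: measurable_window.
exact: lte_quarters.
Qed.

(** Away from the two jumps at [n] and [- n], the windowed function is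
    continuous, so the integrand converges to 0 almost everywhere; bounded
    shifts keep it supported in a fixed interval. *)
Lemma window_shift_cvg n h (u : nat -> R) : continuous h ->
  (forall x, `|h x| <= n%:R) -> u @ \oo --> 0 ->
  energy (fun x => window n h x - window n h (x - u k)) @[k --> \oo] --> 0%E.
Proof.
move=> ch hn u0.
have mw : measurable_fun setT (window n h).
  by apply: measurable_window; exact: continuous_measurable_fun.
have [M [_ HM]] := cvg_seq_bounded (cvgP _ u0).
have uM k : `|u k| <= `|M| + 1.
  by apply: (HM (`|M| + 1)) => //; rewrite (le_lt_trans (ler_norm _))// ltrDl.
pose B := n%:R + (`|M| + 1).
have wn x : `|window n h x| <= n%:R.
  by rewrite /window; case: ifPn => // _; rewrite normr0.
rewrite (_ : 0%E = (\int[mu]_x (cst 0 x)%:E)%E); last by rewrite integral0.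
apply: (@cvg_integral_dominated _ _ _ mu _ _
  (fun x => (2 * n%:R) ^+ 2 * \1_(`[-B, B]%classic) x)) => //.
- move=> k; apply: measurable_funX; apply: measurable_funB => //.
  exact: measurable_fun_shift.
  (* the exceptional set consists of the two jumps *)
- exists ([set n%:R] `|` [set - n%:R]); split.
  + by apply: measurableU; exact: measurable_set1.
  + by apply: countable_lebesgue_measure0; apply: finite_set_countable; rewrite finite_setU; split; exact: finite_set1.
  + move=> x /=; apply: contra_notP => xn.
    have xu : x - u k @[k --> \oo] --> x.
      by rewrite -[X in _ --> X]subr0; apply: cvgB => //; exact: cvg_cst.
    have xn' : `|x| != n%:R.
      apply/eqP => xE; apply: xn; move: xE.
      by case: (ger0P x) => _ <-; [left|right; rewrite opprK].
    rewrite [X in _ --> X](_ : cst 0 x = (window n h x - window n h x) ^+ 2); last first.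
      by rewrite subrr expr0n.
    apply: (@cvg_comp _ _ _ (fun k => window n h x - window n h (x - u k)) (fun y => y ^+ 2)); last exact: exprn_continuous.
    apply: cvgB; first exact: cvg_cst.
    have [xlt|xgt] := ltP `|x| n%:R.
      rewrite {2}/window (ltW xlt).
      have hx : h (x - u k) @[k --> \oo] --> h x.
        exact: (continuous_cvg _ (ch x) xu).
      apply: cvg_trans hx.
      apply: near_eq_cvg; near=> k.
      rewrite /window ifT// ltW//; near: k.
      exact: (cvgr_lt `|x| (cvg_norm xu)).
    rewrite {2}/window ifF; last by apply/negbTE; rewrite -ltNge lt_neqAle eq_sym xn'.
    apply: cvg_near_cst; near=> k.
    rewrite /window ifF//; apply/negbTE; rewrite -ltNge; near: k.
    by apply: (cvgr_gt `|x| (cvg_norm xu)); rewrite lt_neqAle eq_sym xn'.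
- by apply: integrableZl_EFin; exact: integrable_indic_itv.
- move=> k x; rewrite ger0_norm ?sqr_ge0//.
  have [xB|xB] := leP `|x| B.
    rewrite indicE mem_set ?mulr1; last by rewrite /= in_itv/= -ler_norml.
    rewrite -real_normK ?num_real// lerXn2r ?nnegrE ?mulr_ge0//.
    by rewrite (le_trans (ler_normB _ _))// mulr_natl mulr2n lerD.
  rewrite /window ifF; last first.
    apply/negbTE; rewrite -ltNge (le_lt_trans _ xB)// /B lerDl.
    by rewrite addr_ge0.
  rewrite ifF; last first.
    apply/negbTE; rewrite -ltNge.
    have : `|x| <= `|x - u k| + `|u k| by rewrite -{1}(subrK (u k) x) ler_normD.
    by have := uM k; move: xB; rewrite /B; lra.
  by rewrite subrr expr0n mulr_ge0// sqr_ge0.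
Unshelve. all: by end_near. Qed.

(** Translation is continuous in the mean-square sense: this holds for windowed
    continuous functions by dominated convergence, and these are dense. *)
Lemma energy_shift_cvg a (u : nat -> R) : sqint a -> u @ \oo --> 0 ->
  energy (fun x => a x - a (x - u k)) @[k --> \oo] --> 0%E.
Proof.
move=> ia u0; have [ma _] := ia.
apply/ge0_cvge0P; first by move=> ?; exact: energy_ge0.
move=> e e0.
have e40 : 0 < e / 4 by rewrite divr_gt0.
have e160 : 0 < e / 4 / 4 by rewrite divr_gt0.
have [n [h [ch hn ah]]] := sqint_continuous_window_approx ia e160.
have mw : measurable_fun setT (window n h).
  by apply: measurable_window; exact: continuous_measurable_fun.
have /ge0_cvge0P := window_shift_cvg ch hn u0.
move=> /(_ (fun=> energy_ge0 _) _ e40) H; near=> k.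
pose p x := a x - window n h x.
have mp : measurable_fun setT p by exact: measurable_funB.
rewrite (_ : (fun x => _) = (fun x => (p x - p (x - u k)) +
   (window n h x - window n h (x - u k)))); last by apply/funext => x; rewrite /p; ring.
apply: le_lt_trans (energyD_le _ _) _.
- by apply: measurable_funB => //; exact: measurable_fun_shift.
- by apply: measurable_funB => //; exact: measurable_fun_shift.
apply: lte_quarters; last by near: k.
apply: le_lt_trans (energyD_le mp _) _.
  by apply: measurableT_comp => //; exact: measurable_fun_shift.
by apply: lte_quarters => //; rewrite energyN energy_shift.
Unshelve. all: by end_near. Qed.

Definition autocorrelation a (u : R) : R :=
  Rintegral mu setT (fun s => a s * a (s - u)).

Lemma autocorrelation0 a : sqint a -> (autocorrelation a 0)%:E = energy a.
Proof.
move=> ia; rewrite -sqint_energyE//; congr EFin; apply: eq_Rintegral => x _.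
by rewrite subr0 expr2.
Qed.

(** Expanding the square relates the continuity of the autocorrelation at 0 to
    the continuity of translations. *)
Lemma autocorrelationE a (u : R) : sqint a ->
  energy (fun s => a s - a (s - u)) =
  (2 * autocorrelation a 0 - 2 * autocorrelation a u)%:E.
Proof.
move=> ia; have iua := sqint_shift u ia.
rewrite -sqint_energyE; last exact: sqintB.
congr EFin.
transitivity (Rintegral mu setT (fun s => (a s ^+ 2 + a (s - u) ^+ 2) - 2 * (a s * a (s - u)))).
  by apply: eq_Rintegral => s _; ring.
rewrite RintegralB//; first last.
- by apply: integrableZl_EFin; exact: sqintM_integrable.
- by apply: integrableD_EFin; exact: sqint_integrable.
rewrite RintegralD//; [|exact: sqint_integrable|exact: sqint_integrable].
rewrite RintegralZl//; last exact: sqintM_integrable.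
congr (_ - _).
have E : autocorrelation a 0 = Rintegral mu setT (fun s => a s ^+ 2).
  by apply: EFin_inj; rewrite autocorrelation0// sqint_energyE.
rewrite E mulr_natl mulr2n; congr (_ + _); apply: EFin_inj.
by rewrite !sqint_energyE// energy_shift//; case: ia.
Qed.

Lemma cvg_autocorrelation a (u : nat -> R) : sqint a -> u @ \oo --> 0 ->
  autocorrelation a (u k) @[k --> \oo] --> autocorrelation a 0.
Proof.
move=> ia u0; have := energy_shift_cvg ia u0.
under eq_fun do rewrite autocorrelationE//.
move=> /fine_cvgP[_] H.
rewrite (_ : autocorrelation a 0 = autocorrelation a 0 - 2^-1 * 0); last by ring.
rewrite (_ : (fun k => _) = fun k => autocorrelation a 0 -
   2^-1 * (2 * autocorrelation a 0 - 2 * autocorrelation a (u k))); last first.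
  by apply/funext => k; field.
by apply: cvgB; [exact: cvg_cst|apply: cvgM; [exact: cvg_cst|exact: H]].
Qed.

Lemma Rintegral_norm_shift_le a (u : R) : sqint a ->
  Rintegral mu setT (fun s => `|a s * a (s - u)|) <= autocorrelation a 0.
Proof.
move=> ia; have iua := sqint_shift u ia.
apply: (@le_trans _ _ (Rintegral mu setT (fun s => 2^-1 * (a s ^+ 2 + a (s - u) ^+ 2)))).
  apply: le_Rintegral => //.
  - exact: (integrable_norm (sqintM_integrable ia iua)).
  - by apply: integrableZl_EFin; apply: integrableD_EFin; exact: sqint_integrable.
  - move=> x _; rewrite normrM -[a x ^+ 2]real_normK ?num_real// -[a (x - u) ^+ 2]real_normK ?num_real//.
    by have := sqr_ge0 (`|a x| - `|a (x - u)|); rewrite !sqrrD sqrrN; lra.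
rewrite RintegralZl//; last by apply: integrableD_EFin; exact: sqint_integrable.
rewrite RintegralD//; [|exact: sqint_integrable|exact: sqint_integrable].
have E : autocorrelation a 0 = Rintegral mu setT (fun s => a s ^+ 2).
  by apply: EFin_inj; rewrite autocorrelation0// sqint_energyE.
have -> : Rintegral mu setT (fun s => a (s - u) ^+ 2) = autocorrelation a 0.
  apply: EFin_inj; rewrite autocorrelation0// sqint_energyE//.
  by rewrite energy_shift//; case: ia.
by rewrite -E; lra.
Qed.

Lemma norm_autocorrelation_le a (u : R) : sqint a ->
  `|autocorrelation a u| <= autocorrelation a 0.
Proof.
move=> ia; have iua := sqint_shift u ia.
rewrite (le_trans (le_normr_Rintegral _ (sqintM_integrable ia iua)))//.
exact: Rintegral_norm_shift_le.
Qed.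

End translation_continuity.

(** * Fubini's theorem for real-valued integrals *)

Section fubini_real.
Context d1 d2 (T1 : measurableType d1) (T2 : measurableType d2) (R : realType).
Variables (m1 : {sigma_finite_measure set T1 -> \bar R})
          (m2 : {sigma_finite_measure set T2 -> \bar R}).
Implicit Types Phi : T1 * T2 -> R.

(** The integral of a section is the difference of the integrals of its positive
    and negative parts; where these are infinite it is a conventional value,
    which still depends measurably on [x]. *)
Lemma measurable_fun_Rintegral Phi : measurable_fun setT Phi ->
  measurable_fun setT (fun x => Rintegral m2 setT (fun y => Phi (x, y))).
Proof.
move=> mPhi; have mE : measurable_fun setT (EFin \o Phi) by exact/measurable_EFinP.
apply: (@measurableT_comp _ _ _ _ _ _ fine); first exact: fine_measurable.
rewrite (_ : (fun x => _) = (fun x => \int[m2]_y ((EFin \o Phi)^\+ (x, y)) -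
    \int[m2]_y ((EFin \o Phi)^\- (x, y)))%E); last first.
  apply/funext => x; rewrite integralE; congr (_ - _)%E.
    by apply: eq_integral => y _; rewrite !funeposE.
  by apply: eq_integral => y _; rewrite !funenegE.
apply: emeasurable_funB.
  apply: measurable_fun_fubini_tonelli_F; first exact: measurable_funepos.
  by move=> z; exact: funepos_ge0.
apply: measurable_fun_fubini_tonelli_F; first exact: measurable_funeneg.
by move=> z; exact: funeneg_ge0.
Qed.

Lemma Rintegral_Fubini Phi :
  (m1 \x m2)%E.-integrable setT (EFin \o Phi) ->
  (forall x, m2.-integrable setT (fun y => (Phi (x, y))%:E)) ->
  (forall y, m1.-integrable setT (fun x => (Phi (x, y))%:E)) ->
  Rintegral m1 setT (fun x => Rintegral m2 setT (fun y => Phi (x, y))) =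
  Rintegral m2 setT (fun y => Rintegral m1 setT (fun x => Phi (x, y))).
Proof.
move=> intPhi int1 int2; congr fine.
transitivity (\int[m1]_x \int[m2]_y (EFin \o Phi) (x, y))%E.
  apply: eq_integral => x _; rewrite /Rintegral fineK//.
  exact: integrable_fin_num (int1 x).
rewrite Fubini//; apply: eq_integral => y _.
by rewrite /Rintegral fineK//; exact: integrable_fin_num (int2 y).
Qed.

Lemma Rintegral_Fubini_dominated Phi (p : T1 -> R) (q : T2 -> R) :
  measurable_fun setT Phi ->
  m1.-integrable setT (EFin \o p) -> m2.-integrable setT (EFin \o q) ->
  (forall x y, `|Phi (x, y)| <= p x * q y) ->
  Rintegral m1 setT (fun x => Rintegral m2 setT (fun y => Phi (x, y))) =
  Rintegral m2 setT (fun y => Rintegral m1 setT (fun x => Phi (x, y))).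
Proof.
move=> mPhi intp intq Ppq.
have int1 x : m2.-integrable setT (fun y => (Phi (x, y))%:E).
  apply: le_integrable (integrableZl_EFin (p x) intq) => //.
    by apply/measurable_EFinP; exact: measurableT_comp.
  by move=> y _; rewrite !abse_EFin lee_fin (le_trans (Ppq x y))// ler_norm.
have int2 y : m1.-integrable setT (fun x => (Phi (x, y))%:E).
  apply: le_integrable (integrableZl_EFin (q y) intp) => //.
    by apply/measurable_EFinP; exact: measurableT_comp.
  by move=> x _; rewrite !abse_EFin lee_fin (le_trans (Ppq x y))// mulrC ler_norm.
apply: Rintegral_Fubini => //.
have mE : measurable_fun setT (EFin \o Phi) by exact/measurable_EFinP.
apply/integrable12ltyP => //.
apply: (@le_lt_trans _ _ (\int[m1]_x (`|p x|%:E * \int[m2]_y `|q y|%:E))%E).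
  apply: ge0_le_integral => //.
  - by move=> x _; apply: integral_ge0 => y _; exact: abse_ge0.
  - apply: (measurable_fun_fubini_tonelli_F (abse \o (EFin \o Phi))).
      exact: measurableT_comp.
    by move=> z; exact: abse_ge0.
  - apply: emeasurable_funM => //; apply/measurable_EFinP.
    by apply: measurableT_comp => //; have /measurable_EFinP := measurable_int _ intp.
  move=> x _; rewrite -ge0_integralZl_EFin//; last first.
    apply/measurable_EFinP; apply: measurableT_comp => //.
    by have /measurable_EFinP := measurable_int _ intq.
  apply: ge0_le_integral => //.
  - apply: measurableT_comp => //; exact: measurable_int (int1 x).
  - apply/measurable_EFinP; apply: measurable_funM => //; apply: measurableT_comp => //.
    by have /measurable_EFinP := measurable_int _ intq.
  - move=> y _; rewrite -EFinM lee_fin -normrM (le_trans (Ppq x y))//.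
    exact: ler_norm.
have [_ qoo] := integrableP _ _ _ intq.
have [_ poo] := integrableP _ _ _ intp.
have qfin : (\int[m2]_y `|q y|%:E)%E \is a fin_num.
  by rewrite ge0_fin_numE//; apply: integral_ge0.
rewrite -(fineK qfin) ge0_integralZr//.
- have pfin : (\int[m1]_x `|p x|%:E)%E \is a fin_num.
    by rewrite ge0_fin_numE//; apply: integral_ge0.
  by rewrite -(fineK pfin) -EFinM ltry.
- apply/measurable_EFinP; apply: measurableT_comp => //.
  by have /measurable_EFinP := measurable_int _ intp.
- by rewrite lee_fin fine_ge0//; exact: integral_ge0.
Qed.

End fubini_real.

(** * Cosine and sine transforms *)

Section abel_kernel.
Context {R : realType}.
Local Notation mu := (@lebesgue_measure R).

Definition abel_kernel (e x : R) : R := expR (- e * `|x|).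

Lemma continuous_abel_kernel e : continuous (abel_kernel e).
Proof.
move=> x; apply: (@continuous_comp _ _ _ (fun x => `|x| : R) (fun y => expR (- e * y))).
  exact: norm_continuous.
exact: continuous_expRM.
Qed.

Lemma measurable_abel_kernel e : measurable_fun setT (abel_kernel e).
Proof. by apply: continuous_measurable_fun; exact: continuous_abel_kernel. Qed.

Lemma abel_kernel_ge0 e x : 0 <= abel_kernel e x.
Proof. exact: expR_ge0. Qed.

Lemma integral_abel_kernel e : 0 < e ->
  (\int[mu]_x (abel_kernel e x)%:E = (2 / e)%:E)%E.
Proof.
move=> e0; rewrite ge0_symfun_integralT.
- rewrite -set_itvcy [RHS]EFinM; congr (_ * _)%E.
  transitivity (\int[mu]_(x in `[0%R, +oo[) (expR (- e * x))%:E)%E; last first.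
    exact: integral_expRNM.
  apply: eq_integral => x; rewrite inE/= in_itv/= andbT => x0.
  by rewrite /abel_kernel ger0_norm.
- exact: abel_kernel_ge0.
- exact: continuous_abel_kernel.
- by move=> x /=; rewrite /abel_kernel normrN.
Qed.

Lemma integrable_abel_kernel e : 0 < e ->
  mu.-integrable setT (EFin \o abel_kernel e).
Proof.
move=> e0; apply/integrableP; split.
  by apply/measurable_EFinP; exact: measurable_abel_kernel.
under eq_integral => x _ do rewrite gee0_abs ?lee_fin ?abel_kernel_ge0//.
by rewrite integral_abel_kernel// ltry.
Qed.

Lemma measurable_cosM (b : R) : measurable_fun setT (fun x : R => cos (b * x)).
Proof.
apply: continuous_measurable_fun => x.
apply: (@continuous_comp _ _ _ (fun x => b * x) cos); last exact: continuous_cos.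
by apply: cvgM; [exact: cvg_cst|exact: cvg_id].
Qed.

Lemma integrable_abel_kernel_cos e b : 0 < e ->
  mu.-integrable setT (fun x => (abel_kernel e x * cos (b * x))%:E).
Proof.
move=> e0; apply: le_integrable (integrable_abel_kernel e0) => //.
  apply/measurable_EFinP; apply: measurable_funM; first exact: measurable_abel_kernel.
  exact: measurable_cosM.
by move=> x _; rewrite /= lee_fin normrM ler_piMr// cos_max.
Qed.

(** As for the half-line, the constant 1 is added to the cosine to have a
    nonnegative integrand, for which evenness can be used. *)
Lemma Rintegral_abel_kernel_cos e b : 0 < e ->
  Rintegral mu setT (fun x => abel_kernel e x * cos (b * x)) =
  2 * e / (e ^+ 2 + b ^+ 2).
Proof.
move=> e0; apply: (addrI (2 / e)).
have -> : 2 / e = Rintegral mu setT (abel_kernel e).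
  by rewrite /Rintegral integral_abel_kernel.
rewrite -RintegralD//; [|exact: integrable_abel_kernel|exact: integrable_abel_kernel_cos].
rewrite /Rintegral [in RHS]integral_abel_kernel//=.
transitivity (fine (\int[mu]_x (abel_kernel e x * (1 + cos (b * x)))%:E)%E).
  by congr fine; apply: eq_integral => x _; rewrite mulrDr mulr1.
rewrite ge0_symfun_integralT.
- rewrite -set_itvcy (_ : (\int[mu]_(x in _) _)%E = (e^-1 + e / (e ^+ 2 + b ^+ 2))%:E).
    by rewrite -EFinM/= mulrDr -mulrA.
  transitivity (\int[mu]_(x in `[0%R, +oo[) (expR (- e * x) * (1 + cos (b * x)))%:E)%E; last first.
    exact: integral_expRNM_1cos.
  apply: eq_integral => x.
  rewrite inE/= in_itv/= andbT => x0.
  by rewrite /abel_kernel ger0_norm.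
- move=> x; rewrite mulr_ge0 ?abel_kernel_ge0//.
- move=> x; apply: cvgM; first exact: continuous_abel_kernel.
  apply: cvgD; first exact: cvg_cst.
  apply: (@continuous_comp _ _ _ (fun x => b * x) cos); last exact: continuous_cos.
  by apply: cvgM; [exact: cvg_cst|exact: cvg_id].
- by move=> x /=; rewrite /abel_kernel normrN mulrN cosN.
Qed.

End abel_kernel.

Section cosine_sine_transforms.
Context {R : realType}.
Local Notation mu := (@lebesgue_measure R).
Implicit Types a : R -> R.

Lemma measurable_fun_Rintegral_lebesgue (Phi : R * R -> R) :
  measurable_fun setT Phi ->
  measurable_fun setT (fun x => Rintegral mu setT (fun y => Phi (x, y))).
Proof.
exact: (@measurable_fun_Rintegral _ _ R (measurableTypeR R) R mu Phi).
Qed.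

Definition fcos a (xi : R) : R := Rintegral mu setT (fun t => a t * cos (2 * pi * t * xi)).
Definition fsin a (xi : R) : R := Rintegral mu setT (fun t => a t * sin (2 * pi * t * xi)).

Lemma Rintegral_swap_dominated (Phi : R * R -> R) (p q : R -> R) :
  measurable_fun setT Phi ->
  mu.-integrable setT (EFin \o p) -> mu.-integrable setT (EFin \o q) ->
  (forall x y, `|Phi (x, y)| <= p x * q y) ->
  Rintegral mu setT (fun x => Rintegral mu setT (fun y => Phi (x, y))) =
  Rintegral mu setT (fun y => Rintegral mu setT (fun x => Phi (x, y))).
Proof.
exact: (@Rintegral_Fubini_dominated _ _ (measurableTypeR R) (measurableTypeR R) R mu mu).
Qed.

Lemma measurable_phase : measurable_fun setT (fun z : R * R => 2 * pi * z.2 * z.1).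
Proof.
apply: measurable_funM; last exact: measurable_fst.
apply: measurable_funM; first exact: measurable_cst.
exact: measurable_snd.
Qed.

Lemma measurable_cos : measurable_fun setT (@cos R).
Proof. by apply: continuous_measurable_fun; exact: continuous_cos. Qed.

Lemma measurable_sin : measurable_fun setT (@sin R).
Proof. by apply: continuous_measurable_fun; exact: continuous_sin. Qed.

Lemma measurable_fcos a : measurable_fun setT a -> measurable_fun setT (fcos a).
Proof.
move=> ma; apply: (@measurable_fun_Rintegral_lebesgue
  (fun z => a z.2 * cos (2 * pi * z.2 * z.1))).
apply: measurable_funM; first exact: measurableT_comp measurable_snd.
exact: measurableT_comp measurable_cos measurable_phase.
Qed.

Lemma measurable_fsin a : measurable_fun setT a -> measurable_fun setT (fsin a).
Proof.
move=> ma; apply: (@measurable_fun_Rintegral_lebesgue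
  (fun z => a z.2 * sin (2 * pi * z.2 * z.1))).
apply: measurable_funM; first exact: measurableT_comp measurable_snd.
exact: measurableT_comp measurable_sin measurable_phase.
Qed.

Lemma integrable_bounded_mul a (b : R -> R) (M : R) :
  mu.-integrable setT (EFin \o a) -> measurable_fun setT b ->
  (forall x, `|b x| <= M) -> mu.-integrable setT (fun x => (a x * b x)%:E).
Proof.
move=> inta mb bM; have /measurable_EFinP ma := measurable_int _ inta.
apply: le_integrable (integrableZl_EFin M inta) => //.
  by apply/measurable_EFinP; exact: measurable_funM.
move=> x _; rewrite !abse_EFin lee_fin !normrM mulrC ler_wpM2r//.
exact: le_trans (bM x) (ler_norm _).
Qed.

Lemma measurable_cos_phase xi : measurable_fun setT (fun t : R => cos (2 * pi * t * xi)).
Proof.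
apply: (measurableT_comp measurable_cos).
by apply: measurable_funM => //; apply: measurable_funM.
Qed.

Lemma measurable_sin_phase xi : measurable_fun setT (fun t : R => sin (2 * pi * t * xi)).
Proof.
apply: (measurableT_comp measurable_sin).
by apply: measurable_funM => //; apply: measurable_funM.
Qed.

Lemma integrable_fcos a xi : mu.-integrable setT (EFin \o a) ->
  mu.-integrable setT (fun t => (a t * cos (2 * pi * t * xi))%:E).
Proof.
move=> inta; apply: (integrable_bounded_mul (M := 1)) => //.
  exact: measurable_cos_phase.
by move=> x; rewrite cos_max.
Qed.

Lemma integrable_fsin a xi : mu.-integrable setT (EFin \o a) ->
  mu.-integrable setT (fun t => (a t * sin (2 * pi * t * xi))%:E).
Proof.
move=> inta; apply: (integrable_bounded_mul (M := 1)) => //.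
  exact: measurable_sin_phase.
by move=> x; rewrite sin_max.
Qed.

Definition L1norm a : R := Rintegral mu setT (fun t => `|a t|).

Lemma norm_fcos_le a xi : mu.-integrable setT (EFin \o a) ->
  `|fcos a xi| <= L1norm a.
Proof.
move=> inta; rewrite (le_trans (le_normr_Rintegral _ (integrable_fcos xi inta)))//.
apply: le_Rintegral => //.
- exact: (integrable_norm (integrable_fcos xi inta)).
- exact: (integrable_norm inta).
- by move=> x _; rewrite normrM ler_piMr// cos_max.
Qed.

Lemma norm_fsin_le a xi : mu.-integrable setT (EFin \o a) ->
  `|fsin a xi| <= L1norm a.
Proof.
move=> inta; rewrite (le_trans (le_normr_Rintegral _ (integrable_fsin xi inta)))//.
apply: le_Rintegral => //.
- exact: (integrable_norm (integrable_fsin xi inta)).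
- exact: (integrable_norm inta).
- by move=> x _; rewrite normrM ler_piMr// sin_max.
Qed.

Lemma fcosN a xi : fcos a (- xi) = fcos a xi.
Proof. by apply: eq_Rintegral => t _; rewrite mulrN cosN. Qed.

Lemma fsinN a xi : mu.-integrable setT (EFin \o a) -> fsin a (- xi) = - fsin a xi.
Proof.
move=> inta; rewrite -[RHS]mulN1r /fsin -RintegralZl//; last exact: integrable_fsin.
by apply: eq_Rintegral => t _; rewrite mulrN sinN mulrN mulN1r.
Qed.

Lemma Rintegral_reflect a (s : R) : measurable_fun setT a ->
  Rintegral mu setT (fun u => a (s - u)) = Rintegral mu setT a.
Proof.
move=> ma.
rewrite -(Rintegral_opp ma) -(Rintegral_shift s (f := fun x => a (- x))).
  by apply: eq_Rintegral => u _; rewrite opprB.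
exact: measurableT_comp.
Qed.

Lemma integrable_reflect a (s : R) : mu.-integrable setT (EFin \o a) ->
  mu.-integrable setT (fun u => (a (s - u))%:E).
Proof.
move=> inta.
apply: eq_integrable (integrable_shift s (integrable_opp inta)) => //.
by move=> u _ /=; rewrite opprB.
Qed.

Lemma cosB_expand a (s xi : R) : mu.-integrable setT (EFin \o a) ->
  cos (2 * pi * s * xi) * fcos a xi + sin (2 * pi * s * xi) * fsin a xi =
  Rintegral mu setT (fun t => a t * cos (2 * pi * (s - t) * xi)).
Proof.
move=> inta.
rewrite -!RintegralZl//; [|exact: integrable_fsin|exact: integrable_fcos].
rewrite -RintegralD//; first last.
- by apply: integrableZl_EFin; exact: integrable_fsin.
- by apply: integrableZl_EFin; exact: integrable_fcos.
apply: eq_Rintegral => t _.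
rewrite (_ : 2 * pi * (s - t) * xi = 2 * pi * s * xi - 2 * pi * t * xi); last by ring.
by rewrite cosB; ring.
Qed.

End cosine_sine_transforms.

(** * Plancherel's formula for real functions *)

Section real_plancherel.
Context {R : realType}.
Local Notation mu := (@lebesgue_measure R).
Variable a : R -> R.
Hypotheses (inta : mu.-integrable setT (EFin \o a)) (ia : sqint a).

Let ma : measurable_fun setT a. Proof. by case: ia. Qed.

Definition spectral_density (xi : R) : R := fcos a xi ^+ 2 + fsin a xi ^+ 2.

Lemma spectral_density_ge0 xi : 0 <= spectral_density xi.
Proof. by rewrite addr_ge0 ?sqr_ge0. Qed.

Lemma measurable_spectral_density : measurable_fun setT spectral_density.
Proof.
by apply: measurable_funD; apply: measurable_funX;
  [exact: measurable_fcos|exact: measurable_fsin].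
Qed.

Let L := L1norm a.

Let L0 : 0 <= L. Proof. by apply: Rintegral_ge0. Qed.

Lemma spectral_density_le xi : spectral_density xi <= 2 * L ^+ 2.
Proof.
rewrite mulr_natl mulr2n lerD// -real_normK ?num_real// lerXn2r ?nnegrE//.
  exact: norm_fcos_le.
exact: norm_fsin_le.
Qed.

(** Its integral against [a s] is the spectral density, and it is itself the
    integral over [t] of [a t * cos (2 pi (s - t) xi)]: the difference [s - t]
    is what brings in the autocorrelation. *)
Let damped (xi s : R) :=
  cos (2 * pi * s * xi) * fcos a xi + sin (2 * pi * s * xi) * fsin a xi.

Let damped_le xi s : `|damped xi s| <= 2 * L.
Proof.
rewrite mulr_natl mulr2n; apply: le_trans (ler_normD _ _) _; rewrite !normrM lerD//.
  by apply: le_trans (norm_fcos_le xi inta); rewrite ler_piMl// cos_max.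
by apply: le_trans (norm_fsin_le xi inta); rewrite ler_piMl// sin_max.
Qed.

Let measurable_damped : measurable_fun setT (fun z : R * R => damped z.1 z.2).
Proof.
apply: measurable_funD; apply: measurable_funM.
- exact: measurableT_comp measurable_cos measurable_phase.
- exact: measurableT_comp (measurable_fcos ma) measurable_fst.
- exact: measurableT_comp measurable_sin measurable_phase.
- exact: measurableT_comp (measurable_fsin ma) measurable_fst.
Qed.

Lemma spectral_densityE xi :
  spectral_density xi = Rintegral mu setT (fun s => a s * damped xi s).
Proof.
rewrite /spectral_density.
have -> : fcos a xi ^+ 2 =
    Rintegral mu setT (fun t => a t * cos (2 * pi * t * xi) * fcos a xi).
  by rewrite RintegralZr ?expr2//; exact: integrable_fcos.
have -> : fsin a xi ^+ 2 =
    Rintegral mu setT (fun t => a t * sin (2 * pi * t * xi) * fsin a xi).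
  by rewrite RintegralZr ?expr2//; exact: integrable_fsin.
rewrite -RintegralD//.
- by apply: eq_Rintegral => s _; rewrite /damped; ring.
- apply: (integrable_bounded_mul (M := L)).
  + exact: integrable_fcos.
  + exact: measurable_cst.
  + by move=> _; exact: norm_fcos_le.
- apply: (integrable_bounded_mul (M := L)).
  + exact: integrable_fsin.
  + exact: measurable_cst.
  + by move=> _; exact: norm_fsin_le.
Qed.

(** The Fourier transform of the damping factor [exp (- e |xi|)]. *)
Definition poisson_kernel (e u : R) : R := 2 * e / (e ^+ 2 + (2 * pi * u) ^+ 2).

Let poisson_den (e u : R) : 0 < e -> 0 < e ^+ 2 + (2 * pi * u) ^+ 2.
Proof. by move=> e0; rewrite ltr_wpDr ?sqr_ge0// exprn_gt0. Qed.

Lemma poisson_kernel_scale (e v : R) : 0 < e ->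
  poisson_kernel e (e * v) = e^-1 * (2 * cauchy_kernel v).
Proof.
move=> e0; rewrite /poisson_kernel /cauchy_kernel mulrCA.
move: (2 * pi * v) => p.
have p0 : 1 + p ^+ 2 != 0 by rewrite gt_eqF// ltr_wpDr ?sqr_ge0.
have -> : e ^+ 2 + (e * p) ^+ 2 = e ^+ 2 * (1 + p ^+ 2) by ring.
by field; rewrite p0 gt_eqF.
Qed.

Lemma poisson_kernelE (e u : R) : 0 < e ->
  poisson_kernel e u = e^-1 * (2 * cauchy_kernel (e^-1 * u)).
Proof.
move=> e0; rewrite -poisson_kernel_scale// mulrA divff ?mul1r//.
by rewrite gt_eqF.
Qed.

Lemma poisson_kernel_ge0 (e u : R) : 0 < e -> 0 <= poisson_kernel e u.
Proof.
move=> e0; rewrite poisson_kernelE// mulr_ge0 ?invr_ge0 ?(ltW e0)//.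
by rewrite mulr_ge0 ?cauchy_kernel_ge0.
Qed.

Lemma poisson_kernel_le (e u : R) : 0 < e -> poisson_kernel e u <= 2 / e.
Proof.
move=> e0; rewrite poisson_kernelE// mulrC ler_wpM2r ?invr_ge0 ?(ltW e0)//.
by rewrite -[leRHS]mulr1 ler_wpM2l// cauchy_kernel_le1.
Qed.

Lemma measurable_poisson_kernel e : 0 < e -> measurable_fun setT (poisson_kernel e).
Proof.
move=> e0; rewrite (_ : poisson_kernel e = (fun u => e^-1 * (2 * cauchy_kernel (e^-1 * u)))).
  apply: measurable_funM => //; apply: measurable_funM => //.
  by apply: (measurableT_comp measurable_cauchy_kernel); exact: measurable_funM.
by apply/funext => u; exact: poisson_kernelE.
Qed.

Lemma integrable_poisson_kernel e : 0 < e ->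
  mu.-integrable setT (EFin \o poisson_kernel e).
Proof.
move=> e0.
have e0' : 0 < e^-1 by rewrite invr_gt0.
have intk : mu.-integrable setT (fun u => (e^-1 * (2 * cauchy_kernel (e^-1 * u)))%:E).
  do 2 apply: integrableZl_EFin.
  exact: (integrable_scale e0' integrable_cauchy_kernel).
by apply: eq_integrable intk => // u _; rewrite /= poisson_kernelE.
Qed.

Lemma Rintegral_abel_kernel_phase (e u : R) : 0 < e ->
  Rintegral mu setT (fun xi => abel_kernel e xi * cos (2 * pi * u * xi)) =
  poisson_kernel e u.
Proof. by move=> e0; rewrite Rintegral_abel_kernel_cos. Qed.

(** Integrating the damping factor first replaces [cos (2 pi (s - t) xi)] by
    the Poisson kernel at [s - t], that is, makes a convolution. *)
Let inner_damped e s : 0 < e ->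
  Rintegral mu setT (fun xi => abel_kernel e xi * damped xi s) =
  Rintegral mu setT (fun u => a (s - u) * poisson_kernel e u).
Proof.
move=> e0.
pose Phi (z : R * R) := abel_kernel e z.1 * (a z.2 * cos (2 * pi * (s - z.2) * z.1)).
transitivity (Rintegral mu setT (fun xi => Rintegral mu setT (fun t => Phi (xi, t)))).
  apply: eq_Rintegral => xi _; rewrite /damped cosB_expand// -RintegralZl//.
  apply: (integrable_bounded_mul (M := 1)) => //.
    apply: (measurableT_comp measurable_cos).
    by apply: measurable_funM => //; apply: measurable_funM => //; exact: measurable_funB.
  by move=> t; rewrite cos_max.
rewrite (@Rintegral_swap_dominated R Phi (abel_kernel e) (fun t => `|a t|)).
- transitivity (Rintegral mu setT (fun t => (fun v => a v * poisson_kernel e (s - v)) t)).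
    apply: eq_Rintegral => t _ /=; rewrite -Rintegral_abel_kernel_phase// -RintegralZl//.
      by apply: eq_Rintegral => xi _; rewrite /Phi/=; ring.
    exact: integrable_abel_kernel_cos.
  rewrite -(Rintegral_reflect s).
    by apply: eq_Rintegral => u _; rewrite subKr.
  apply: measurable_funM => //.
  apply: (measurableT_comp (measurable_poisson_kernel e0)).
  exact: measurable_funB.
- apply: measurable_funM.
    exact: measurableT_comp (measurable_abel_kernel e) measurable_fst.
  apply: measurable_funM; first exact: measurableT_comp ma measurable_snd.
  apply: (measurableT_comp measurable_cos).
  apply: measurable_funM; last exact: measurable_fst.
  apply: measurable_funM => //; apply: measurable_funB => //; exact: measurable_snd.
- exact: integrable_abel_kernel.
- exact: integrable_norm.
- move=> xi t /=; rewrite normrM ger0_norm ?abel_kernel_ge0// ler_wpM2l ?abel_kernel_ge0//.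
  by rewrite normrM ler_piMr// cos_max.
Qed.

Let autocorr_kernel e (z : R * R) := a z.1 * (a (z.1 - z.2) * poisson_kernel e z.2).

Let measurable_autocorr_kernel e : 0 < e -> measurable_fun setT (autocorr_kernel e).
Proof.
move=> e0; apply: measurable_funM; first exact: measurableT_comp ma measurable_fst.
apply: measurable_funM; last first.
  exact: measurableT_comp (measurable_poisson_kernel e0) measurable_snd.
apply: (measurableT_comp ma); apply: measurable_funB.
  exact: measurable_fst.
exact: measurable_snd.
Qed.

Lemma measurable_autocorrelation : measurable_fun setT (autocorrelation a).
Proof.
apply: (@measurable_fun_Rintegral_lebesgue R (fun z => a z.2 * a (z.2 - z.1))).
apply: measurable_funM; first exact: measurableT_comp ma measurable_snd.
apply: (measurableT_comp ma); apply: measurable_funB.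
  exact: measurable_snd.
exact: measurable_fst.
Qed.

Lemma integrable_poisson_autocorrelation e : 0 < e ->
  mu.-integrable setT (fun u => (poisson_kernel e u * autocorrelation a u)%:E).
Proof.
move=> e0; apply: (integrable_bounded_mul (M := autocorrelation a 0)).
- exact: integrable_poisson_kernel.
- exact: measurable_autocorrelation.
- by move=> u; exact: norm_autocorrelation_le.
Qed.

(** Absolute integrability in the plane comes from integrating over [s] first:
    the integral of [|a s * a (s - u)|] is at most the energy of [a], uniformly
    in [u]. *)
Let swap_autocorr e : 0 < e ->
  Rintegral mu setT (fun s => Rintegral mu setT (fun u => autocorr_kernel e (s, u))) =
  Rintegral mu setT (fun u => poisson_kernel e u * autocorrelation a u).
Proof.
move=> e0.
have int1 u : mu.-integrable setT (fun s => (autocorr_kernel e (s, u))%:E).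
  have ints := integrableZl_EFin (poisson_kernel e u)
    (sqintM_integrable ia (sqint_shift u ia)).
  by apply: eq_integrable ints => // s _; rewrite /autocorr_kernel/=; congr EFin; ring.
have int2 (s : R) : mu.-integrable setT (fun u => (autocorr_kernel e (s, u))%:E).
  rewrite /autocorr_kernel/=; apply: integrableZl_EFin.
  apply: (integrable_bounded_mul (M := 2 / e)).
  + exact: integrable_reflect.
  + exact: measurable_poisson_kernel.
  + by move=> u; rewrite ger0_norm ?poisson_kernel_ge0// poisson_kernel_le.
rewrite (@Rintegral_Fubini _ _ (measurableTypeR R) (measurableTypeR R) R mu mu (autocorr_kernel e))//.
- apply: eq_Rintegral => u _; rewrite /autocorrelation -RintegralZl//.
    by apply: eq_Rintegral => s _; rewrite /autocorr_kernel/=; ring.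
  by apply: sqintM_integrable => //; exact: sqint_shift.
- have mE : measurable_fun setT (EFin \o autocorr_kernel e).
    by apply/measurable_EFinP; exact: measurable_autocorr_kernel.
  apply/integrable21ltyP => //.
  apply: (@le_lt_trans _ _ (\int[mu]_u (poisson_kernel e u * autocorrelation a 0)%:E)%E).
    apply: ge0_le_integral => //.
    + by move=> u _; apply: integral_ge0 => s _; exact: abse_ge0.
    + apply: (@measurable_fun_fubini_tonelli_G _ _ (measurableTypeR R) (measurableTypeR R)
          R mu (abse \o (EFin \o autocorr_kernel e))).
        exact: measurableT_comp.
      by move=> z; exact: abse_ge0.
    + apply/measurable_EFinP; apply: measurable_funM => //.
      exact: measurable_poisson_kernel.
    + move=> u _; have intn := integrable_norm (int1 u).
      rewrite (_ : (\int[mu]_s _)%E =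
          (Rintegral mu setT (fun s => `|autocorr_kernel e (s, u)|))%:E).
        rewrite lee_fin.
        have -> : Rintegral mu setT (fun s => `|autocorr_kernel e (s, u)|) =
            Rintegral mu setT (fun s => poisson_kernel e u * `|a s * a (s - u)|).
          apply: eq_Rintegral => s _; rewrite /autocorr_kernel/= mulrA normrM mulrC.
          by rewrite (ger0_norm (poisson_kernel_ge0 _ _)).
        rewrite RintegralZl//; last first.
          exact: (integrable_norm (sqintM_integrable ia (sqint_shift u ia))).
        by rewrite ler_wpM2l ?poisson_kernel_ge0// Rintegral_norm_shift_le.
      by rewrite /Rintegral fineK//; exact: integrable_fin_num intn.
  apply: integrable_lty => //.
  apply: (integrable_bounded_mul (M := `|autocorrelation a 0|)) => //.
  exact: integrable_poisson_kernel.
Qed.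

(** The change of variable [u = e v] moves the parameter from the kernel to the
    autocorrelation, where the limit [e -> 0] is a matter of dominated
    convergence. *)
Lemma Rintegral_abel_spectral_density e : 0 < e ->
  Rintegral mu setT (fun xi => abel_kernel e xi * spectral_density xi) =
  Rintegral mu setT (fun v => 2 * cauchy_kernel v * autocorrelation a (e * v)).
Proof.
move=> e0.
pose Phi (z : R * R) := abel_kernel e z.1 * (a z.2 * damped z.1 z.2).
transitivity (Rintegral mu setT (fun xi => Rintegral mu setT (fun s => Phi (xi, s)))).
  apply: eq_Rintegral => xi _; rewrite spectral_densityE -RintegralZl//.
  apply: (integrable_bounded_mul (M := 2 * L)) => //.
  exact: (measurableT_comp measurable_damped (pair1_measurable xi)).
rewrite (@Rintegral_swap_dominated R Phi (abel_kernel e) (fun s => 2 * L * `|a s|)).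
- transitivity (Rintegral mu setT (fun s => Rintegral mu setT (fun u => autocorr_kernel e (s, u)))).
    apply: eq_Rintegral => s _ /=.
    transitivity (a s * Rintegral mu setT (fun xi => abel_kernel e xi * damped xi s)).
      rewrite -RintegralZl//; first by apply: eq_Rintegral => xi _; rewrite /Phi/=; ring.
      apply: (integrable_bounded_mul (M := 2 * L)) => //.
        exact: integrable_abel_kernel.
      exact: (measurableT_comp measurable_damped (pair2_measurable s)).
    rewrite inner_damped// -RintegralZl//.
    apply: (integrable_bounded_mul (M := 2 / e)).
    + exact: integrable_reflect.
    + exact: measurable_poisson_kernel.
    + by move=> u; rewrite ger0_norm ?poisson_kernel_ge0// poisson_kernel_le.
  rewrite (swap_autocorr e0).
  have intf := integrable_poisson_autocorrelation e0.
  have eN0 : e != 0 by rewrite gt_eqF.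
  transitivity (e * Rintegral mu setT
      (fun v => poisson_kernel e (e * v) * autocorrelation a (e * v))).
    by rewrite (Rintegral_scale e0 intf) mulVKf.
  rewrite -RintegralZl//; last exact: (integrable_scale e0 intf).
  apply: eq_Rintegral => v _; rewrite poisson_kernel_scale//.
  by rewrite -[_ * _ * autocorrelation _ _]mulrA mulVKf.
- apply: measurable_funM.
    exact: measurableT_comp (measurable_abel_kernel e) measurable_fst.
  by apply: measurable_funM => //; exact: measurableT_comp ma measurable_snd.
- exact: integrable_abel_kernel.
- by apply: integrableZl_EFin; exact: integrable_norm.
- move=> xi s /=; rewrite normrM ger0_norm ?abel_kernel_ge0// ler_wpM2l ?abel_kernel_ge0//.
  by rewrite normrM mulrC ler_wpM2r.
Qed.

Let cvg_rhs : Rintegral mu setT (fun v => 2 * cauchy_kernel v * autocorrelation a (n.+1%:R^-1 * v))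
    @[n --> \oo] --> autocorrelation a 0.
Proof.
have -> : autocorrelation a 0 = Rintegral mu setT (fun v => 2 * cauchy_kernel v * autocorrelation a 0).
  rewrite RintegralZr//; last by apply: integrableZl_EFin; exact: integrable_cauchy_kernel.
  rewrite RintegralZl//; last exact: integrable_cauchy_kernel.
  by rewrite /Rintegral integral_cauchy_kernel/= mulfV// mul1r.
apply: (@cvg_Rintegral_dominated _ _ _ mu _ _ (fun v => 2 * cauchy_kernel v * autocorrelation a 0)).
- move=> n; apply: measurable_funM.
    by apply: measurable_funM => //; exact: measurable_cauchy_kernel.
  by apply: (measurableT_comp measurable_autocorrelation); exact: measurable_funM.
- apply: measurable_funM => //.
  by apply: measurable_funM => //; exact: measurable_cauchy_kernel.
- apply: aeW => v; apply: cvgM; first exact: cvg_cst.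
  apply: cvg_autocorrelation => //.
  by rewrite -[X in _ --> X](mul0r v); apply: cvgM; [exact: cvg_harmonic|exact: cvg_cst].
- apply: (integrable_bounded_mul (M := `|autocorrelation a 0|)) => //.
  by apply: integrableZl_EFin; exact: integrable_cauchy_kernel.
- move=> n v; rewrite normrM ger0_norm; last by rewrite mulr_ge0 ?cauchy_kernel_ge0.
  rewrite ler_wpM2l ?mulr_ge0 ?cauchy_kernel_ge0//.
  exact: norm_autocorrelation_le.
Qed.

(** Plancherel's formula for a real function, by Abel summation: the integral of
    the spectral density against a damping factor is the integral of the
    autocorrelation against an approximate identity. *)
Lemma integral_spectral_density :
  (\int[mu]_xi (spectral_density xi)%:E = energy a)%E.
Proof.
have mS := measurable_spectral_density.
pose S_ n xi := (abel_kernel n.+1%:R^-1 xi * spectral_density xi)%:E.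
have S_cvg xi : S_ n xi @[n --> \oo] --> (spectral_density xi)%:E.
  apply: cvg_EFin; first exact: nearW.
  rewrite -[X in _ --> X]mul1r; apply: cvgM; last exact: cvg_cst.
  rewrite -[X in _ --> X](@expR0 R) -(mul0r `|xi|) -oppr0.
  apply: (continuous_cvg _ (@continuous_expR R _)).
  by apply: cvgM; [apply: cvgN; exact: cvg_harmonic|exact: cvg_cst].
have cS : (\int[mu]_xi S_ n xi)%E @[n --> \oo] --> (\int[mu]_xi (spectral_density xi)%:E)%E.
  rewrite (_ : (\int[mu]_xi (spectral_density xi)%:E)%E =
      (\int[mu]_xi limn (S_ ^~ xi))%E); last first.
    by apply: eq_integral => xi _; apply/esym/cvg_lim => //; exact: S_cvg.
  apply: cvg_monotone_convergence => //.
  - move=> n; apply/measurable_EFinP; apply: measurable_funM => //.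
    exact: measurable_abel_kernel.
  - by move=> n xi _; rewrite lee_fin mulr_ge0 ?abel_kernel_ge0 ?spectral_density_ge0.
  - move=> xi _ m n mn; rewrite lee_fin ler_wpM2r ?spectral_density_ge0//.
    rewrite ler_expR ler_wpM2r// lerN2 lef_pV2 ?posrE// ler_nat//.
have cR : (\int[mu]_xi S_ n xi)%E @[n --> \oo] --> energy a.
  rewrite -autocorrelation0//.
  have -> : (fun n => \int[mu]_xi S_ n xi)%E = (fun n => (Rintegral mu setT
      (fun v => 2 * cauchy_kernel v * autocorrelation a (n.+1%:R^-1 * v)))%:E).
    apply/funext => n.
    rewrite -Rintegral_abel_spectral_density ?invr_gt0// /Rintegral fineK//.
    apply: integrable_fin_num => //.
    apply: (integrable_bounded_mul (M := 2 * L ^+ 2)) => //.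
    + by apply: integrable_abel_kernel; rewrite invr_gt0.
    + by move=> xi; rewrite ger0_norm ?spectral_density_ge0// spectral_density_le.
  by apply: cvg_EFin; [exact: nearW|exact: cvg_rhs].
exact: cvg_unique cS cR.
Qed.

End real_plancherel.

(** * Completeness *)

Section completeness.
Context {R : realType}.
Local Notation mu := (@lebesgue_measure R).

(** Shifting by a geometric sequence turns such a sequence into a nondecreasing
    one from below and a nonincreasing one from above. *)
Lemma cvg_geometric_increments (x : nat -> R) (C : R) : 0 <= C ->
  (forall k, `|x k.+1 - x k| <= C * 2^-1 ^+ k) ->
  cvgn x /\ forall n, `|limn x - x n| <= 2 * C * 2^-1 ^+ n.
Proof.
move=> C0 xC.
pose g n : R := 2 * C * 2^-1 ^+ n.
have gS n : g n.+1 = C * 2^-1 ^+ n by rewrite /g exprS; field.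
have gE n : g n = 2 * (C * 2^-1 ^+ n) by rewrite /g mulrA.
have g0 n : 0 <= g n by rewrite /g !mulr_ge0// exprn_ge0// invr_ge0.
have nd : nondecreasing_seq (fun n => x n - g n).
  apply/nondecreasing_seqP => n; rewrite gS gE.
  by have := xC n; rewrite ler_norml => /andP[]; lra.
have ni : nonincreasing_seq (fun n => x n + g n).
  apply/nonincreasing_seqP => n; rewrite gS gE.
  by have := xC n; rewrite ler_norml => /andP[]; lra.
have yz m n : x m - g m <= x n + g n.
  apply: (@le_trans _ _ (x (maxn m n) - g (maxn m n))).
    by apply: nd; exact: leq_maxl.
  apply: (@le_trans _ _ (x (maxn m n) + g (maxn m n))).
    by have := g0 (maxn m n); lra.
  by apply: ni; exact: leq_maxr.
have cy : cvgn (fun n => x n - g n).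
  apply: nondecreasing_is_cvgn => //.
  by exists (x 0%N + g 0%N) => _ [n _ <-].
have cg : g n @[n --> \oo] --> 0.
  rewrite -(mulr0 (2 * C)); apply: cvgM; first exact: cvg_cst.
  by apply: cvg_expr; rewrite ger0_norm ?invr_ge0// invf_lt1// ltr1n.
pose L := limn (fun n => x n - g n).
have cx : x n @[n --> \oo] --> L.
  rewrite (_ : x = (fun n => (x n - g n) + g n)); last by apply/funext => n; rewrite subrK.
  rewrite -[X in _ --> X]addr0; apply: cvgD => //; exact: cy.
split; first exact: cvgP cx.
move=> n; rewrite (cvg_lim _ cx)// ler_norml; apply/andP; split.
  rewrite lerNl opprB lerBlDl -lerBlDr; apply: nondecreasing_cvgn_le => //.
rewrite lerBlDl addrC; apply: limr_le => //.
by apply: nearW => m; rewrite addrC.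
Qed.

(** Riesz-Fischer for a rapidly converging sequence: the weighted sum of the
    squared increments is integrable, hence finite almost everywhere, where it
    dominates the squared increments by a geometric sequence. *)
Lemma energy_complete (a : nat -> R -> R) (C : R) : 0 <= C ->
  (forall n, sqint (a n)) ->
  (forall n, energy (fun x => a n.+1 x - a n x)%R <= (C * 8^-1 ^+ n)%:E)%E ->
  exists2 l, sqint l & energy (fun x => a n x - l x) @[n --> \oo] --> 0%E.
Proof.
move=> C0 ia aC.
have ma n : measurable_fun setT (a n) by case: (ia n).
(* of the decay [8^-n] the weight [4^n] leaves a convergent geometric series,
   while a finite sum of the [d n x] bounds [|a n.+1 x - a n x|] by a multiple
   of [2^-n] *)
pose d n x := (4 ^+ n * (a n.+1 x - a n x) ^+ 2)%:E.
have d0 n x : (0 <= d n x)%E by rewrite lee_fin mulr_ge0 ?sqr_ge0// exprn_ge0.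
have md n : measurable_fun setT (d n).
  apply/measurable_EFinP; apply: measurable_funM => //; apply: measurable_funX.
  exact: measurable_funB.
pose w x := (\sum_(n <oo) d n x)%E.
have w0 x : (0 <= w x)%E by exact: nneseries_ge0.
have mw : measurable_fun setT w.
  by apply: ge0_emeasurable_sum => // n x _ _; exact: d0.
have intw : (\int[mu]_x w x < +oo)%E.
  rewrite integral_nneseries//.
  apply: (@le_lt_trans _ _ (\sum_(n <oo) (C * 2^-1 ^+ n)%:E)%E).
    apply: lee_nneseries => [n _ _|n _]; first by apply: integral_ge0 => x _; exact: d0.
    rewrite /d; under eq_integral do rewrite EFinM.
    rewrite ge0_integralZl_EFin//; last 2 first.
      by move=> x _; rewrite lee_fin sqr_ge0.
      by apply: measurable_sqr; exact: measurable_funB.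
    apply: (@le_trans _ _ ((4 ^+ n)%:E * (C * 8^-1 ^+ n)%:E)%E).
      by rewrite lee_wpmul2l ?lee_fin ?exprn_ge0//; exact: aC.
    rewrite -EFinM lee_fin mulrCA -exprMn ler_wpM2l//.
    by rewrite (_ : 4 / 8 = 2^-1 :> R)//; field.
  have cgeo : series (geometric C (2^-1 : R)) n @[n --> \oo] --> C / (1 - 2^-1).
    by apply: cvg_geometric_series; rewrite ger0_norm ?invr_ge0// invf_lt1// ltr1n.
  rewrite (_ : (\sum_(n <oo) _)%E = (C / (1 - 2^-1))%:E) ?ltry//.
  apply/cvg_lim => //.
  rewrite (_ : (fun n => _) = EFin \o series (geometric C (2^-1 : R))); last first.
    by apply/funext => n; rewrite /series/= sumEFin.
  by apply: cvg_EFin => //; exact: nearW.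
have iw : mu.-integrable setT w.
  apply/integrableP; split => //.
  by under eq_integral => x _ do rewrite gee0_abs//.
have wfin := integrable_ae measurableT iw.
(* the upper limit is measurable, and equals the limit wherever this exists *)
pose l x := fine (limn_esup (fun n => (a n x)%:E)).
have ml : measurable_fun setT l.
  apply: (@measurableT_comp _ _ _ _ _ _ fine); first exact: fine_measurable.
  by apply: measurable_fun_limn_esup => n; apply/measurable_EFinP; exact: ma.
have al x : w x \is a fin_num -> forall n,
    (((a n x - l x) ^+ 2)%:E <= (4 * 4^-1 ^+ n)%:E * w x)%E.
  move=> wx.
  pose W := fine (w x).
  have W0 : 0 <= W by rewrite fine_ge0.
  have dW k : `|a k.+1 x - a k x| <= Num.sqrt W * 2^-1 ^+ k.
    rewrite -(@ler_pXn2r _ 2) ?nnegrE//.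
    rewrite exprMn sqr_sqrtr// real_normK ?num_real// -exprM mulnC exprM.
    rewrite (_ : 2^-1 ^+ 2 = 4^-1 :> R); last by field.
    rewrite exprVn ler_pdivlMr ?exprn_gt0// mulrC.
    rewrite -lee_fin -[_%:E]/(d k x) /W fineK//.
    rewrite /w (nneseriesD1 (n := k))//.
    by rewrite leeDl// nneseries_ge0.
  have [cx xl] := cvg_geometric_increments (sqrtr_ge0 W) dW.
  have lx : l x = limn (fun n => a n x).
    have H : (a n x)%:E @[n --> \oo] --> (limn (fun n => a n x))%:E.
      by apply: cvg_EFin => //; exact: nearW.
    by rewrite /l (is_cvg_limn_esupE (cvgP _ H)) (cvg_lim _ H).
  move=> n; rewrite -(fineK wx) -EFinM lee_fin -/W lx.
  rewrite -real_normK ?num_real// distrC.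
  apply: (@le_trans _ _ ((2 * Num.sqrt W * 2^-1 ^+ n) ^+ 2)).
    by rewrite lerXn2r ?nnegrE// !mulr_ge0 ?sqrtr_ge0// exprn_ge0// invr_ge0.
  rewrite !exprMn sqr_sqrtr// -exprM mulnC exprM.
  have -> : 2^-1 ^+ 2 = 4^-1 :> R by field.
  have -> : 2 ^+ 2 = 4 :> R by ring.
  by rewrite mulrAC.
have el n : (energy (fun x => a n x - l x)%R <= (4 * 4^-1 ^+ n)%:E * \int[mu]_x w x)%E.
  rewrite -ge0_integralZl_EFin//.
  apply: ae_ge0_le_integral => //.
    + by move=> x _; rewrite lee_fin sqr_ge0.
    + by apply: measurable_sqr; exact: measurable_funB.
    + by move=> x _; rewrite mule_ge0// lee_fin mulr_ge0// exprn_ge0// invr_ge0.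
    + exact: measurable_funeM.
    + by apply: filterS wfin => x H _; apply: al; exact: H.
have Wfin : (\int[mu]_x w x)%E \is a fin_num by rewrite ge0_fin_numE// integral_ge0.
exists l.
  have -> : l = (fun x => a 0%N x - (a 0%N x - l x)) by apply/funext => x; rewrite subKr.
  apply: sqintB => //; split; first exact: measurable_funB.
  by rewrite (le_lt_trans (el 0%N))// -(fineK Wfin) -EFinM ltry.
apply: (@squeeze_cvge _ _ _ _ (cst 0%E) _ (fun n => (4 * 4^-1 ^+ n)%:E * \int[mu]_x w x)%E).
- by apply: nearW => n; rewrite energy_ge0 el.
- exact: cvg_cst.
- rewrite -(fineK Wfin) -(mul0e (fine (\int[mu]_x w x)%E)%:E).
  apply: cvgeM => //; last exact: cvg_cst.
  apply: cvg_EFin; first exact: nearW.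
  rewrite -(mulr0 4); apply: cvgM; first exact: cvg_cst.
  by apply: cvg_expr; rewrite ger0_norm ?invr_ge0// invf_lt1// ltr1n.
Qed.

End completeness.

(** * Square integrable complex functions *)

Section complex_parts.
Context {R : realType}.
Local Notation mu := (@lebesgue_measure R).
Implicit Types (z w : R[i]).

Lemma cReD z w : complex.Re (z + w) = complex.Re z + complex.Re w.
Proof. by case: z; case: w. Qed.

Lemma cImD z w : complex.Im (z + w) = complex.Im z + complex.Im w.
Proof. by case: z; case: w. Qed.

Lemma cReB z w : complex.Re (z - w) = complex.Re z - complex.Re w.
Proof. by case: z; case: w. Qed.

Lemma cImB z w : complex.Im (z - w) = complex.Im z - complex.Im w.
Proof. by case: z; case: w. Qed.

Lemma cReM z w :
  complex.Re (z * w) = complex.Re z * complex.Re w - complex.Im z * complex.Im w.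
Proof. by case: z; case: w. Qed.

Lemma cImM z w :
  complex.Im (z * w) = complex.Re z * complex.Im w + complex.Im z * complex.Re w.
Proof. by case: z; case: w. Qed.

Lemma Re_conjc z : complex.Re (conjc z) = complex.Re z.
Proof. by case: z. Qed.

Lemma Im_conjc z : complex.Im (conjc z) = - complex.Im z.
Proof. by case: z. Qed.

(** The squared modulus, as a real number. *)
Definition nsq z : R := complex.Re z ^+ 2 + complex.Im z ^+ 2.

Lemma nsq_ge0 z : 0 <= nsq z.
Proof. by rewrite addr_ge0 ?sqr_ge0. Qed.

Lemma nsqM z w : nsq (z * w) = nsq z * nsq w.
Proof. by rewrite /nsq cReM cImM; ring. Qed.

Lemma nsq_conjc z : nsq (conjc z) = nsq z.
Proof. by rewrite /nsq Re_conjc Im_conjc sqrrN. Qed.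

Lemma nsq_cexpi (a : R) : nsq (cexpi a) = 1.
Proof. by rewrite /nsq/= cos2Dsin2. Qed.

Lemma normcE2 z : ComplexField.Normc.normc z = Num.sqrt (nsq z).
Proof. by case: z. Qed.

Lemma nsq_eq0 z : nsq z = 0 -> z = 0.
Proof.
move=> z0; apply: ComplexField.Normc.eq0_normc.
by rewrite normcE2 z0 sqrtr0.
Qed.

End complex_parts.

Section complex_measurable.
Context d (T : measurableType d) {R : realType}.
Implicit Types f g : T -> R[i].

(** [cmeasurable] over an arbitrary measurable space, such as the
    time-frequency plane. *)
Definition cmeasurable_fun f :=
  measurable_fun setT (fun t => complex.Re (f t)) /\
  measurable_fun setT (fun t => complex.Im (f t)).

Lemma cmeasurable_funM f g : cmeasurable_fun f -> cmeasurable_fun g ->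
  cmeasurable_fun (fun t => f t * g t).
Proof.
move=> [fr fi] [gr gi]; split.
  by under eq_fun do rewrite cReM; apply: measurable_funB; exact: measurable_funM.
by under eq_fun do rewrite cImM; apply: measurable_funD; exact: measurable_funM.
Qed.

Lemma cmeasurable_fun_conjc f : cmeasurable_fun f ->
  cmeasurable_fun (fun t => conjc (f t)).
Proof.
move=> [fr fi]; split; first by under eq_fun do rewrite Re_conjc.
by under eq_fun do rewrite Im_conjc; exact: measurableT_comp.
Qed.

Lemma cmeasurable_fun_comp (f : R -> R[i]) (u : T -> R) :
  cmeasurable f -> measurable_fun setT u -> cmeasurable_fun (fun t => f (u t)).
Proof.
by move=> [fr fi] mu_; split; [exact: measurableT_comp fr mu_|exact: measurableT_comp fi mu_].
Qed.

Lemma measurable_fun_nsq f : cmeasurable_fun f ->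
  measurable_fun setT (fun t => nsq (f t)).
Proof. by move=> [mr mi]; apply: measurable_funD; apply: measurable_funX. Qed.

End complex_measurable.

Section complex_L2.
Context {R : realType}.
Local Notation mu := (@lebesgue_measure R).
Implicit Types (f g h : R -> R[i]).

Lemma measurable_nsq f : cmeasurable f -> measurable_fun setT (fun t => nsq (f t)).
Proof. exact: measurable_fun_nsq. Qed.

Lemma cmeasurableD f g : cmeasurable f -> cmeasurable g ->
  cmeasurable (fun t => f t + g t).
Proof.
move=> [fr fi] [gr gi]; split.
  by under eq_fun do rewrite cReD; exact: measurable_funD.
by under eq_fun do rewrite cImD; exact: measurable_funD.
Qed.

Lemma cmeasurableB f g : cmeasurable f -> cmeasurable g ->
  cmeasurable (fun t => f t - g t).
Proof.
move=> [fr fi] [gr gi]; split.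
  by under eq_fun do rewrite cReB; exact: measurable_funB.
by under eq_fun do rewrite cImB; exact: measurable_funB.
Qed.

Lemma cmeasurableM f g : cmeasurable f -> cmeasurable g ->
  cmeasurable (fun t => f t * g t).
Proof. exact: cmeasurable_funM. Qed.

Lemma cmeasurable_conjc f : cmeasurable f -> cmeasurable (fun t => conjc (f t)).
Proof. exact: cmeasurable_fun_conjc. Qed.

Lemma cmeasurable_cst (c : R[i]) : cmeasurable (fun _ : R => c).
Proof. by split; exact: measurable_cst. Qed.

Lemma cmeasurable_cexpi (b : R) : cmeasurable (fun t : R => cexpi (b * t)).
Proof.
split=> /=.
  by apply: (measurableT_comp measurable_cos); exact: measurable_funM.
by apply: (measurableT_comp measurable_sin); exact: measurable_funM.
Qed.

Lemma cmeasurable_translate f (x : R) : cmeasurable f -> cmeasurable (translate x f).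
Proof.
by move=> [fr fi]; split; [exact: (measurable_fun_shift x fr)|exact: (measurable_fun_shift x fi)].
Qed.

Definition cenergy f : \bar R := (\int[mu]_t (nsq (f t))%:E)%E.

Lemma cenergy_ge0 f : (0 <= cenergy f)%E.
Proof. by apply: integral_ge0 => t _; rewrite lee_fin nsq_ge0. Qed.

Lemma cenergyE f : cmeasurable f -> cenergy f =
  (energy (fun t => complex.Re (f t)) + energy (fun t => complex.Im (f t)))%E.
Proof.
move=> [fr fi]; rewrite /cenergy /nsq /energy.
under eq_integral do rewrite EFinD.
rewrite ge0_integralD//.
- by move=> t _; rewrite lee_fin sqr_ge0.
- exact: measurable_sqr.
- by move=> t _; rewrite lee_fin sqr_ge0.
- exact: measurable_sqr.
Qed.

Lemma norm2_cenergy f : norm2 f = (cenergy f `^ 2^-1)%E.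
Proof.
rewrite /norm2 unlock; congr (_ `^ _)%E; apply: eq_integral => t _.
rewrite gee0_abs ?lee_fin ?normcE2 ?sqrtr_ge0// poweR_EFin.
by rewrite powR_mulrn ?sqrtr_ge0// sqr_sqrtr// nsq_ge0.
Qed.

Lemma cenergy_norm2 f : cenergy f = (norm2 f `^ 2)%E.
Proof.
by rewrite norm2_cenergy -poweRrM mulVf// poweRe1// cenergy_ge0.
Qed.

Lemma norm2_ge0 f : (0 <= norm2 f)%E.
Proof. exact: Lnorm_ge0. Qed.

Lemma norm2_lty f : (norm2 f < +oo)%E <-> (cenergy f < +oo)%E.
Proof.
rewrite norm2_cenergy; split; first by apply: lty_poweRy.
exact: poweR_lty.
Qed.

Lemma L2P f : L2 f <->
  sqint (fun t => complex.Re (f t)) /\ sqint (fun t => complex.Im (f t)).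
Proof.
split=> [[mf /norm2_lty]|[[mr ir] [mi ii]]].
  have [mr mi] := mf; rewrite cenergyE// => foo.
  split; split => //; apply: le_lt_trans foo.
    by rewrite leeDl// energy_ge0.
  by rewrite leeDr// energy_ge0.
have mf : cmeasurable f by [].
by split => //; apply/norm2_lty; rewrite cenergyE// lte_add_pinfty.
Qed.

Lemma le_norm2 f g : cmeasurable f -> cmeasurable g ->
  (forall t, nsq (f t) <= nsq (g t)) -> (norm2 f <= norm2 g)%E.
Proof.
move=> mf mg fg; rewrite !norm2_cenergy.
apply: gt0_ler_poweR; rewrite ?invr_ge0// ?in_itv/= ?cenergy_ge0 ?leey//.
rewrite /cenergy; apply: ge0_le_integral => //.
- by move=> t _; rewrite lee_fin nsq_ge0.
- by apply/measurable_EFinP; exact: measurable_nsq.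
- by apply/measurable_EFinP; exact: measurable_nsq.
- by move=> t _; rewrite lee_fin.
Qed.

Lemma eq_norm2 f g : (forall t, nsq (f t) = nsq (g t)) -> norm2 f = norm2 g.
Proof.
move=> fg; rewrite !norm2_cenergy; congr (_ `^ _)%E.
by apply: eq_integral => t _; rewrite fg.
Qed.

Lemma norm2_lt (e : R) f : 0 < e -> (norm2 f < e%:E)%E <-> (cenergy f < (e ^+ 2)%:E)%E.
Proof.
move=> e0; rewrite norm2_cenergy poweR12_sqrt ?cenergy_ge0//.
have := cenergy_ge0 f; case: (cenergy f) => [r|//|//]; rewrite lee_fin => r0 /=.
by rewrite !lte_fin -{2}(sqr_sqrtr r0) ltr_pXn2r// nnegrE ?sqrtr_ge0// ltW.
Qed.

Lemma cvg_norm2P (u : nat -> R -> R[i]) :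
  norm2 (u n) @[n --> \oo] --> 0%E <-> cenergy (u n) @[n --> \oo] --> 0%E.
Proof.
have P0 := ge0_cvge0P (fun n => norm2_ge0 (u n)).
have Q0 := ge0_cvge0P (fun n => cenergy_ge0 (u n)).
split=> [/P0 H|/Q0 H].
  apply/Q0 => e e0; have se0 : 0 < Num.sqrt e by rewrite sqrtr_gt0.
  apply: filterS (H _ se0) => n /(norm2_lt _ se0).
  by rewrite sqr_sqrtr// ltW.
apply/P0 => e e0; apply: filterS (H (e ^+ 2) _); last by rewrite exprn_gt0.
by move=> n /norm2_lt; exact.
Qed.

Lemma norm2D_le f g : cmeasurable f -> cmeasurable g ->
  (norm2 (fun t => f t + g t)%R <= norm2 f + norm2 g)%E.
Proof.
move=> mf mg.
pose nf t := ComplexField.Normc.normc (f t).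
pose ng t := ComplexField.Normc.normc (g t).
have mn h : cmeasurable h -> measurable_fun setT (fun t => ComplexField.Normc.normc (h t)).
  move=> mh; under eq_fun do rewrite normcE2.
  by apply: (measurableT_comp (continuous_measurable_fun (@sqrt_continuous R))); exact: measurable_nsq.
have n0 z : 0 <= ComplexField.Normc.normc z :> R by rewrite normcE2 sqrtr_ge0.
apply: (le_trans _ (minkowski_EFin mu (mn f mf) (mn g mg) _)); last by rewrite ler1n.
pose nfg t : R[i] := (nf t + ng t)%:C.
have -> : Lnorm mu 2%:E (EFin \o (nf \+ ng)) = norm2 nfg.
  rewrite /norm2; apply: eq_Lnorm => t; rewrite /= expr0n/= addr0 sqrtr_sqr.
  by rewrite ger0_norm// addr_ge0// n0.
apply: le_norm2.
- exact: cmeasurableD.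
- split => /=; last exact: measurable_cst.
  by apply: measurable_funD; exact: mn.
- move=> t; rewrite {2}/nsq/= expr0n/= addr0.
  rewrite -[leLHS]sqr_sqrtr ?nsq_ge0// -normcE2.
  rewrite lerXn2r ?nnegrE ?n0 ?addr_ge0 ?n0//.
  exact: le_normcD.
Qed.

Lemma L2_cmeasurable f : L2 f -> cmeasurable f.
Proof. by case. Qed.

Lemma L2D f g : L2 f -> L2 g -> L2 (fun t => f t + g t).
Proof.
move=> [mf foo] [mg goo]; split; first exact: cmeasurableD.
by rewrite (le_lt_trans (norm2D_le mf mg))// lte_add_pinfty.
Qed.

Lemma norm2_unimodular (m : R -> R[i]) f : (forall t, nsq (m t) = 1) ->
  norm2 (fun t => m t * f t) = norm2 f.
Proof. by move=> m1; apply: eq_norm2 => t; rewrite nsqM m1 mul1r. Qed.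

Lemma L2_unimodular (m : R -> R[i]) f : cmeasurable m ->
  (forall t, nsq (m t) = 1) -> L2 f -> L2 (fun t => m t * f t).
Proof.
move=> mm m1 [mf foo]; split; first exact: cmeasurableM.
by rewrite norm2_unimodular.
Qed.

Lemma L2B f g : L2 f -> L2 g -> L2 (fun t => f t - g t).
Proof.
move=> Lf Lg; have m1 : nsq (-1 : R[i]) = 1 by rewrite /nsq/=; ring.
have := L2D Lf (L2_unimodular (cmeasurable_cst (-1)) (fun=> m1) Lg).
by under eq_fun do rewrite mulN1r.
Qed.

Lemma norm2_translate f (x : R) : cmeasurable f -> norm2 (translate x f) = norm2 f.
Proof.
move=> mf; rewrite !norm2_cenergy; congr (_ `^ _)%E.
rewrite /cenergy/translate (ge0_integral_shift x (phi := fun t => (nsq (f t))%:E))//.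
- by apply/measurable_EFinP; exact: measurable_nsq.
- by move=> t; rewrite lee_fin nsq_ge0.
Qed.

Lemma L2_translate f (x : R) : L2 f -> L2 (translate x f).
Proof.
move=> [mf foo]; split; first exact: cmeasurable_translate.
by rewrite norm2_translate.
Qed.

Lemma norm2B_sym f g : norm2 (fun t => f t - g t) = norm2 (fun t => g t - f t).
Proof.
apply: eq_norm2 => t; rewrite -opprB -mulN1r nsqM.
by rewrite (_ : nsq (-1) = 1) ?mul1r// /nsq/=; ring.
Qed.

Lemma norm2_le_add f g : cmeasurable f -> cmeasurable g ->
  (norm2 f <= norm2 g + norm2 (fun t => f t - g t)%R)%E.
Proof.
move=> mf mg; apply: le_trans (norm2D_le mg (cmeasurableB mf mg)).
by under [X in (_ <= norm2 X)%E]eq_fun do rewrite addrC subrK.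
Qed.

Lemma cvg_norm2D (u v : nat -> R -> R[i]) :
  (forall n, cmeasurable (u n)) -> (forall n, cmeasurable (v n)) ->
  norm2 (u n) @[n --> \oo] --> 0%E -> norm2 (v n) @[n --> \oo] --> 0%E ->
  norm2 (fun t => u n t + v n t) @[n --> \oo] --> 0%E.
Proof.
move=> mu_ mv u0 v0.
apply: (@squeeze_cvge _ _ _ _ (cst 0%E) _ (fun n => norm2 (u n) + norm2 (v n))%E).
- by apply: nearW => n; rewrite norm2_ge0/=; exact: norm2D_le.
- exact: cvg_cst.
- by rewrite -[X in _ --> X](adde0 0%E); apply: cvgeD.
Qed.

Lemma cintegrable_inner f g : L2 f -> L2 g ->
  cintegrable setT (fun t => f t * conjc (g t)).
Proof.
move=> /L2P[fr fi] /L2P[gr gi].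
have rr := sqintM_integrable fr gr; have ii := sqintM_integrable fi gi.
have ri := sqintM_integrable fr gi; have ir := sqintM_integrable fi gr.
split.
  apply: eq_integrable (integrableD_EFin rr ii) => // t _.
  by rewrite cReM Re_conjc Im_conjc; congr EFin; ring.
apply: eq_integrable (integrableB_EFin ir ri) => // t _.
by rewrite cImM Re_conjc Im_conjc; congr EFin; ring.
Qed.

Lemma integrable_nsq f : L2 f -> mu.-integrable setT (fun t => (nsq (f t))%:E).
Proof.
by move=> /L2P[fr fi]; exact: integrableD_EFin (sqint_integrable fr) (sqint_integrable fi).
Qed.

Lemma L2_cenergyE f : L2 f -> cenergy f = (Rintegral mu setT (fun t => nsq (f t)))%:E.
Proof.
by move=> Lf; rewrite /Rintegral fineK//; exact: integrable_fin_num (integrable_nsq Lf).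
Qed.

(** The polarization identity from which Parseval's formula is deduced. *)
Lemma cenergyD f g : L2 f -> L2 g -> cenergy (fun t => f t + g t) =
  (fine (cenergy f) + fine (cenergy g) + 2 * complex.Re (inner f g))%:E.
Proof.
move=> Lf Lg; rewrite !L2_cenergyE//; last exact: L2D.
have [ir _] := cintegrable_inner Lf Lg.
rewrite /inner/cintegral/= -RintegralZl// -!RintegralD//.
- congr EFin; apply: eq_Rintegral => t _.
  by rewrite /nsq cReD cImD cReM Re_conjc Im_conjc; ring.
- exact: integrableD_EFin (integrable_nsq Lf) (integrable_nsq Lg).
- exact: integrableZl_EFin.
- exact: integrable_nsq.
- exact: integrable_nsq.
Qed.

Lemma Im_inner f g : complex.Im (inner f g) = complex.Re (inner f (fun t => (0 +i* 1) * g t)).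
Proof.
apply: eq_Rintegral => t _.
by rewrite cImM cReM !Re_conjc !Im_conjc cReM cImM/=; ring.
Qed.

Lemma L2_imaginary f : L2 f -> L2 (fun t => (0 +i* 1) * f t).
Proof.
apply: L2_unimodular => [|_]; first exact: cmeasurable_cst.
by rewrite /nsq/=; ring.
Qed.

End complex_L2.

(** * The Plancherel and Parseval formulas *)

Section cintegral_theory.
Context {R : realType}.
Local Notation mu := (@lebesgue_measure R).
Implicit Types (f g u v h k : R -> R[i]).

Lemma eq_cintegral (D : set R) f g : (forall t, D t -> f t = g t) ->
  cintegral D f = cintegral D g.
Proof.
move=> fg; congr (_ +i* _); apply: eq_Rintegral => t /set_mem Dt; by rewrite fg.
Qed.

Lemma cintegrable_measurable f : cintegrable setT f -> cmeasurable f.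
Proof.
by move=> [ir ii]; split; apply/measurable_EFinP; [exact: measurable_int ir|exact: measurable_int ii].
Qed.

Lemma cintegrableD f g : cintegrable setT f -> cintegrable setT g ->
  cintegrable setT (fun t => f t + g t).
Proof.
move=> [fr fi] [gr gi]; split.
  by under eq_fun do rewrite cReD; exact: integrableD_EFin.
by under eq_fun do rewrite cImD; exact: integrableD_EFin.
Qed.

Lemma cintegralD f g : cintegrable setT f -> cintegrable setT g ->
  cintegral setT (fun t => f t + g t) = cintegral setT f + cintegral setT g.
Proof.
move=> [fr fi] [gr gi]; rewrite /cintegral.
by congr (_ +i* _); rewrite -RintegralD//; apply: eq_Rintegral => t _; [exact: cReD|exact: cImD].
Qed.

Lemma cintegrable_bounded (m : R -> R[i]) f (M : R) : cmeasurable m ->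
  (forall t, `|complex.Re (m t)| <= M) -> (forall t, `|complex.Im (m t)| <= M) ->
  cintegrable setT f -> cintegrable setT (fun t => m t * f t).
Proof.
move=> [mr mi] rM iM [fr fi]; split.
  under eq_fun do rewrite cReM ![complex.Re (m _) * _]mulrC ![complex.Im (m _) * _]mulrC.
  by apply: integrableB_EFin; exact: (integrable_bounded_mul (M := M)).
under eq_fun do rewrite cImM ![complex.Re (m _) * _]mulrC ![complex.Im (m _) * _]mulrC.
by apply: integrableD_EFin; exact: (integrable_bounded_mul (M := M)).
Qed.

Lemma cintegrableZ (c : R[i]) f : cintegrable setT f -> cintegrable setT (fun t => c * f t).
Proof.
apply: (cintegrable_bounded (M := Num.max `|complex.Re c| `|complex.Im c|)).
- exact: cmeasurable_cst.
- by move=> _; rewrite le_max lexx.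
- by move=> _; rewrite le_max lexx orbT.
Qed.

Lemma cintegralZ (c : R[i]) f : cintegrable setT f ->
  cintegral setT (fun t => c * f t) = c * cintegral setT f.
Proof.
move=> [fr fi]; case: c => a b; rewrite /cintegral.
congr (_ +i* _); rewrite -!RintegralZl//=.
  rewrite -RintegralB//; [|exact: integrableZl_EFin|exact: integrableZl_EFin].
  by apply: eq_Rintegral => t _; rewrite cReM.
rewrite -RintegralD//; [|exact: integrableZl_EFin|exact: integrableZl_EFin].
by apply: eq_Rintegral => t _; rewrite cImM.
Qed.

Lemma cintegrable_conjc f : cintegrable setT f ->
  cintegrable setT (fun t => conjc (f t)).
Proof.
move=> [fr fi]; split.
  by apply: eq_integrable fr => // t _; rewrite Re_conjc.
apply: eq_integrable (integrableZl_EFin (-1) fi) => // t _.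
by rewrite Im_conjc mulN1r.
Qed.

Lemma cintegral_conjc f : cintegrable setT f ->
  cintegral setT (fun t => conjc (f t)) = conjc (cintegral setT f).
Proof.
move=> [fr fi]; rewrite /cintegral/=; congr (_ +i* _).
  by apply: eq_Rintegral => t _; rewrite Re_conjc.
rewrite -mulN1r -RintegralZl//; apply: eq_Rintegral => t _.
by rewrite Im_conjc mulN1r.
Qed.

Lemma cintegral_translate (x : R) f : cmeasurable f ->
  cintegral setT (translate x f) = cintegral setT f.
Proof.
move=> [fr fi]; congr (_ +i* _).
  exact: (Rintegral_shift x fr).
exact: (Rintegral_shift x fi).
Qed.

Lemma cintegrable_translate (x : R) f : cintegrable setT f ->
  cintegrable setT (translate x f).
Proof.
move=> [fr fi]; split; [exact: (integrable_shift x fr)|exact: (integrable_shift x fi)].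
Qed.

Lemma cmeasurable_character (xi : R) : cmeasurable (fun t : R => cexpi (- (2 * pi * t * xi))).
Proof.
rewrite (_ : (fun t => _) = (fun t => cexpi (- (2 * pi * xi) * t))).
  exact: cmeasurable_cexpi.
by apply/funext => t; congr cexpi; ring.
Qed.

Lemma cintegrable_fourier f (xi : R) : cintegrable setT f ->
  cintegrable setT (fun t => f t * cexpi (- (2 * pi * t * xi))).
Proof.
move=> intf; under eq_fun do rewrite mulrC.
apply: (cintegrable_bounded (M := 1)) => //.
- exact: cmeasurable_character.
- by move=> t; rewrite cos_max.
- by move=> t; rewrite sin_max.
Qed.

Lemma cexpiD (a b : R) : cexpi (a + b) = cexpi a * cexpi b.
Proof.
apply/eqP; rewrite eq_complex/= cosD sinD; apply/andP; split; apply/eqP => //.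
by rewrite addrC mulrC [X in _ + X]mulrC addrC.
Qed.

Lemma conjc_cexpi (a : R) : conjc (cexpi a) = cexpi (- a).
Proof. by rewrite /cexpi/= cosN sinN. Qed.

Lemma fourierD f g xi : cintegrable setT f -> cintegrable setT g ->
  fourier (fun t => f t + g t) xi = fourier f xi + fourier g xi.
Proof.
move=> If Ig; rewrite -cintegralD; try exact: cintegrable_fourier.
by apply: eq_cintegral => t _; rewrite mulrDl.
Qed.

Lemma fourierZ (c : R[i]) f xi : cintegrable setT f ->
  fourier (fun t => c * f t) xi = c * fourier f xi.
Proof.
move=> If; rewrite -cintegralZ; last exact: cintegrable_fourier.
by apply: eq_cintegral => t _; rewrite mulrA.
Qed.

Lemma fourierB f g xi : cintegrable setT f -> cintegrable setT g ->
  fourier (fun t => f t - g t) xi = fourier f xi - fourier g xi.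
Proof.
move=> If Ig; transitivity (fourier (fun t => f t + (-1) * g t) xi).
  by congr fourier; apply/funext => t; rewrite mulN1r.
by rewrite fourierD ?fourierZ ?mulN1r//; exact: cintegrableZ.
Qed.

Lemma fourier_translate (x : R) f xi : cintegrable setT f ->
  fourier (translate x f) xi = cexpi (- (2 * pi * x * xi)) * fourier f xi.
Proof.
move=> If; have Ie := cintegrable_fourier xi If.
rewrite -cintegralZ// -(@cintegral_translate x _ (cintegrable_measurable (cintegrableZ _ Ie))).
apply: eq_cintegral => t _; rewrite /translate mulrCA -cexpiD; congr (_ * cexpi _); ring.
Qed.

Lemma fourierE f xi : cintegrable setT f ->
  fourier f xi =
    (fcos (fun t => complex.Re (f t)) xi + fsin (fun t => complex.Im (f t)) xi) +i*
    (fcos (fun t => complex.Im (f t)) xi - fsin (fun t => complex.Re (f t)) xi).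
Proof.
move=> [fr fi]; rewrite /fourier/cintegral; congr (_ +i* _).
  rewrite -RintegralD//; [|exact: integrable_fcos|exact: integrable_fsin].
  by apply: eq_Rintegral => t _; rewrite cReM/= cosN sinN mulrN opprK.
rewrite -RintegralB//; [|exact: integrable_fcos|exact: integrable_fsin].
by apply: eq_Rintegral => t _; rewrite cImM/= cosN sinN mulrN addrC.
Qed.

Lemma cmeasurable_fourier f : cintegrable setT f -> cmeasurable (fourier f).
Proof.
move=> If; have [mr mi] := cintegrable_measurable If.
have -> := funext (fun xi => fourierE xi If); split => /=.
  by apply: measurable_funD; [exact: measurable_fcos|exact: measurable_fsin].
by apply: measurable_funB; [exact: measurable_fcos|exact: measurable_fsin].
Qed.

(** Adding the values at [xi] and [- xi] cancels the mixed terms between the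
    real and the imaginary part of [f]. *)
Lemma nsq_fourier_add f xi : cintegrable setT f ->
  nsq (fourier f xi) + nsq (fourier f (- xi)) =
  2 * (spectral_density (fun t => complex.Re (f t)) xi +
       spectral_density (fun t => complex.Im (f t)) xi).
Proof.
move=> If; have [fr fi] := If; rewrite !fourierE// /nsq/= !fcosN !fsinN//.
by rewrite /spectral_density; ring.
Qed.

Lemma plancherel_L1 f : cintegrable setT f -> L2 f -> cenergy (fourier f) = cenergy f.
Proof.
move=> If Lf; have [fr fi] := If; have [sr si] := (L2P f).1 Lf.
have mF := measurable_nsq (cmeasurable_fourier If).
pose P xi := (nsq (fourier f xi))%:E.
have mP : measurable_fun setT P by apply/measurable_EFinP.
have P0 xi : (0 <= P xi)%E by rewrite lee_fin nsq_ge0.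
have mPN : measurable_fun setT (fun xi : R => P (- xi)) by exact: measurableT_comp.
have E2 : (cenergy (fourier f) + cenergy (fourier f) = 2%:E * cenergy f)%E.
  rewrite -{2}[cenergy _](ge0_integral_opp (phi := P))// -ge0_integralD//;
    last by move=> x _; exact: P0.
  under eq_integral do rewrite -EFinD nsq_fourier_add// EFinM.
  have mS a : sqint a -> measurable_fun setT (EFin \o spectral_density a).
    by move=> ia; apply/measurable_EFinP; exact: measurable_spectral_density.
  rewrite ge0_integralZl_EFin//.
  - under eq_integral do rewrite EFinD.
    rewrite ge0_integralD//.
    + by rewrite !integral_spectral_density// -cenergyE//; case: Lf.
    + by move=> x _; rewrite lee_fin spectral_density_ge0.
    + exact: mS.
    + by move=> x _; rewrite lee_fin spectral_density_ge0.
    + exact: mS.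
  - by move=> x _; rewrite lee_fin addr_ge0 ?spectral_density_ge0.
  - by under eq_fun do rewrite EFinD; apply: emeasurable_funD; exact: mS.
have := cenergy_ge0 (fourier f); move: E2; rewrite (L2_cenergyE Lf).
case: (cenergy (fourier f)) => [r|//|//] /= [rE] _; congr EFin; lra.
Qed.

Lemma L2_fourier f : cintegrable setT f -> L2 f -> L2 (fourier f).
Proof.
move=> If Lf; split; first exact: cmeasurable_fourier.
by apply/norm2_lty; rewrite plancherel_L1//; apply/norm2_lty; case: Lf.
Qed.

Lemma norm2_fourier f : cintegrable setT f -> L2 f -> norm2 (fourier f) = norm2 f.
Proof. by move=> If Lf; rewrite !norm2_cenergy plancherel_L1. Qed.

Lemma is_fourierL2_L1 f : cintegrable setT f -> L2 f -> is_fourierL2 f (fourier f).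
Proof.
move=> If Lf; split => //; first exact: L2_fourier.
have n0 g : norm2 (fun t => g t - g t) = 0%E.
  rewrite norm2_cenergy/cenergy; under eq_integral do rewrite subrr/nsq/= expr0n/= addr0.
  by rewrite integral0 poweR0r.
exists (fun=> f); split => //.
  by under eq_fun do rewrite n0; exact: cvg_cst.
by under eq_fun do rewrite n0; exact: cvg_cst.
Qed.

Lemma is_fourierL2D f g h k : is_fourierL2 f h -> is_fourierL2 g k ->
  is_fourierL2 (fun t => f t + g t) (fun xi => h xi + k xi).
Proof.
move=> [Lf Lh [u [Iu uf uh]]] [Lg Lk [v [Iv vg vk]]].
split; [exact: L2D|exact: L2D|exists (fun n t => u n t + v n t)]; split.
- move=> n; have [Iun Lun] := Iu n; have [Ivn Lvn] := Iv n.
  by split; [exact: cintegrableD|exact: L2D].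
- have -> : (fun n => norm2 (fun t => u n t + v n t - (f t + g t))) =
      (fun n => norm2 (fun t => (u n t - f t) + (v n t - g t))).
    by apply/funext => n; congr norm2; apply/funext => t; rewrite opprD addrACA.
  apply: cvg_norm2D => // n.
    by have [_ Lun] := Iu n; apply: L2_cmeasurable; exact: L2B.
  by have [_ Lvn] := Iv n; apply: L2_cmeasurable; exact: L2B.
- have -> : (fun n => norm2 (fun xi => fourier (fun t => u n t + v n t) xi - (h xi + k xi))) =
      (fun n => norm2 (fun xi => (fourier (u n) xi - h xi) + (fourier (v n) xi - k xi))).
    apply/funext => n; congr norm2; apply/funext => xi.
    by rewrite fourierD ?opprD 1?addrACA//; [case: (Iu n)|case: (Iv n)].
  apply: cvg_norm2D => // n.
    by have [Iun Lun] := Iu n; apply: L2_cmeasurable; apply: L2B => //; exact: L2_fourier.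
  by have [Iun Lun] := Iv n; apply: L2_cmeasurable; apply: L2B => //; exact: L2_fourier.
Qed.

Lemma is_fourierL2_imaginary f h : is_fourierL2 f h ->
  is_fourierL2 (fun t => (0 +i* 1) * f t) (fun xi => (0 +i* 1) * h xi).
Proof.
have i1 (t : R) : nsq ((0 +i* 1) : R[i]) = 1 by rewrite /nsq/=; ring.
move=> [Lf Lh [u [Iu uf uh]]].
split; [exact: L2_imaginary|exact: L2_imaginary|exists (fun n t => (0 +i* 1) * u n t)]; split.
- move=> n; have [Iun Lun] := Iu n.
  by split; [exact: cintegrableZ|exact: L2_imaginary].
- rewrite (_ : (fun n => _) = (fun n => norm2 (fun t => u n t - f t)))//.
  apply/funext => n; rewrite -[RHS](norm2_unimodular _ i1).
  by congr norm2; apply/funext => t; rewrite mulrBr.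
- rewrite (_ : (fun n => _) = (fun n => norm2 (fun t => fourier (u n) t - h t)))//.
  apply/funext => n; rewrite -[RHS](norm2_unimodular _ i1).
  congr norm2; apply/funext => t; rewrite mulrBr fourierZ//.
  by case: (Iu n).
Qed.

Lemma is_fourierL2_translate (x : R) f h : is_fourierL2 f h ->
  is_fourierL2 (translate x f) (fun xi => cexpi (- (2 * pi * x * xi)) * h xi).
Proof.
have mc : cmeasurable (fun xi : R => cexpi (- (2 * pi * x * xi))).
  under eq_fun do rewrite -mulNr; exact: cmeasurable_cexpi.
move=> [Lf Lh [u [Iu uf uh]]]; split.
- exact: L2_translate.
- by apply: L2_unimodular => // xi; exact: nsq_cexpi.
exists (fun n => translate x (u n)); split.
- move=> n; have [Iun Lun] := Iu n.
  by split; [exact: cintegrable_translate|exact: L2_translate].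
- rewrite (_ : (fun n => _) = (fun n => norm2 (fun t => u n t - f t)))//.
  apply/funext => n; rewrite -[RHS](@norm2_translate _ (fun t => u n t - f t) x)//.
  by apply: L2_cmeasurable; apply: L2B => //; case: (Iu n).
- rewrite (_ : (fun n => _) = (fun n => norm2 (fun t => fourier (u n) t - h t)))//.
  apply/funext => n; rewrite -[RHS](norm2_unimodular _ (fun xi => nsq_cexpi (- (2 * pi * x * xi)))).
  congr norm2; apply/funext => t; rewrite mulrBr fourier_translate//.
  by case: (Iu n).
Qed.

Lemma lee_cvg0D (x y : \bar R) (d : nat -> \bar R) : (forall n, 0 <= d n)%E ->
  (forall n, x <= y + d n)%E -> d @ \oo --> 0%E -> (x <= y)%E.
Proof.
move=> d0 xyd /(ge0_cvge0P d0) H; apply/lee_addgt0Pr => e e0.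
have [n _ /(_ n (leqnn n)) dn] := H e e0.
by rewrite (le_trans (xyd n))// leeD2l// ltW.
Qed.

(** Plancherel's formula passes to the limit by the triangle inequality. *)
Lemma norm2_is_fourierL2 f h : is_fourierL2 f h -> norm2 f = norm2 h.
Proof.
move=> [Lf Lh [u [Iu uf uh]]].
have mf := L2_cmeasurable Lf; have mh := L2_cmeasurable Lh.
have mu_ n : cmeasurable (u n) by case: (Iu n) => _ [].
have mF n : cmeasurable (fourier (u n)).
  by apply: cmeasurable_fourier; case: (Iu n).
have Fu n : norm2 (fourier (u n)) = norm2 (u n).
  by case: (Iu n) => *; exact: norm2_fourier.
have sum0 : (norm2 (fun t => u n t - f t)%R + norm2 (fun xi => fourier (u n) xi - h xi)%R)%E
    @[n --> \oo] --> 0%E.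
  by rewrite -[X in _ --> X](adde0 0%E); apply: cvgeD.
apply/eqP; rewrite eq_le; apply/andP; split; apply: (lee_cvg0D _ _ sum0) => n;
  rewrite ?adde_ge0 ?norm2_ge0//.
  rewrite (le_trans (norm2_le_add mf (mu_ n)))// -Fu norm2B_sym addeC.
  by rewrite addeCA leeD2l// norm2_le_add.
rewrite (le_trans (norm2_le_add mh (mF n)))// Fu norm2B_sym addeA leeD2r//.
exact: norm2_le_add.
Qed.

(** By polarization the isometry preserves real parts of inner products; the
    imaginary part is the real part of the product with ['i * g]. *)
Theorem parseval f g h k : is_fourierL2 f h -> is_fourierL2 g k ->
  inner f g = inner h k.
Proof.
move=> fh gk.
have Re_inner g' k' : is_fourierL2 g' k' ->
    complex.Re (inner f g') = complex.Re (inner h k').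
  move=> gk'; have [Lf Lh _] := fh; have [Lg Lk _] := gk'.
  have Efh : cenergy f = cenergy h by rewrite !cenergy_norm2 (norm2_is_fourierL2 fh).
  have Egk : cenergy g' = cenergy k' by rewrite !cenergy_norm2 (norm2_is_fourierL2 gk').
  have := norm2_is_fourierL2 (is_fourierL2D fh gk').
  move/(congr1 (fun x => x `^ 2)%E); rewrite -!cenergy_norm2 !cenergyD// Efh Egk.
  by move/eqP; rewrite eqe => /eqP; lra.
have R1 := Re_inner _ _ gk; have R2 := Re_inner _ _ (is_fourierL2_imaginary gk).
apply/eqP; rewrite eq_complex; apply/andP; split; apply/eqP; first exact: R1.
rewrite (Im_inner f g) (Im_inner h k); exact: R2.
Qed.

End cintegral_theory.

(** * Surjectivity of the Fourier transform on L^2 *)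

Section multiplication_formula.
Context {R : realType}.
Local Notation mu := (@lebesgue_measure R).
Implicit Types (f g u p q h k : R -> R[i]) (z w : R[i]).

Lemma conjcM z w : conjc (z * w) = conjc z * conjc w.
Proof.
by case: z => a b; case: w => c d; apply/eqP; rewrite eq_complex/=; apply/andP; split; apply/eqP; ring.
Qed.

(** A submultiplicative bound for the real part that is integrable together with
    both components, which is what domination requires. *)
Definition norm1 z : R := `|complex.Re z| + `|complex.Im z|.

Lemma norm1_ge0 z : 0 <= norm1 z.
Proof. by rewrite addr_ge0. Qed.

Lemma le_Re_norm1 z : `|complex.Re z| <= norm1 z.
Proof. by rewrite lerDl. Qed.

Lemma norm1M z w : norm1 (z * w) <= norm1 z * norm1 w.
Proof.
rewrite /norm1 cReM cImM.
apply: (@le_trans _ _ ((`|complex.Re z * complex.Re w| + `|complex.Im z * complex.Im w|) +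
   (`|complex.Re z * complex.Im w| + `|complex.Im z * complex.Re w|))).
  by rewrite lerD// ?ler_normB// ler_normD.
by rewrite !normrM; move: `|_| `|_| `|_| `|_| => a b c d; rewrite le_eqVlt; apply/orP; left; apply/eqP; ring.
Qed.

Lemma norm1_conjc z : norm1 (conjc z) = norm1 z.
Proof. by rewrite /norm1 Re_conjc Im_conjc normrN. Qed.

Lemma norm1_cexpi (a : R) : norm1 (cexpi a) <= 2.
Proof. by rewrite /norm1/= mulr2n lerD// ?cos_max ?sin_max. Qed.

Lemma integrable_norm1 f : cintegrable setT f ->
  mu.-integrable setT (fun t => (norm1 (f t))%:E).
Proof. by move=> [fr fi]; apply: integrableD_EFin; exact: integrable_norm. Qed.

(** Fubini's theorem moves the character from one factor to the other. *)
Lemma Re_inner_fourier u p : cintegrable setT u -> cintegrable setT p ->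
  complex.Re (inner (fourier u) p) =
  complex.Re (inner u (fun t => fourier p (- t))).
Proof.
move=> Iu Ip.
have [mur mui] := cintegrable_measurable Iu.
have [mpr mpi] := cintegrable_measurable Ip.
pose Phi (z : R * R) := complex.Re (conjc (p z.1) * (u z.2 * cexpi (- (2 * pi * z.2 * z.1)))).
transitivity (Rintegral mu setT (fun xi => Rintegral mu setT (fun t => Phi (xi, t)))).
  apply: eq_Rintegral => xi _; rewrite mulrC.
  by rewrite -(cintegralZ (conjc (p xi)) (cintegrable_fourier xi Iu)).
rewrite (@Rintegral_swap_dominated R Phi (fun xi => norm1 (p xi)) (fun t => norm1 (u t) * 2)).
- apply: eq_Rintegral => t _.
  have Ic := cintegrable_fourier (- t) Ip.
  rewrite -(cintegral_conjc Ic) -(cintegralZ (u t) (cintegrable_conjc Ic)).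
  apply: eq_Rintegral => xi _; congr complex.Re; rewrite /Phi/=.
  rewrite conjcM conjc_cexpi mulrCA; congr (_ * (_ * cexpi _)); ring.
- rewrite /Phi; under eq_fun do rewrite cReM cReM cImM Re_conjc Im_conjc /= cosN sinN.
  have mc : measurable_fun setT (fun z : R * R => cos (2 * pi * z.2 * z.1)).
    exact: measurableT_comp measurable_cos measurable_phase.
  have ms : measurable_fun setT (fun z : R * R => - sin (2 * pi * z.2 * z.1)).
    by apply: measurableT_comp => //; exact: measurableT_comp measurable_sin measurable_phase.
  have m1 a : measurable_fun setT a -> measurable_fun setT (fun z : R * R => a z.1 : R).
    by move=> ma; exact: measurableT_comp ma measurable_fst.
  have m2 a : measurable_fun setT a -> measurable_fun setT (fun z : R * R => a z.2 : R).
    by move=> ma; exact: measurableT_comp ma measurable_snd.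
  apply: measurable_funB; apply: measurable_funM.
  + exact: m1 mpr.
  + by apply: measurable_funB; apply: measurable_funM => //; [exact: m2 mur|exact: m2 mui].
  + by apply: measurableT_comp => //; exact: m1 mpi.
  + by apply: measurable_funD; apply: measurable_funM => //; [exact: m2 mur|exact: m2 mui].
- exact: integrable_norm1.
- under eq_fun do rewrite mulrC; apply: integrableZl_EFin; exact: integrable_norm1.
- move=> xi t; rewrite /Phi/=; apply: le_trans (le_Re_norm1 _) _.
  apply: le_trans (norm1M _ _) _; rewrite norm1_conjc ler_wpM2l ?norm1_ge0//.
  by apply: le_trans (norm1M _ _) _; rewrite ler_wpM2l ?norm1_ge0// norm1_cexpi.
Qed.

Definition cwindow (n : nat) f : R -> R[i] :=
  fun t => if `|t| <= n%:R then f t else 0.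

Lemma sqint_window1 n : sqint (window n (fun=> 1 : R)).
Proof.
split; first exact: measurable_window.
have -> : energy (window n (fun=> 1 : R)) = mu `[- n%:R, n%:R].
  rewrite -[X in mu X]setIT -integral_indic//.
  apply: eq_integral => t _; rewrite indicE /window ler_norml.
  rewrite (_ : (t \in _) = (- n%:R <= t <= n%:R)).
    by case: ifP => _; rewrite ?expr1n ?expr0n.
  by apply/idP/idP; rewrite inE/= in_itv.
by rewrite lebesgue_measure_itv/=; case: ifPn => // _; rewrite -EFinB ltry.
Qed.

Lemma cwindowE n f : cwindow n f =
  (fun t => window n (fun t => complex.Re (f t)) t +i* window n (fun t => complex.Im (f t)) t).
Proof.
apply/funext => t; rewrite /cwindow/window; case: ifP => // _.
by case: (f t).
Qed.

Lemma L2_cwindow n f : L2 f -> L2 (cwindow n f).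
Proof.
move=> /L2P[fr fi]; rewrite cwindowE; apply/L2P; split.
  apply: (le_sqint _ _ fr); first by apply: measurable_window; case: fr.
  by move=> t; rewrite /window; case: ifP => _ //; rewrite normr0.
apply: (le_sqint _ _ fi); first by apply: measurable_window; case: fi.
by move=> t; rewrite /window; case: ifP => _ //; rewrite normr0.
Qed.

Lemma cintegrable_cwindow n f : L2 f -> cintegrable setT (cwindow n f).
Proof.
move=> /L2P[fr fi]; rewrite cwindowE; split.
  apply: eq_integrable (sqintM_integrable (sqint_window1 n) fr) => // t _ /=.
  by rewrite /window; case: ifP => _; rewrite ?mul1r ?mul0r.
apply: eq_integrable (sqintM_integrable (sqint_window1 n) fi) => // t _ /=.
by rewrite /window; case: ifP => _; rewrite ?mul1r ?mul0r.
Qed.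

Lemma nsq0 : nsq (0 : R[i]) = 0.
Proof. by rewrite /nsq/= expr0n addr0. Qed.

Lemma cwindow_cvg f : L2 f ->
  cenergy (fun t => f t - cwindow n f t) @[n --> \oo] --> 0%E.
Proof.
move=> Lf; rewrite (_ : 0%E = (\int[mu]_x (cst 0 x)%:E)%E); last by rewrite integral0.
apply: (@cvg_integral_dominated _ _ _ mu _ _ (fun x => nsq (f x))) => //.
- move=> n; apply: measurable_nsq; apply: L2_cmeasurable; apply: L2B => //.
  exact: L2_cwindow.
- apply: aeW => x; apply: cvg_near_cst; near=> n; rewrite /cwindow.
  have -> : `|x| <= n%:R by near: n; exact: near_norm_le.
  by rewrite subrr nsq0.
- exact: integrable_nsq.
- move=> n x; rewrite ger0_norm ?nsq_ge0// /cwindow.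
  by case: ifP => _; rewrite ?subr0// subrr nsq0 nsq_ge0.
Unshelve. all: by end_near. Qed.

Lemma Re_inner_cwindow n q : L2 q ->
  complex.Re (inner (cwindow n q) q) = fine (cenergy (cwindow n q)).
Proof.
move=> Lq; rewrite L2_cenergyE/=; last exact: L2_cwindow.
apply: eq_Rintegral => t _; rewrite /cwindow; case: ifP => _.
  by rewrite cReM Re_conjc Im_conjc /nsq; ring.
by rewrite mul0r nsq0.
Qed.

Lemma cenergyB f g : L2 f -> L2 g -> cenergy (fun t => f t - g t) =
  (fine (cenergy f) + fine (cenergy g) - 2 * complex.Re (inner f g))%:E.
Proof.
move=> Lf Lg.
have m1 : nsq (-1 : R[i]) = 1 by rewrite /nsq/=; ring.
have Lg' := L2_unimodular (cmeasurable_cst (-1)) (fun=> m1) Lg.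
have := cenergyD Lf Lg'.
have -> : cenergy (fun t => -1 * g t) = cenergy g.
  by apply: eq_integral => t _; rewrite nsqM m1 mul1r.
have -> : complex.Re (inner f (fun t => -1 * g t)) = - complex.Re (inner f g).
  have [ifg _] := cintegrable_inner Lf Lg.
  rewrite /inner/cintegral/= -[RHS]mulN1r -RintegralZl//.
  by apply: eq_Rintegral => t _; rewrite !cReM !Re_conjc !Im_conjc cReM cImM/=; ring.
by under eq_fun do rewrite mulN1r; rewrite mulrN.
Qed.

Lemma cenergy_reflect f : cmeasurable f -> cenergy (fun t => f (- t)) = cenergy f.
Proof.
move=> mf; rewrite /cenergy (ge0_integral_opp (phi := fun t => (nsq (f t))%:E))//.
- by apply/measurable_EFinP; exact: measurable_nsq.
- by move=> t; rewrite lee_fin nsq_ge0.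
Qed.

Lemma L2_reflect f : L2 f -> L2 (fun t => f (- t)).
Proof.
move=> [mf foo]; have [mr mi] := mf; split.
  by split; [exact: (measurableT_comp mr)|exact: (measurableT_comp mi)].
by apply/norm2_lty; rewrite cenergy_reflect//; apply/norm2_lty.
Qed.

(** Windowed inversion: by the multiplication formula the distance from [p] to
    the transform of the windowed inverse transform is the energy left outside
    the window. *)
Lemma cenergy_fourier_inversion n p : cintegrable setT p -> L2 p ->
  let q := fun t => fourier p (- t) in
  cenergy (fun xi => fourier (cwindow n q) xi - p xi) =
  cenergy (fun t => q t - cwindow n q t).
Proof.
move=> Ip Lp q; have LFp := L2_fourier Ip Lp.
have Lq : L2 q by exact: L2_reflect.
have Iw := cintegrable_cwindow n Lq; have Lw := L2_cwindow n Lq.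
have LFw := L2_fourier Iw Lw.
have Eq : cenergy q = cenergy p.
  by rewrite /q cenergy_reflect ?plancherel_L1//; exact: L2_cmeasurable.
have -> : cenergy (fun t => q t - cwindow n q t) = cenergy (fun t => cwindow n q t - q t).
  by rewrite !cenergy_norm2 norm2B_sym.
by rewrite !cenergyB// Re_inner_fourier// Re_inner_cwindow// plancherel_L1// Eq.
Qed.

(** First cut [h] off to make it integrable, then cut off the inverse transform
    of the result. *)
Lemma fourier_approx h (e : R) : L2 h -> 0 < e ->
  exists u, [/\ cintegrable setT u, L2 u &
    (norm2 (fun xi => fourier u xi - h xi)%R < e%:E)%E].
Proof.
move=> Lh e0; have e20 : 0 < e / 2 by rewrite divr_gt0.
have [m _ /(_ m (leqnn m)) hm] :=
  (ge0_cvge0P (fun n => norm2_ge0 _)).1 ((cvg_norm2P _).2 (cwindow_cvg Lh)) _ e20.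
pose p := cwindow m h; have Ip := cintegrable_cwindow m Lh; have Lp := L2_cwindow m Lh.
pose q t := fourier p (- t).
have Lq : L2 q by apply: L2_reflect; exact: L2_fourier.
have [n _ /(_ n (leqnn n)) qn] :=
  (ge0_cvge0P (fun n => norm2_ge0 _)).1 ((cvg_norm2P _).2 (cwindow_cvg Lq)) _ e20.
exists (cwindow n q); have Iw := cintegrable_cwindow n Lq; have Lw := L2_cwindow n Lq.
split => //.
have LF := L2_fourier Iw Lw.
have := norm2D_le (L2_cmeasurable (L2B LF Lp)) (L2_cmeasurable (L2B Lp Lh)).
under [X in (norm2 X <= _)%E]eq_fun do rewrite addrA subrK.
move=> /le_lt_trans; apply.
rewrite (splitr e) EFinD lteD// ?(norm2B_sym p h)//.
by rewrite norm2_cenergy cenergy_fourier_inversion// -norm2_cenergy.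
Qed.

(** As the transform is an isometry, functions whose transforms converge rapidly
    to [h] form a rapidly converging sequence. *)
Theorem fourierL2_surj h : L2 h -> exists f, is_fourierL2 f h.
Proof.
move=> Lh.
have e0 n : 0 < 4^-1 ^+ n :> R by rewrite exprn_gt0// invr_gt0.
(* the squared norm of an increment is then at most [4 * 16^-n], within the
   rate [8^-n] that completeness asks for *)
have /choice[u Hu] : forall n, exists u, [/\ cintegrable setT u, L2 u &
    (norm2 (fun xi => fourier u xi - h xi)%R < (4^-1 ^+ n)%:E)%E].
  by move=> n; exact: fourier_approx.
have Iu n : cintegrable setT (u n) by case: (Hu n).
have Lu n : L2 (u n) by case: (Hu n).
have uh n : (norm2 (fun xi => fourier (u n) xi - h xi)%R < (4^-1 ^+ n)%:E)%E by case: (Hu n).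
have LF n : L2 (fourier (u n)) by exact: L2_fourier.
have inc n : (cenergy (fun t => u n.+1 t - u n t)%R <= (4 * 8^-1 ^+ n)%:E)%E.
  have Id : cintegrable setT (fun t => u n.+1 t - u n t).
    have := cintegrableD (Iu n.+1) (cintegrableZ (-1) (Iu n)).
    by under eq_fun do rewrite mulN1r.
  have d0 : 0 < 2 * 4^-1 ^+ n :> R by rewrite mulr_gt0.
  apply: (@le_trans _ _ ((2 * 4^-1 ^+ n) ^+ 2)%:E).
    apply/ltW/norm2_lt => //; rewrite -norm2_fourier//; last exact: L2B.
    rewrite (eq_norm2 (g := fun xi => fourier (u n.+1) xi - fourier (u n) xi)); last first.
      by move=> xi; rewrite fourierB.
    have := norm2D_le (L2_cmeasurable (L2B (LF n.+1) Lh)) (L2_cmeasurable (L2B Lh (LF n))).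
    under [X in (norm2 X <= _)%E]eq_fun do rewrite addrA subrK.
    move=> /le_lt_trans; apply; rewrite mulrDl mul1r EFinD lteD//.
      by rewrite (lt_le_trans (uh n.+1))// lee_fin exprS ler_piMl ?(ltW (e0 n))// invf_le1 ?ler1n.
    by rewrite norm2B_sym.
  rewrite lee_fin exprMn -exprM mulnC exprM.
  have -> : 2 ^+ 2 = 4 :> R by ring.
  rewrite ler_wpM2l// lerXn2r ?nnegrE ?invr_ge0 ?exprn_ge0 ?invr_ge0//.
  by rewrite expr2; lra.
have part_le f : cmeasurable f -> (energy (fun t => complex.Re (f t)) <= cenergy f)%E /\
    (energy (fun t => complex.Im (f t)) <= cenergy f)%E.
  by move=> mf; rewrite cenergyE//; split; [rewrite leeDl|rewrite leeDr]; rewrite ?energy_ge0.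
have md n : cmeasurable (fun t => u n.+1 t - u n t) by apply: L2_cmeasurable; exact: L2B.
have [||l sl ul] := @energy_complete _ (fun n t => complex.Re (u n t)) 4 _ (fun n => ((L2P _).1 (Lu n)).1).
- by [].
- move=> n; apply: le_trans (inc n); apply: le_trans (part_le _ (md n)).1.
  by under [X in (_ <= energy X)%E]eq_fun do rewrite cReB.
have [||m sm um] := @energy_complete _ (fun n t => complex.Im (u n t)) 4 _ (fun n => ((L2P _).1 (Lu n)).2).
- by [].
- move=> n; apply: le_trans (inc n); apply: le_trans (part_le _ (md n)).2.
  by under [X in (_ <= energy X)%E]eq_fun do rewrite cImB.
pose f t := l t +i* m t.
have Lf : L2 f by apply/L2P.
exists f; split => //; exists u; split => //.
  apply/cvg_norm2P.
  rewrite (_ : (fun n => cenergy _) = (fun n =>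
      energy (fun t => complex.Re (u n t) - l t)%R + energy (fun t => complex.Im (u n t) - m t)%R)%E).
    by rewrite -[X in _ --> X](adde0 0%E); apply: cvgeD.
  apply/funext => n; rewrite cenergyE; last by apply: L2_cmeasurable; exact: L2B.
  by congr (energy _ + energy _)%E; apply/funext => t; rewrite ?cReB ?cImB.
apply: (@squeeze_cvge _ _ _ _ (cst 0%E) _ (fun n => (4^-1 ^+ n)%:E)).
- by apply: nearW => n; rewrite norm2_ge0 ltW.
- exact: cvg_cst.
- apply: cvg_EFin; first exact: nearW.
  by apply: cvg_expr; rewrite ger0_norm ?invr_ge0// invf_lt1// ltr1n.
Qed.

Lemma inv_fourierL2P h : L2 h -> is_fourierL2 (inv_fourierL2 h) h.
Proof. move=> /fourierL2_surj[f fh].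
by apply: (@xgetPex _ (cst 0) [set f | is_fourierL2 f h]); exists f. Qed.

End multiplication_formula.

(** * Kernels of constant mass *)

Section weighted_kernel.
Context {R : realType}.
Local Notation mu := (@lebesgue_measure R).
(** The mass of [A] over [x] is prescribed only where [psi] does not vanish: for
    the kernel of the atoms it is zero outside [D], where the functions of
    interest vanish. *)
Variables (A : R * R -> R) (c : R) (psi : R -> R).
Hypotheses (mA : measurable_fun setT A) (A0 : forall z, 0 <= A z)
  (intpsi : mu.-integrable setT (EFin \o psi))
  (massA : forall t, psi t != 0 -> (\int[mu]_x (A (x, t))%:E = c%:E)%E).

Let Phi z : R := psi z.2 * A z.

Let mpsi : measurable_fun setT psi.
Proof. by apply/measurable_EFinP; exact: measurable_int intpsi. Qed.

Let mPhi : measurable_fun setT Phi.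
Proof. by apply: measurable_funM => //; exact: measurableT_comp mpsi measurable_snd. Qed.

Let mA1 t : measurable_fun setT (fun x => (A (x, t))%:E).
Proof. by apply/measurable_EFinP; exact: (measurableT_comp mA (pair2_measurable t)). Qed.

Let mass_mul t : (\int[mu]_x (Phi (x, t))%:E = (c * psi t)%:E)%E.
Proof.
rewrite /Phi/=; have [->|psit] := eqVneq (psi t) 0.
  by under eq_integral do rewrite mul0r; rewrite integral0 mulr0.
under eq_integral do rewrite EFinM.
rewrite integralZl//; first by rewrite massA// -EFinM mulrC.
apply/integrableP; split; first exact: mA1.
by under eq_integral do rewrite gee0_abs ?lee_fin//; rewrite massA// ltry.
Qed.

Let mass_norm t : (\int[mu]_x `|(Phi (x, t))%:E| = (c * `|psi t|)%:E)%E.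
Proof.
rewrite /Phi/=; have [->|psit] := eqVneq (psi t) 0.
  by under eq_integral do rewrite mul0r normr0; rewrite integral0 normr0 mulr0.
under eq_integral do rewrite normrM (ger0_norm (A0 _)) EFinM.
rewrite ge0_integralZl_EFin//; try exact: mA1; try by move=> x _; rewrite lee_fin.
by rewrite massA// -EFinM mulrC.
Qed.

Lemma integrable_weighted_kernel :
  (mu \x mu)%E.-integrable setT (EFin \o Phi : _ -> \bar R).
Proof.
have mE : measurable_fun setT (EFin \o Phi) by apply/measurable_EFinP.
apply/(@integrable21ltyP _ _ (measurableTypeR R) (measurableTypeR R)) => //.
rewrite [X in (X < _)%E](_ : _ = \int[mu]_t (c * `|psi t|)%:E)%E; last first.
  by apply: eq_integral => t _; exact: mass_norm.
apply: integrable_lty => //; apply: integrableZl_EFin; exact: integrable_norm.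
Qed.

Lemma ae_integrable_weighted_kernel :
  {ae mu, forall x, mu.-integrable setT (fun t => (psi t * A (x, t))%:E)}.
Proof. exact: ae_integrable1 integrable_weighted_kernel. Qed.

Let F x := Rintegral mu setT (fun t => psi t * A (x, t)).

Let Fe := fubini_F mu (EFin \o Phi : R * R -> \bar R).

Let iFe : mu.-integrable setT Fe.
Proof. exact: integrable_fubini_F integrable_weighted_kernel. Qed.

Let mF : measurable_fun setT (fun x => (F x)%:E).
Proof. by apply/measurable_EFinP; exact: measurable_fun_Rintegral_lebesgue mPhi. Qed.

(** The real-valued integral agrees with the extended one where the latter is
    finite and is 0 elsewhere, so it is dominated by it. *)
Lemma integrable_Rintegral_weighted_kernel : mu.-integrable setT (fun x => (F x)%:E).
Proof.
apply: le_integrable iFe => // x _; rewrite /F/Rintegral.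
by rewrite /Fe/fubini_F/=; case: (\int[mu]_y _)%E => [r||] //=; rewrite normr0 leey.
Qed.

Lemma Rintegral_weighted_kernel : Rintegral mu setT F = c * Rintegral mu setT psi.
Proof.
rewrite -RintegralZl//; congr fine.
transitivity (\int[mu]_x Fe x)%E.
  apply: ae_eq_integral => //; first exact: measurable_int iFe.
  apply: filterS (integrable_ae measurableT iFe) => x Fx _.
  by rewrite /F/Rintegral fineK//; exact: Fx.
rewrite /Fe/fubini_F (@Fubini _ _ (measurableTypeR R) (measurableTypeR R))//.
  by apply: eq_integral => t _; exact: mass_mul.
exact: integrable_weighted_kernel.
Qed.

End weighted_kernel.

(** * The warped atoms *)

Section warped_atoms.
Context {R : realType}.
Local Notation mu := (@lebesgue_measure R).
Variables (D : set R) (F : R -> R) (theta : R -> R[i]).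
Hypotheses (oD : open D) (iD : is_interval D) (wF : warping_function D F)
  (wtheta : L2w (warping_weight D F) theta) (Ltheta : L2 theta).

Let mD : measurable D. Proof. exact: open_measurable. Qed.

Let bijF : set_bij D setT F. Proof. by case: wF. Qed.
Let dF : {in D, forall t, derivable F t 1}. Proof. by case: wF => _ []. Qed.
Let cF' : {in D, forall t, {for t, continuous (derive1 F)}}.
Proof. by case: wF => _ []. Qed.
Let F'gt0 : {in D, forall t, 0 < derive1 F t}. Proof. by case: wF. Qed.

Local Notation Fb := (F \_ D).
Local Notation F'b := (derive1 F \_ D).

Let mFb : measurable_fun setT Fb.
Proof. by apply/(measurable_restrictT _ mD); exact: measurable_bij_C1. Qed.

Let mF'b : measurable_fun setT F'b.
Proof. by apply/(measurable_restrictT _ mD); exact: measurable_derive_bij_C1. Qed.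

Let F'b_ge0 x : 0 <= F'b x.
Proof. by rewrite patchE; case: ifPn => // xD; rewrite ltW// F'gt0. Qed.

(** The derivative of the inverse function. *)
Lemma warping_weightE t : D t -> warping_weight D F (F t) * derive1 F t = 1.
Proof.
move=> Dt; have tD := mem_set Dt.
have injF : {in D &, injective F} by case: bijF.
have nD : \forall s \near t, D s by exact: open_nbhs_nbhs.
have : is_derive (F t) 1 (pinv D F) (derive1 F t)^-1.
  apply: is_derive_inverse.
  - by apply: filterS nD => s Ds; rewrite pinvKV//; exact: mem_set.
  - apply: filterS nD => s Ds; apply/differentiable_continuous/derivable1_diffP.
    by apply: dF; exact: mem_set.
  - by rewrite derive1E; apply/derivableP; exact: dF.
  - by rewrite gt_eqF// F'gt0.
move=> dP; rewrite /warping_weight derive1E derive_val mulVf//.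
by rewrite gt_eqF// F'gt0.
Qed.

(** The atom [g_x] at [t] as a function of the pair [(x, t)]. Replacing [F] and
    its derivative by 0 outside [D] makes it jointly Borel, and zero when [x]
    or [t] is outside [D]. *)
Definition warped_kernel (z : R * R) : R[i] :=
  (\1_D z.2 * Num.sqrt (F'b z.1))%:C * theta (Fb z.2 - Fb z.1).

Lemma warped_atom_freqE x : D x ->
  warped_atom_freq D F theta x = (fun t => warped_kernel (x, t)).
Proof.
move=> Dx; apply/funext => t.
rewrite /warped_atom_freq /warped_kernel/= indicE !patchE (mem_set Dx) /patch.
case: ifPn => tD; first by rewrite mul1r.
by rewrite mul0r mul0r.
Qed.

Lemma cmeasurable_warped_kernel : cmeasurable_fun warped_kernel.
Proof.
apply: cmeasurable_funM.
  split => /=; last exact: measurable_cst.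
  apply: measurable_funM.
    apply: measurableT_comp measurable_snd; exact: measurable_indic.
  apply: (measurableT_comp (continuous_measurable_fun (@sqrt_continuous R))).
  exact: measurableT_comp mF'b measurable_fst.
apply: cmeasurable_fun_comp; first by case: Ltheta.
apply: measurable_funB.
  exact: measurableT_comp mFb measurable_snd.
exact: measurableT_comp mFb measurable_fst.
Qed.

Lemma nsq_warped_kernel x t :
  nsq (warped_kernel (x, t)) = \1_D t * F'b x * nsq (theta (Fb t - Fb x)).
Proof.
rewrite /warped_kernel nsqM/=; congr (_ * _).
rewrite /nsq/= expr0n addr0 exprMn sqr_sqrtr//.
by rewrite indicE; case: (t \in D); rewrite ?expr1n// expr0n.
Qed.

Lemma nsq_warped_kernel_off x t : ~ D x -> nsq (warped_kernel (x, t)) = 0.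
Proof.
move=> Dx; rewrite nsq_warped_kernel.
have -> : F'b x = 0 by rewrite patchE memNset.
by rewrite mulr0 mul0r.
Qed.

Lemma measurable_nsq_warped_kernel :
  measurable_fun setT (fun z => nsq (warped_kernel z)).
Proof. exact/measurable_fun_nsq/cmeasurable_warped_kernel. Qed.

(** The total mass over [x] does not depend on [t]: the substitution by [F]
    turns it into the energy of [theta]. *)
Lemma mass_warped_kernel t : D t ->
  (\int[mu]_x (nsq (warped_kernel (x, t)))%:E = cenergy theta)%E.
Proof.
move=> Dt.
pose phi s := (nsq (theta (F t - s)))%:E.
have mtheta : cmeasurable theta by case: Ltheta.
have mphi : measurable_fun setT phi.
  apply/measurable_EFinP; apply: measurable_fun_nsq.
  apply: cmeasurable_fun_comp => //; exact: measurable_funB.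
have phi0 s : (0 <= phi s)%E by rewrite lee_fin nsq_ge0.
transitivity (\int[mu]_x phi x)%E.
  rewrite -(ge0_integral_substitution oD iD bijF dF cF' F'gt0 mphi phi0).
  rewrite [RHS]integral_mkcond; apply: eq_integral => x _.
  rewrite nsq_warped_kernel indicE (mem_set Dt) mul1r patchE !patchE (mem_set Dt).
  by case: ifPn => xD; [rewrite EFinM|rewrite mul0r].
rewrite -(ge0_integral_opp (phi := phi))//.
pose phi' s := (nsq (theta s))%:E.
have mphi' : measurable_fun setT phi' by apply/measurable_EFinP; exact: measurable_nsq.
rewrite -[RHS](ge0_integral_shift (- F t) (phi := phi'))//.
  by apply: eq_integral => s _; rewrite /phi/phi' !opprK addrC.
by move=> s; rewrite lee_fin nsq_ge0.
Qed.

(** As [w (F t) * F' t = 1], moderateness bounds the unweighted energy of an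
    atom by the weighted energy of [theta]. *)
Lemma L2_warped_kernel x : D x -> L2 (fun t => warped_kernel (x, t)).
Proof.
move=> Dx; have [mr mi] := cmeasurable_warped_kernel.
have mk : cmeasurable (fun t => warped_kernel (x, t)).
  by split; [exact: (measurableT_comp mr (pair1_measurable x))|
             exact: (measurableT_comp mi (pair1_measurable x))].
split => //; apply/norm2_lty.
case: wF => _ _ _ _ [[v [v0 _ w0 [C Cw]]] _].
pose w := warping_weight D F.
(* [rho] is [w * |theta|^2], in the form in which its measurability is given *)
pose rho s := nsq ((Num.sqrt (w s))%:C * theta s).
have rhoE s : rho s = w s * nsq (theta s).
  by rewrite /rho nsqM; congr (_ * _); rewrite /nsq/= expr0n addr0 sqr_sqrtr// ltW// w0.
pose phi s := (rho (s - F x))%:E.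
have mphi : measurable_fun setT phi.
  apply/measurable_EFinP; apply: (measurableT_comp (measurable_nsq wtheta.1)).
  exact: measurable_funB.
have phi0 s : (0 <= phi s)%E by rewrite lee_fin nsq_ge0.
have phi_lty : (\int[mu]_s phi s < +oo)%E.
  rewrite (ge0_integral_shift (F x) (phi := fun s => (rho s)%:E)).
  - by have [_ /norm2_lty] := wtheta.
  - by apply/measurable_EFinP; exact: (measurable_nsq wtheta.1).
  - by move=> s; rewrite lee_fin nsq_ge0.
have C0 : 0 <= C.
  have := Cw 0 0; rewrite addr0 => /(lt_le_trans (w0 0)).
  by rewrite pmulr_lgt0// pmulr_lgt0// => /ltW.
pose K := F'b x * (C * v (F x)).
have K0 : 0 <= K by rewrite mulr_ge0// mulr_ge0// ltW.
apply: (@le_lt_trans _ _ (K%:E * \int[mu]_s phi s)%E); last first.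
  by rewrite lte_mul_pinfty ?lee_fin.
rewrite -(ge0_integral_substitution oD iD bijF dF cF' F'gt0 mphi phi0).
rewrite [X in (_ <= _ * X)%E]integral_mkcond.
pose G t := F'b t * rho (Fb t - F x).
have mG : measurable_fun setT G.
  apply: measurable_funM => //; apply: (measurableT_comp (measurable_nsq wtheta.1)).
  exact: measurable_funB.
have G0 t : 0 <= G t by rewrite mulr_ge0// nsq_ge0.
rewrite (_ : _ \_ D = EFin \o G); last first.
  apply/funext => t; rewrite patchE /= /G !patchE.
  by case: ifPn => tD; [rewrite EFinM|rewrite mul0r].
rewrite -ge0_integralZl_EFin//; first last.
- by apply/measurable_EFinP.
- by move=> t _; rewrite lee_fin.
apply: ge0_le_integral => //.
- by move=> t _; rewrite lee_fin nsq_ge0.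
- by apply/measurable_EFinP; exact: measurable_nsq.
- by apply/measurable_EFinP; exact: measurable_funM.
move=> t _; rewrite /= -EFinM lee_fin nsq_warped_kernel /G /K !patchE (mem_set Dx) indicE.
case: ifPn => tD; last by rewrite !mul0r mulr0.
rewrite mul1r -!mulrA ler_wpM2l//; first by rewrite ltW// F'gt0// mem_set.
rewrite rhoE; have wt := warping_weightE (set_mem tD).
have := Cw (F x) (F t - F x); rewrite addrC subrK => Cwt.
have F't := ltW (F'gt0 tD).
have N0 := nsq_ge0 (theta (F t - F x)).
apply: (@le_trans _ _ (warping_weight D F (F t) * derive1 F t * nsq (theta (F t - F x)))).
  by rewrite wt mul1r.
apply: (@le_trans _ _ (C * v (F x) * warping_weight D F (F t - F x) * derive1 F t * nsq (theta (F t - F x)))).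
  by rewrite ler_wpM2r// ler_wpM2r.
by rewrite le_eqVlt; apply/orP; left; apply/eqP; rewrite /w; ring.
Qed.

End warped_atoms.

(** * Weak inversion *)

Section inversion.
Context {R : realType}.
Local Notation mu := (@lebesgue_measure R).

#[local] Instance ae_lebesgue_filter : Filter (nbhs (almost_everywhere mu)).
Proof. exact: ae_filter_ringOfSetsType. Qed.

Lemma inner_conjc (f g : R -> R[i]) : L2 f -> L2 g -> inner f g = conjc (inner g f).
Proof.
move=> Lf Lg; rewrite -cintegral_conjc; last exact: cintegrable_inner.
by apply: eq_cintegral => t _; rewrite conjcM conjcK mulrC.
Qed.

Lemma cintegral_reflect (f : R -> R[i]) : cmeasurable f ->
  cintegral setT (fun t => f (- t)) = cintegral setT f.
Proof.
by move=> [fr fi]; congr (_ +i* _); [exact: (Rintegral_opp fr)|exact: (Rintegral_opp fi)].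
Qed.

(** Borel measurability does not pass from [G] to an almost everywhere equal [u];
    this is why a Borel function [v] that agrees with [u] on [D] is
    required. *)
Lemma ae_eq_Rintegral_on (D : set R) (u v G : R -> R) : measurable D ->
  measurable_fun setT v -> (forall x, D x -> u x = v x) ->
  {ae mu, forall x, D x -> u x = G x} -> mu.-integrable setT (EFin \o G) ->
  (forall x, ~ D x -> G x = 0) ->
  mu.-integrable D (EFin \o u) /\ Rintegral mu D u = Rintegral mu setT G.
Proof.
move=> mD mv uv uG intG G0.
have mu_ : measurable_fun D (EFin \o u).
  apply: (@eq_measurable_fun _ _ _ _ _ (EFin \o v)).
    by move=> x /set_mem Dx /=; rewrite uv.
  by apply/measurable_EFinP; exact: measurable_funTS.
have intGD : mu.-integrable D (EFin \o G) by exact: integrableS intG.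
have mG := measurable_int _ intGD.
have GD : G \_ D = G.
  apply/funext => x; rewrite patchE; case: ifPn => // xD.
  by rewrite G0// => Dx; move: xD; rewrite mem_set.
split; last first.
  rewrite -GD -Rintegral_mkcond; congr fine; apply: ae_eq_integral => //.
  by apply: filterS uG => x ux Dx; rewrite /= ux.
apply/integrableP; split => //.
have /integrableP[_] := intGD; congr (_ < _)%E.
apply: ae_eq_integral => //.
- exact: measurableT_comp.
- exact: measurableT_comp.
- by apply: filterS uG => x ux Dx; rewrite /= ux.
Qed.

Variables (D : set R) (F : R -> R) (theta : R -> R[i]).
Hypotheses (oD : open D) (iD : is_interval D) (wF : warping_function D F)
  (wtheta : L2w (warping_weight D F) theta) (Ltheta : L2 theta).

Let K := warped_kernel D F theta.
Let A z := nsq (K z).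

Let cK : cmeasurable_fun K. Proof. exact: cmeasurable_warped_kernel. Qed.

Let mA : measurable_fun setT A. Proof. exact: measurable_nsq_warped_kernel. Qed.

Let A0 z : 0 <= A z. Proof. exact: nsq_ge0. Qed.

Let LK x : D x -> L2 (fun t => K (x, t)). Proof. exact: L2_warped_kernel. Qed.

(** The product [h * conj g_x], whose transform gives the coefficients of [f]
    at [x]. *)
Let slice (h : R -> R[i]) x t := h t * conjc (K (x, t)).

Let T : R := fine (cenergy theta).

Let TE : cenergy theta = T%:E.
Proof. by rewrite /T L2_cenergyE. Qed.

Lemma cmeasurable_slice h x : cmeasurable h -> cmeasurable (slice h x).
Proof.
move=> mh; apply: cmeasurableM => //; apply: cmeasurable_conjc.
by have [mr mi] := cK; split; [exact: (measurableT_comp mr (pair1_measurable x))|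
  exact: (measurableT_comp mi (pair1_measurable x))].
Qed.

Lemma warped_transformE f h x xi : is_fourierL2 f h -> D x ->
  warped_transform D F theta f x xi = fourier (slice h x) (- xi).
Proof.
move=> fh Dx; have Lg : L2 (warped_atom_freq D F theta x).
  by rewrite warped_atom_freqE//; exact: LK.
rewrite /warped_transform (parseval fh (is_fourierL2_translate xi (inv_fourierL2P Lg))).
apply: eq_cintegral => t _.
rewrite /slice conjcM conjc_cexpi warped_atom_freqE// [cexpi _ * _]mulrC mulrA.
by congr (_ * cexpi _); ring.
Qed.

Lemma inner_warped_atom f h x xi : is_fourierL2 f h -> D x ->
  inner (warped_atom D F theta x xi) f = conjc (fourier (slice h x) (- xi)).
Proof.
move=> fh Dx; have Lg : L2 (warped_atom_freq D F theta x).
  by rewrite warped_atom_freqE//; exact: LK.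
have [Lf _ _] := fh.
have [La _ _] := is_fourierL2_translate xi (inv_fourierL2P Lg).
rewrite inner_conjc//; congr conjc; exact: warped_transformE.
Qed.

(** The energy of [slice h x], integrated over [x], is the energy of [h] times
    that of [theta]. *)
Lemma ae_L2_slice h : L2on D h -> {ae mu, forall x, L2 (slice h x)}.
Proof.
move=> [Lh h0].
have mass t : nsq (h t) != 0 -> (\int[mu]_x (A (x, t))%:E = T%:E)%E.
  move=> ht; rewrite -TE; apply: mass_warped_kernel => //.
  by apply: contrapT => /h0 ht0; move: ht; rewrite ht0 nsq0 eqxx.
apply: filterS (ae_integrable_weighted_kernel mA A0 (integrable_nsq Lh) mass) => x intx.
split; first by apply: cmeasurable_slice; case: Lh.
apply/norm2_lty; rewrite /cenergy/slice.
under eq_integral do rewrite nsqM nsq_conjc.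
exact: integrable_lty intx.
Qed.

Lemma cintegrable_slice h x : L2 h -> D x -> cintegrable setT (slice h x).
Proof. by move=> Lh Dx; apply: cintegrable_inner => //; exact: LK. Qed.

Lemma cmeasurable_fourier_slice h : cmeasurable h ->
  cmeasurable_fun (fun z : R * R => fourier (slice h z.1) z.2).
Proof.
move=> mh.
pose Phi (y : (R * R) * R) := h y.2 * conjc (K (y.1.1, y.2)) *
  cexpi (- (2 * pi * y.2 * y.1.2)).
have [mr mi] : cmeasurable_fun Phi.
  apply: cmeasurable_funM.
    apply: cmeasurable_funM; first by apply: cmeasurable_fun_comp => //; exact: measurable_snd.
    apply: cmeasurable_fun_conjc; have [Kr Ki] := cK.
    have mz : measurable_fun setT (fun y : (R * R) * R => (y.1.1, y.2)).
      apply/measurable_fun_pairP; split; last exact: measurable_snd.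
      exact: measurableT_comp measurable_fst measurable_fst.
    by split; [exact: measurableT_comp Kr mz|exact: measurableT_comp Ki mz].
  have mp : measurable_fun setT (fun y : (R * R) * R => - (2 * pi * y.2 * y.1.2)).
    apply: measurableT_comp => //; apply: measurable_funM.
      by apply: measurable_funM => //; exact: measurable_snd.
    exact: measurableT_comp measurable_snd measurable_fst.
  by split; [exact: measurableT_comp measurable_cos mp|exact: measurableT_comp measurable_sin mp].
by split; [exact: (@measurable_fun_Rintegral _ _ (R * R)%type (measurableTypeR R) R mu _ mr)|
  exact: (@measurable_fun_Rintegral _ _ (R * R)%type (measurableTypeR R) R mu _ mi)].
Qed.

(** The integrand of the reconstruction formula for [x] in [D], in a form that
    is jointly Borel. *)
Let coef h h2 x xi : R[i] :=
  fourier (slice h x) (- xi) * conjc (fourier (slice h2 x) (- xi)).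

Let cmeasurable_coef h h2 : cmeasurable h -> cmeasurable h2 ->
  cmeasurable_fun (fun z : R * R => coef h h2 z.1 z.2).
Proof.
move=> mh mh2; have mz : measurable_fun setT (fun z : R * R => (z.1, - z.2)).
  apply/measurable_fun_pairP; split; first exact: measurable_fst.
  rewrite (_ : snd \o _ = (fun z : R * R => 0 - z.2)).
    by apply: measurable_funB => //; exact: measurable_snd.
  by apply/funext => z /=; rewrite sub0r.
have [hr hi] := cmeasurable_fourier_slice mh.
have [kr ki] := cmeasurable_fourier_slice mh2.
apply: cmeasurable_funM; first by split; [exact: measurableT_comp hr mz|exact: measurableT_comp hi mz].
apply: cmeasurable_fun_conjc.
by split; [exact: measurableT_comp kr mz|exact: measurableT_comp ki mz].
Qed.

(** Parseval's formula in [xi]. *)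
Let cintegral_coef h h2 x : L2on D h -> L2on D h2 -> D x ->
  L2 (slice h x) -> L2 (slice h2 x) ->
  cintegrable setT (coef h h2 x) /\
  cintegral setT (coef h h2 x) =
    Rintegral mu setT (fun t => complex.Re (h t * conjc (h2 t)) * A (x, t)) +i*
    Rintegral mu setT (fun t => complex.Im (h t * conjc (h2 t)) * A (x, t)).
Proof.
move=> [Lh _] [Lh2 _] Dx Lp Lq.
have Ip := cintegrable_slice Lh Dx; have Iq := cintegrable_slice Lh2 Dx.
have LFp := L2_fourier Ip Lp; have LFq := L2_fourier Iq Lq.
split; first exact: cintegrable_inner (L2_reflect LFp) (L2_reflect LFq).
rewrite (@cintegral_reflect (fun xi => fourier (slice h x) xi * conjc (fourier (slice h2 x) xi))); last first.
  apply: cmeasurableM; first exact: L2_cmeasurable.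
  by apply: cmeasurable_conjc; exact: L2_cmeasurable.
rewrite -[LHS]/(inner _ _) -(parseval (is_fourierL2_L1 Ip Lp) (is_fourierL2_L1 Iq Lq)).
congr (_ +i* _); apply: eq_Rintegral => t _; rewrite /slice /A;
  case: (h t) => a b; case: (h2 t) => a2 b2; case: (K _) => a3 b3; rewrite /nsq/=; ring.
Qed.

Let A_off x t : ~ D x -> A (x, t) = 0.
Proof.
by move=> Dx; exact: nsq_warped_kernel_off.
Qed.

Lemma weak_inversion f f2 : inv_fourier_image D f -> inv_fourier_image D f2 ->
  let k := fun x xi => warped_transform D F theta f x xi *
    inner (warped_atom D F theta x xi) f2 in
  [/\ {ae mu, forall x, D x -> cintegrable setT (k x)},
      cintegrable D (fun x => cintegral setT (k x)) &
      cintegral D (fun x => cintegral setT (k x)) = T%:C * inner f f2].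
Proof.
move=> [h Lh fh] [h2 Lh2 fh2] k.
have mD : measurable D by exact: open_measurable.
have kE x : D x -> k x = coef h h2 x.
  by move=> Dx; apply/funext => xi; rewrite /k (warped_transformE _ fh)// (inner_warped_atom _ fh2).
have ae_k : {ae mu, forall x, D x -> cintegrable setT (k x) /\
    cintegral setT (k x) =
    Rintegral mu setT (fun t => complex.Re (h t * conjc (h2 t)) * A (x, t)) +i*
    Rintegral mu setT (fun t => complex.Im (h t * conjc (h2 t)) * A (x, t))}.
  apply: filterS2 (ae_L2_slice Lh) (ae_L2_slice Lh2) => x Lp Lq Dx.
  by rewrite kE//; exact: cintegral_coef.
have [cr ci] := cmeasurable_coef (L2_cmeasurable Lh.1) (L2_cmeasurable Lh2.1).
have [pr pi] := cintegrable_inner Lh.1 Lh2.1.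
have mass t : h t * conjc (h2 t) != 0 -> (\int[mu]_x (A (x, t))%:E = T%:E)%E.
  move=> ht; rewrite -TE; apply: mass_warped_kernel => //.
  by apply: contrapT => /Lh.2 ht0; move: ht; rewrite ht0 mul0r eqxx.
have massr t : complex.Re (h t * conjc (h2 t)) != 0 -> (\int[mu]_x (A (x, t))%:E = T%:E)%E.
  by move=> ht; apply: mass; apply: contra ht => /eqP ->.
have massi t : complex.Im (h t * conjc (h2 t)) != 0 -> (\int[mu]_x (A (x, t))%:E = T%:E)%E.
  by move=> ht; apply: mass; apply: contra ht => /eqP ->.
have off (psi : R -> R) x : ~ D x -> Rintegral mu setT (fun t => psi t * A (x, t)) = 0.
  move=> Dx; under eq_Rintegral do rewrite A_off// mulr0.
  by rewrite /Rintegral integral0.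
pose ur x := complex.Re (cintegral setT (k x)).
pose vr x := Rintegral mu setT (fun xi => complex.Re (coef h h2 x xi)).
pose Gr x := Rintegral mu setT (fun t => complex.Re (h t * conjc (h2 t)) * A (x, t)).
have mvr : measurable_fun setT vr by exact: (measurable_fun_Rintegral_lebesgue cr).
have uvr x : D x -> ur x = vr x by move=> Dx; rewrite /ur kE.
have uGr : {ae mu, forall x, D x -> ur x = Gr x}.
  by apply: filterS ae_k => x H Dx; rewrite /ur (H Dx).2.
have intGr : mu.-integrable setT (EFin \o Gr).
  exact: (integrable_Rintegral_weighted_kernel mA A0 pr massr).
have G0r x : ~ D x -> Gr x = 0 by exact: off.
have [int_ur Er] := ae_eq_Rintegral_on mD mvr uvr uGr intGr G0r.
pose ui x := complex.Im (cintegral setT (k x)).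
pose vi x := Rintegral mu setT (fun xi => complex.Im (coef h h2 x xi)).
pose Gi x := Rintegral mu setT (fun t => complex.Im (h t * conjc (h2 t)) * A (x, t)).
have mvi : measurable_fun setT vi by exact: (measurable_fun_Rintegral_lebesgue ci).
have uvi x : D x -> ui x = vi x by move=> Dx; rewrite /ui kE.
have uGi : {ae mu, forall x, D x -> ui x = Gi x}.
  by apply: filterS ae_k => x H Dx; rewrite /ui (H Dx).2.
have intGi : mu.-integrable setT (EFin \o Gi).
  exact: (integrable_Rintegral_weighted_kernel mA A0 pi massi).
have G0i x : ~ D x -> Gi x = 0 by exact: off.
have [int_ui Ei] := ae_eq_Rintegral_on mD mvi uvi uGi intGi G0i.
split; [|by split|].
  by apply: filterS ae_k => x H Dx; case: (H Dx).
rewrite (parseval fh fh2) -[LHS]/(Rintegral mu D ur +i* Rintegral mu D ui) Er Ei.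
rewrite /Gr /Gi (Rintegral_weighted_kernel mA A0 pr massr) (Rintegral_weighted_kernel mA A0 pi massi).
rewrite -[inner h h2]/(Rintegral mu setT _ +i* Rintegral mu setT _).
move: (Rintegral _ _ _) (Rintegral _ _ _) => a b.
by apply/eqP; rewrite eq_complex/= !mul0r subr0 addr0 !eqxx.
Qed.

End inversion.

Lemma norm2_sqr (R : realType) (g : R -> R[i]) : L2 g ->
  fine (norm2 g) ^+ 2 = fine (cenergy g).
Proof.
move=> Lg; rewrite norm2_cenergy poweR12_sqrt ?cenergy_ge0// L2_cenergyE//=.
by rewrite sqr_sqrtr//; apply: Rintegral_ge0 => t _; exact: nsq_ge0.
Qed.

Lemma cenergy_eq0 (R : realType) (g : R -> R[i]) : cmeasurable g -> cenergy g = 0%E ->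
  {ae (@lebesgue_measure R), forall t, g t = 0}.
Proof.
move=> mg g0.
have mn : measurable_fun setT (EFin \o (fun t => nsq (g t))).
  by apply/measurable_EFinP; exact: measurable_nsq.
have E : (\int[lebesgue_measure]_t `|(EFin \o (fun t => nsq (g t))) t| = 0)%E.
  by rewrite -g0; apply: eq_integral => t _; rewrite gee0_abs ?lee_fin ?nsq_ge0.
have H := (ae_eq_integral_abs (@lebesgue_measure R) measurableT mn).1 E.
by apply: filterS H => t /(_ Logic.I) [] /nsq_eq0.
Qed.

Theorem corollary4p3 (R : realType) (D : set R) (F : R -> R)
    (theta : R -> R[i])
    (hD : D = setT \/ D = [set t | 0 < t])
    (hF : warping_function D F)
    (htheta : L2w (warping_weight D F) theta /\ L2 theta)
    (htheta0 : ~ {ae (@lebesgue_measure R), forall t, theta t = 0})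
    (f : R -> R[i]) (hf : inv_fourier_image D f) :
  forall f2 : R -> R[i], inv_fourier_image D f2 ->
    let V := warped_transform D F theta f in
    let k := fun x xi => V x xi * inner (warped_atom D F theta x xi) f2 in
    [/\ {ae (@lebesgue_measure R), forall x, D x -> cintegrable setT (k x)},
        cintegrable D (fun x => cintegral setT (k x)) &
        inner f f2 =
          ((fine (norm2 theta) ^+ 2)^-1)%:C *
            cintegral D (fun x => cintegral setT (k x))].
Proof.
move=> f2 hf2 V k; have [wtheta Ltheta] := htheta.
have oD : open D.
  by case: hD => ->; [exact: openT|exact: open_gt].
have iD : is_interval D.
  case: hD => -> //= x y /= x0 _ z /andP[xz _]; exact: lt_le_trans xz.
have [aek ik kE] := weak_inversion oD iD hF wtheta Ltheta hf hf2.
split => //; rewrite kE norm2_sqr// mulrA -rmorphM/= mulVf ?mul1r//.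
apply/eqP => T0; apply: htheta0; apply: cenergy_eq0; first by case: Ltheta.
by rewrite -(@fineK _ (cenergy theta)) ?T0// L2_cenergyE.
Qed.
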